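(* Let $\tfrac12\le\gamma<1$ and let $m(q,\omega)$ be a smooth function on $\mathbb{R}\times\mathbb{S}^2$ satisfying $|(\langle q\rangle\partial_q)^k\partial_\omega^\alpha m(q,\omega)|\lesssim\langle q\rangle^{-1-2\gamma}$ for all $k,\alpha$. Set $$M(\omega)=\int_{-\infty}^\infty m(q,\omega)\,dq,\qquad \overline{M}=\frac1{4\pi}\int_{\mathbb{S}^2}M(\sigma)\,dS(\sigma),$$ and let $Q$ be a solution on $\mathbb{S}^2$ of $\Delta_\omega Q(\omega)=-M(\omega)+\overline{M}$. Let $\widetilde{\mathcal{G}_0}(q,\omega)$ be a smooth function with $|(\langle q\rangle\partial_q)^k\partial_\omega^\alpha\widetilde{\mathcal{G}_0}|\lesssim\langle q\rangle^{-2}$ for all $k,\alpha$, satisfying $$\int_{-\infty}^\infty\widetilde{\mathcal{G}_0}(q,\omega)\,dq=Q(\omega)\quad\text{for all }\omega\in\mathbb{S}^2.$$ Then there exists a smooth solution $\phi$ of $$\Box\phi+\frac{m(r-t,\omega)}{r^3}\,\chi\Big(\frac{\langle t-r\rangle}{r}\Big)=0$$ with the wave zone asymptotics $\phi\sim\mathcal{G}_0(r-t,\omega)/r$ as $r\to\infty$ with $r\sim t$, where $$\mathcal{G}_0(q,\omega)=\overline{M}\langle q\rangle^{-1}\chi_{q<0}(q)+\widetilde{\mathcal{G}_0}(q,\omega).$$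
   Context: Coordinates on $\mathbb{R}^{1+3}$ are $(t,x)$ with $x=r\omega$, $r=|x|$, $\omega\in\mathbb{S}^2$; $\Box=-\partial_t^2+\Delta_x$, $\Delta_\omega$ is the Laplacian on the unit sphere, and $\langle q\rangle=(1+q^2)^{1/2}$. $\chi$ is a smooth cutoff with $\chi(s)=1$ for $s<1/4$ and $\chi(s)=0$ for $s>1/2$. $\chi_{q<0}$ is a smooth cutoff with $\chi_{q<0}(s)=1$ for $s<-1$ and $\chi_{q<0}(s)=0$ for $s>0$. ''Wave zone asymptotics $\phi\sim A$'' means $A$ gives the leading term of $\phi$ as $r\to\infty$ with $r-t$ and $\omega$ fixed. *)

(* Defs.v *)
From Stdlib Require Import Reals Lra List.
From Coquelicot Require Import Coquelicot.
Open Scope R_scope.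

Definition jb (q : R) : R := sqrt (1 + q ^ 2).

Definition fun4 := R -> R -> R -> R -> R.

Inductive Idx := I0 | I1 | I2 | I3.

Definition pd (i : Idx) (f : fun4) : fun4 :=
  match i with
  | I0 => fun a b c d => Derive (fun s => f s b c d) a
  | I1 => fun a b c d => Derive (fun s => f a s c d) b
  | I2 => fun a b c d => Derive (fun s => f a b s d) c
  | I3 => fun a b c d => Derive (fun s => f a b c s) d
  end.

Definition ex_pd (i : Idx) (f : fun4) (a b c d : R) : Prop :=
  match i with
  | I0 => ex_derive (fun s => f s b c d) a
  | I1 => ex_derive (fun s => f a s c d) b
  | I2 => ex_derive (fun s => f a b s d) c
  | I3 => ex_derive (fun s => f a b c s) d
  end.

Definition cont4 (f : fun4) (a b c d : R) : Prop :=
  continuous (fun p : R * R * R * R =>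
                f (fst (fst (fst p))) (snd (fst (fst p))) (snd (fst p)) (snd p))
             (a, b, c, d).

Definition dparts (l : list Idx) (f : fun4) : fun4 :=
  fold_right pd f l.

Definition SmoothOn (U : R -> R -> R -> R -> Prop) (f : fun4) : Prop :=
  forall (l : list Idx) a b c d, U a b c d ->
    (forall i, ex_pd i (dparts l f) a b c d) /\ cont4 (dparts l f) a b c d.

Definition Smooth1 (f : R -> R) : Prop := forall (n : nat) (x : R), ex_derive_n f n x.

Definition nrm (x y z : R) : R := sqrt (x ^ 2 + y ^ 2 + z ^ 2).

Definition punct (q x y z : R) : Prop := x ^ 2 + y ^ 2 + z ^ 2 <> 0.

(* A function on R x S^2 is given as f q w1 w2 w3 (only values with |w| = 1
   matter); its degree-zero homogeneous extension in the x-variables: *)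
Definition homext (f : fun4) : fun4 :=
  fun q x y z => f q (x / nrm x y z) (y / nrm x y z) (z / nrm x y z).

Definition sph (Q : R -> R -> R -> R) : fun4 := fun _ w1 w2 w3 => Q w1 w2 w3.

(* Symbol operators: I0 acts as <q> d_q, I1..I3 act as d_{x_i}
   (angular derivatives, through the homogeneous extension). *)
Definition sop (i : Idx) (f : fun4) : fun4 :=
  match i with
  | I0 => fun q b c d => jb q * pd I0 f q b c d
  | _ => pd i f
  end.

Definition sops (l : list Idx) (f : fun4) : fun4 := fold_right sop f l.

Definition SymbolBound (f : fun4) (s : R) : Prop :=
  forall l : list Idx, exists C : R, forall q w1 w2 w3,
    w1 ^ 2 + w2 ^ 2 + w3 ^ 2 = 1 ->
    Rabs (sops l (homext f) q w1 w2 w3) <= C * Rpower (jb q) (- s).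

(* Laplace-Beltrami operator on S^2: Euclidean Laplacian of the
   degree-zero homogeneous extension, evaluated on the unit sphere. *)
Definition lapS (Q : R -> R -> R -> R) (w1 w2 w3 : R) : R :=
  let F := homext (sph Q) in
  pd I1 (pd I1 F) 0 w1 w2 w3 + pd I2 (pd I2 F) 0 w1 w2 w3
  + pd I3 (pd I3 F) 0 w1 w2 w3.

Definition intR (g : R -> R) : R :=
  RInt_gen g (Rbar_locally m_infty) (Rbar_locally p_infty).

Definition sphere_int (F : R -> R -> R -> R) : R :=
  RInt (fun th => RInt (fun ph =>
          F (sin th * cos ph) (sin th * sin ph) (cos th) * sin th) 0 (2 * PI))
       0 PI.

Definition box (phi : fun4) : fun4 :=
  fun t x y z => - pd I0 (pd I0 phi) t x y z + pd I1 (pd I1 phi) t x y z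
                 + pd I2 (pd I2 phi) t x y z + pd I3 (pd I3 phi) t x y z.

(* Main.v *)
(* A solution with the prescribed radiation field is the sum of two explicit pieces.

   The source decays like r^-3 along forward light cones, so its advanced potential
     (1/4 pi) int_0^oo rho int_{S^2} F(t + rho, x + rho sigma) dsigma drho
   converges; it solves the inhomogeneous equation and its radiation field vanishes.  With
   rho = (1 - s^2)/s^2 the integrand extends smoothly to s = 0 (null infinity), so it is an integral
   of a smooth function over a compact box.

   The homogeneous solution with radiation field G is the superposition of plane waves
     (1/2 pi) int_{S^2} (d_q G)(x . sigma - t, sigma) dsigma;
   by Archimedes' hat-box theorem r times it is G(q, omega) - G(q - 2r, omega) up to an error due
   to the variation of d_q G in sigma near omega, which is O(r^(-1/2)). *)
Require Import Defs.
From Stdlib Require Import Reals Lra Lia List FunctionalExtensionality Classical ClassicalEpsilon.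
From Coquelicot Require Import Coquelicot.
Open Scope R_scope.

(** * Finitely differentiable functions of several variables *)

(** Derivatives of every order have to be taken of iterated and improper integrals. All of them are
    therefore brought to one form: a [Ck] integrand on the whole of [env], integrated over a fixed
    compact box. This dictates the substitution: with 1 + rho = 1 / s^2 the scale s^2 is never
    negative, so the integrand is smooth for every real s and no one-sided derivative occurs at s =
    0, while the weight rho |d rho / ds| leaves a factor s.

    The forward cone suits the limit at fixed phase q: as a point of the cone at x turns away from
    the direction of x, its phase leaves q linearly in 1 - cos. The decay of m in the phase then
    confines the angular integral to few directions, and this is where a power of r is gained.

    Rotation invariance of the sphere enters only infinitesimally: a rotation field is a divergence
    in the two angles, so its integral vanishes. Both the hat-box theorem and the vanishing integral
    of the spherical Laplacian rest on this. *)

Definition env := nat -> R.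

Definition upd (v : env) (i : nat) (s : R) : env :=
  fun j => if Nat.eqb j i then s else v j.

(** Entries from n on are left free, so [cont n f v] forces f to take the value f v at every w that
    agrees with v below n. One type thus serves every number of variables, and integrating out
    coordinate n needs no reindexing. *)
Definition near (n : nat) (d : R) (v w : env) : Prop :=
  forall i, (i < n)%nat -> Rabs (w i - v i) < d.

Definition cont (n : nat) (f : env -> R) (v : env) : Prop :=
  forall eps, 0 < eps -> exists d, 0 < d /\
    forall w, near n d v w -> Rabs (f w - f v) < eps.

Definition PD (i : nat) (f : env -> R) : env -> R :=
  fun v => Derive (fun s => f (upd v i s)) (v i).

Definition pex (i : nat) (f : env -> R) (v : env) : Prop :=
  ex_derive (fun s => f (upd v i s)) (v i).

Definition Open (n : nat) (U : env -> Prop) : Prop :=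
  forall v, U v -> exists d, 0 < d /\ forall w, near n d v w -> U w.

(** Joint continuity is demanded at every order, not just existence of the iterated partials: it is
    what yields total differentiability and hence the chain rule. *)
Fixpoint Ck (n k : nat) (U : env -> Prop) (f : env -> R) : Prop :=
  (forall v, U v -> cont n f v) /\
  match k with
  | O => True
  | S k' => forall i, (i < n)%nat ->
              (forall v, U v -> pex i f v) /\ Ck n k' U (PD i f)
  end.

Definition All : env -> Prop := fun _ => True.

Lemma upd_eq v i s : upd v i s i = s.
Proof. unfold upd; now rewrite Nat.eqb_refl. Qed.

Lemma upd_neq v i j s : j <> i -> upd v i s j = v j.
Proof. intros H; unfold upd; apply Nat.eqb_neq in H; now rewrite H. Qed.

Lemma upd_upd v i a b : upd (upd v i a) i b = upd v i b.
Proof.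
  apply functional_extensionality; intros j; unfold upd.
  now destruct (Nat.eqb j i).
Qed.

Lemma upd_id v i : upd v i (v i) = v.
Proof.
  apply functional_extensionality; intros j; unfold upd.
  destruct (Nat.eqb_spec j i); congruence.
Qed.

Lemma upd_comm v i j a b : i <> j -> upd (upd v i a) j b = upd (upd v j b) i a.
Proof.
  intros H; apply functional_extensionality; intros l; unfold upd.
  destruct (Nat.eqb_spec l i), (Nat.eqb_spec l j); congruence.
Qed.

Lemma near_upd n d v i s : 0 < d -> Rabs (s - v i) < d -> near n d v (upd v i s).
Proof.
  intros Hd H j _. destruct (Nat.eq_dec j i) as [->|N].
  - now rewrite upd_eq.
  - rewrite upd_neq by easy. rewrite Rminus_diag, Rabs_R0; lra.
Qed.

Lemma near_le n d d' v w : d <= d' -> near n d v w -> near n d' v w.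
Proof. intros H N i Hi; specialize (N i Hi); lra. Qed.

Lemma Open_All n : Open n All.
Proof. intros v _; exists 1; split; [lra | easy]. Qed.

Lemma Open_and n U V : Open n U -> Open n V -> Open n (fun v => U v /\ V v).
Proof.
  intros HU HV v [Hu Hv].
  destruct (HU v Hu) as [d1 [P1 Q1]], (HV v Hv) as [d2 [P2 Q2]].
  exists (Rmin d1 d2); split; [now apply Rmin_glb_lt|].
  intros w Hw; split.
  - apply Q1; apply near_le with (2 := Hw); apply Rmin_l.
  - apply Q2; apply near_le with (2 := Hw); apply Rmin_r.
Qed.

Lemma cont_ext n U f g v : Open n U -> U v -> (forall w, U w -> f w = g w) ->
  cont n f v -> cont n g v.
Proof.
  intros HU Hv E C eps He.
  destruct (C eps He) as [d1 [P1 Q1]], (HU v Hv) as [d2 [P2 Q2]].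
  exists (Rmin d1 d2); split; [now apply Rmin_glb_lt|].
  intros w Hw. rewrite <- !E; trivial.
  - apply Q1; apply near_le with (2 := Hw); apply Rmin_l.
  - apply Q2; apply near_le with (2 := Hw); apply Rmin_r.
Qed.

Lemma locally_upd n U v i : Open n U -> U v -> locally (v i) (fun s => U (upd v i s)).
Proof.
  intros HU Hv. destruct (HU v Hv) as [d [P Q]].
  exists (mkposreal d P). intros s Hs. apply Q, near_upd; trivial.
Qed.

Lemma Ck_cont n k U f v : Ck n k U f -> U v -> cont n f v.
Proof. destruct k; intros [H _]; auto. Qed.

Lemma Ck_ext n k U : forall f g, Open n U -> (forall v, U v -> f v = g v) ->
  Ck n k U f -> Ck n k U g.
Proof.
  induction k as [|k IH]; intros f g HU E [C H]; split.
  - intros v Hv; eapply cont_ext; eauto.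
  - easy.
  - intros v Hv; eapply cont_ext; eauto.
  - intros i Hi; destruct (H i Hi) as [H1 H2]. split.
    + intros v Hv; unfold pex.
      apply ex_derive_ext_loc with (2 := H1 v Hv).
      generalize (locally_upd n U v i HU Hv); apply filter_imp; intros s; apply E.
    + apply IH with (3 := H2); trivial.
      intros v Hv; unfold PD. apply Derive_ext_loc.
      generalize (locally_upd n U v i HU Hv); apply filter_imp; intros s; apply E.
Qed.

Lemma Ck_S n k U : forall f, Ck n (S k) U f -> Ck n k U f.
Proof.
  induction k as [|k IH]; intros f [C H]; split; trivial.
  intros i Hi; destruct (H i Hi); auto.
Qed.

Lemma Ck_le n k k' U f : (k <= k')%nat -> Ck n k' U f -> Ck n k U f.
Proof. induction 1; auto using Ck_S. Qed.

Lemma Ck_sub n k (U V : env -> Prop) : (forall v, V v -> U v) ->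
  forall f, Ck n k U f -> Ck n k V f.
Proof.
  intros HV; induction k as [|k IH]; intros f [C H]; split; auto.
  intros i Hi; destruct (H i Hi); auto.
Qed.

Lemma Ck_local n k (U : env -> Prop) : forall f,
  (forall v, U v -> exists V : env -> Prop, V v /\ Ck n k V f) -> Ck n k U f.
Proof.
  induction k as [|k IH]; intros f H; split; trivial.
  - intros v Hv; destruct (H v Hv) as [V [Vv [C _]]]; auto.
  - intros v Hv; destruct (H v Hv) as [V [Vv [C _]]]; auto.
  - intros i Hi; split.
    + intros v Hv; destruct (H v Hv) as [V [Vv [_ C]]]; now apply C.
    + apply IH; intros v Hv; destruct (H v Hv) as [V [Vv [_ C]]].
      exists V; split; trivial; now apply C.
Qed.

Lemma Ck_intro n k U f : Open n U -> (forall v, U v -> cont n f v) ->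
  (forall i, (i < n)%nat -> exists g,
    (forall v, U v -> is_derive (fun s => f (upd v i s)) (v i) (g v)) /\ Ck n k U g) ->
  Ck n (S k) U f.
Proof.
  intros HU C H; split; trivial. intros i Hi; destruct (H i Hi) as [g [G1 G2]]; split.
  - intros v Hv; exists (g v); auto.
  - apply Ck_ext with (f := g); trivial. intros v Hv; symmetry; unfold PD.
    apply is_derive_unique; auto.
Qed.

Lemma Ck_is_derive n k U f i v : Ck n (S k) U f -> (i < n)%nat -> U v ->
  is_derive (fun s => f (upd v i s)) (v i) (PD i f v).
Proof. intros [_ H] Hi Hv. apply Derive_correct, (H i Hi); trivial. Qed.

Lemma Ck_is_derive_at n k f i v s : Ck n (S k) All f -> (i < n)%nat ->
  is_derive (fun s => f (upd v i s)) s (PD i f (upd v i s)).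
Proof.
  intros H Hi. assert (E := Ck_is_derive n k All f i (upd v i s) H Hi I).
  rewrite upd_eq in E. apply is_derive_ext with (2 := E).
  intros u; now rewrite upd_upd.
Qed.

Lemma Ck_D n k U f i : Ck n (S k) U f -> (i < n)%nat -> Ck n k U (PD i f).
Proof. intros [_ H] Hi; now apply H. Qed.

Lemma cont_const n c v : cont n (fun _ => c) v.
Proof. intros eps He; exists 1; split; [lra|]; intros; rewrite Rminus_diag, Rabs_R0; lra. Qed.

Lemma cont_proj n i v : (i < n)%nat -> cont n (fun v => v i) v.
Proof. intros Hi eps He; exists eps; split; auto. Qed.

Lemma cont_plus n f g v : cont n f v -> cont n g v -> cont n (fun v => f v + g v) v.
Proof.
  intros F G eps He.
  destruct (F (eps / 2)) as [d1 [P1 Q1]]; [lra|].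
  destruct (G (eps / 2)) as [d2 [P2 Q2]]; [lra|].
  exists (Rmin d1 d2); split; [now apply Rmin_glb_lt|].
  intros w Hw.
  assert (A := Q1 w (near_le _ _ _ _ _ (Rmin_l _ _) Hw)).
  assert (B := Q2 w (near_le _ _ _ _ _ (Rmin_r _ _) Hw)).
  replace (f w + g w - (f v + g v)) with ((f w - f v) + (g w - g v)) by ring.
  generalize (Rabs_triang (f w - f v) (g w - g v)); lra.
Qed.

Lemma cont_mult n f g v : cont n f v -> cont n g v -> cont n (fun v => f v * g v) v.
Proof.
  intros F G eps He.
  set (M := 1 + Rabs (f v) + Rabs (g v)).
  assert (HM : 1 <= M) by (unfold M; generalize (Rabs_pos (f v)) (Rabs_pos (g v)); lra).
  set (eta := Rmin 1 (eps / (2 * M))).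
  assert (He2 : 0 < eps / (2 * M)) by (apply Rdiv_lt_0_compat; lra).
  assert (Heta : 0 < eta) by (apply Rmin_glb_lt; lra).
  destruct (F eta Heta) as [d1 [P1 Q1]].
  destruct (G eta Heta) as [d2 [P2 Q2]].
  exists (Rmin d1 d2); split; [now apply Rmin_glb_lt|].
  intros w Hw.
  assert (A := Q1 w (near_le _ _ _ _ _ (Rmin_l _ _) Hw)).
  assert (B := Q2 w (near_le _ _ _ _ _ (Rmin_r _ _) Hw)).
  replace (f w * g w - f v * g v)
    with ((f w - f v) * (g w - g v) + (f w - f v) * g v + f v * (g w - g v)) by ring.
  assert (E1 : eta <= 1) by apply Rmin_l.
  assert (E2 : eta * (2 * M) <= eps).
  { apply Rle_trans with (eps / (2 * M) * (2 * M)).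
    - apply Rmult_le_compat_r; [lra | apply Rmin_r].
    - right; field; lra. }
  eapply Rle_lt_trans; [apply Rabs_triang|].
  eapply Rle_lt_trans; [apply Rplus_le_compat_r, Rabs_triang|].
  rewrite !Rabs_mult.
  generalize (Rabs_pos (f v)) (Rabs_pos (g v)) (Rabs_pos (f w - f v)) (Rabs_pos (g w - g v)).
  intros. unfold M in E2.
  assert (Rabs (f w - f v) * Rabs (g w - g v) <= eta * 1) by (apply Rmult_le_compat; lra).
  assert (Rabs (f w - f v) * Rabs (g v) <= eta * Rabs (g v)) by (apply Rmult_le_compat; lra).
  assert (Rabs (f v) * Rabs (g w - g v) <= Rabs (f v) * eta) by (apply Rmult_le_compat; lra).
  nra.
Qed.

Lemma Ck_const n k U c : Open n U -> Ck n k U (fun _ => c).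
Proof.
  intros HU; revert c; induction k as [|k IH]; intros c.
  - split; trivial; intros; apply cont_const.
  - apply Ck_intro; trivial; [intros; apply cont_const|].
    intros i Hi; exists (fun _ => 0); split; auto. intros; apply @is_derive_const.
Qed.

Lemma Ck_proj n k U i : Open n U -> (i < n)%nat -> Ck n k U (fun v => v i).
Proof.
  intros HU Hi; destruct k as [|k].
  - split; trivial; intros; now apply cont_proj.
  - apply Ck_intro; trivial; [intros; now apply cont_proj|].
    intros j Hj. destruct (Nat.eq_dec i j) as [<-|N].
    + exists (fun _ => 1); split; [|now apply Ck_const]. intros v Hv.
      apply is_derive_ext with (fun s => s); [intros; now rewrite upd_eq|].
      apply @is_derive_id.
    + exists (fun _ => 0); split; [|now apply Ck_const]. intros v Hv.
      apply is_derive_ext with (fun s => v i); [intros; now rewrite upd_neq|].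
      apply @is_derive_const.
Qed.

Lemma Ck_plus n k U : Open n U -> forall f g, Ck n k U f -> Ck n k U g ->
  Ck n k U (fun v => f v + g v).
Proof.
  intros HU; induction k as [|k IH]; intros f g F G.
  - split; trivial; intros; apply cont_plus; eapply Ck_cont; eauto.
  - apply Ck_intro; trivial.
    + intros; apply cont_plus; eapply Ck_cont; eauto.
    + intros i Hi. exists (fun v => PD i f v + PD i g v); split.
      * intros v Hv. apply @is_derive_plus; eapply Ck_is_derive; eauto.
      * apply IH; now apply Ck_D.
Qed.

Lemma Ck_mult n k U : Open n U -> forall f g, Ck n k U f -> Ck n k U g ->
  Ck n k U (fun v => f v * g v).
Proof.
  intros HU; induction k as [|k IH]; intros f g F G.
  - split; trivial; intros; apply cont_mult; eapply Ck_cont; eauto.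
  - apply Ck_intro; trivial.
    + intros; apply cont_mult; eapply Ck_cont; eauto.
    + intros i Hi. exists (fun v => PD i f v * g v + f v * PD i g v); split.
      * intros v Hv.
        assert (A := is_derive_mult _ _ _ _ _ (Ck_is_derive _ _ _ _ i v F Hi Hv)
                       (Ck_is_derive _ _ _ _ i v G Hi Hv) Rmult_comm).
        cbv beta in A. rewrite !upd_id in A. exact A.
      * apply Ck_plus; trivial; apply IH; try (now apply Ck_D); now apply Ck_S.
Qed.

Lemma Ck_opp n k U f : Open n U -> Ck n k U f -> Ck n k U (fun v => - f v).
Proof.
  intros HU F. apply Ck_ext with (fun v => (-1) * f v); trivial.
  - intros; ring.
  - apply Ck_mult; trivial. now apply Ck_const.
Qed.

Lemma Ck_minus n k U f g : Open n U -> Ck n k U f -> Ck n k U g ->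
  Ck n k U (fun v => f v - g v).
Proof. intros; apply Ck_plus; trivial; now apply Ck_opp. Qed.

Lemma Ck_pow n k U f p : Open n U -> Ck n k U f -> Ck n k U (fun v => f v ^ p).
Proof.
  intros HU F; induction p as [|p IH]; simpl.
  - now apply Ck_const.
  - now apply Ck_mult.
Qed.

Fixpoint sumn (m : nat) (a : nat -> R) : R :=
  match m with O => 0 | S m' => sumn m' a + a m' end.

Lemma Ck_sumn n k U m (a : nat -> env -> R) : Open n U ->
  (forall j, (j < m)%nat -> Ck n k U (a j)) -> Ck n k U (fun v => sumn m (fun j => a j v)).
Proof.
  intros HU; induction m as [|m IH]; intros H; simpl.
  - now apply Ck_const.
  - apply Ck_plus; trivial; auto.
Qed.

Definition mix (m : nat) (w p : env) : env := fun j => if Nat.ltb j m then w j else p j.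

Lemma mix_0 w p : mix 0 w p = p.
Proof. now apply functional_extensionality. Qed.

Lemma mix_S m w p : mix (S m) w p = upd (mix m w p) m (w m).
Proof.
  apply functional_extensionality; intros j; unfold mix, upd.
  destruct (Nat.ltb_spec j (S m)), (Nat.ltb_spec j m), (Nat.eqb_spec j m);
    trivial; try lia; congruence.
Qed.

Lemma fin_delta (m : nat) (P : nat -> R -> Prop) :
  (forall j d d', d' <= d -> P j d -> P j d') ->
  (forall j, (j < m)%nat -> exists d, 0 < d /\ P j d) ->
  exists d, 0 < d /\ forall j, (j < m)%nat -> P j d.
Proof.
  intros Hmon; induction m as [|m IH]; intros H.
  - exists 1; split; [lra | intros; lia].
  - destruct IH as [d1 [P1 Q1]]; [intros; apply H; lia|].
    destruct (H m) as [d2 [P2 Q2]]; [lia|].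
    exists (Rmin d1 d2); split; [now apply Rmin_glb_lt|].
    intros j Hj. destruct (Nat.eq_dec j m) as [->|].
    + eapply Hmon; [apply Rmin_r | trivial].
    + eapply Hmon; [apply Rmin_l | apply Q1; lia].
Qed.

(** Walk from p to w one coordinate at a time through the points [mix m w p]. The mean value theorem
    on each leg gives a partial derivative at a point close to p, which continuity replaces by its
    value at p. *)
Lemma total_increment n U f p : Open n U -> Ck n 1 U f -> U p ->
  forall eps, 0 < eps -> exists d, 0 < d /\ forall w, near n d p w ->
    Rabs (f w - f p - sumn n (fun j => PD j f p * (w j - p j)))
      <= eps * sumn n (fun j => Rabs (w j - p j)).
Proof.
  intros HU HF Hp eps He.
  destruct (HU p Hp) as [d0 [P0 Q0]].
  destruct (fin_delta n (fun j d => forall w, near n d p w ->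
              Rabs (PD j f w - PD j f p) < eps)) as [d1 [P1 Q1]].
  { intros j d d' Hd H w Hw; apply H; now apply near_le with d'. }
  { intros j Hj. apply (Ck_cont n 0 U); trivial. now apply Ck_D. }
  exists (Rmin d0 d1); split; [now apply Rmin_glb_lt|]. intros w Hw.
  assert (Hmix : forall m, near n (Rmin d0 d1) p (mix m w p)).
  { intros m i Hi; unfold mix. destruct (Nat.ltb i m); [now apply Hw|].
    rewrite Rminus_diag, Rabs_R0; now apply Rmin_glb_lt. }
  assert (Key : forall m, (m <= n)%nat ->
    Rabs (f (mix m w p) - f p - sumn m (fun j => PD j f p * (w j - p j)))
      <= eps * sumn m (fun j => Rabs (w j - p j))).
  { induction m as [|m IH]; intros Hm.
    - rewrite mix_0; simpl. rewrite Rminus_diag, Rminus_0_r, Rabs_R0; lra.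
    - specialize (IH ltac:(lia)). simpl.
      set (x := mix m w p) in *.
      assert (Hxm : x m = p m).
      { unfold x, mix. destruct (Nat.ltb_spec m m); [lia | easy]. }
      assert (Hseg : forall s, Rmin (p m) (w m) <= s <= Rmax (p m) (w m) ->
                near n (Rmin d0 d1) p (upd x m s)).
      { intros s Hs i Hi. destruct (Nat.eq_dec i m) as [->|N].
        - rewrite upd_eq. assert (A := Hw m Hi).
          apply Rle_lt_trans with (2 := A).
          unfold Rmin, Rmax in Hs; destruct (Rle_dec (p m) (w m));
            unfold Rabs; repeat destruct Rcase_abs; lra.
        - rewrite upd_neq by easy. now apply Hmix. }
      destruct (MVT_gen (fun s => f (upd x m s)) (p m) (w m)
                  (fun s => PD m f (upd x m s))) as [c [Hc E]].
      { intros s Hs.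
        assert (Hu : U (upd x m s)).
        { apply Q0, near_le with (2 := Hseg s ltac:(lra)), Rmin_l. }
        assert (A := Ck_is_derive n 0 U f m _ HF ltac:(lia) Hu).
        rewrite upd_eq in A. apply is_derive_ext with (2 := A).
        intros t; now rewrite upd_upd. }
      { intros s Hs.
        assert (Hu : U (upd x m s)).
        { apply Q0, near_le with (2 := Hseg s ltac:(lra)), Rmin_l. }
        assert (A := Ck_is_derive n 0 U f m _ HF ltac:(lia) Hu).
        rewrite upd_eq in A. apply continuity_pt_filterlim.
        apply (@ex_derive_continuous R_AbsRing R_NormedModule).
        exists (PD m f (upd x m s)). apply is_derive_ext with (2 := A).
        intros t; now rewrite upd_upd. }
      cbv beta in E.
      rewrite <- Hxm, upd_id, Hxm in E.
      rewrite mix_S; fold x.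
      replace (f (upd x m (w m)) - f p
        - (sumn m (fun j => PD j f p * (w j - p j)) + PD m f p * (w m - p m)))
        with ((f x - f p - sumn m (fun j => PD j f p * (w j - p j)))
              + (PD m f (upd x m c) - PD m f p) * (w m - p m)) by lra.
      eapply Rle_trans; [apply Rabs_triang|].
      rewrite Rmult_plus_distr_l. apply Rplus_le_compat; trivial.
      rewrite Rabs_mult. apply Rmult_le_compat_r; [apply Rabs_pos|].
      left; apply Q1; [lia|]. apply near_le with (2 := Hseg c Hc), Rmin_r. }
  specialize (Key n (Nat.le_refl n)).
  replace (f w) with (f (mix n w p)); trivial.
  assert (Hm : forall i, (i < n)%nat -> mix n w p i = w i).
  { intros i Hi; unfold mix. destruct (Nat.ltb_spec i n); [easy | lia]. }
  (* [mix n w p] and w may differ from index n on; continuity, which does not see those entries,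
     makes the two values equal. *)
  destruct (Req_dec (f (mix n w p)) (f w)) as [E|NE]; trivial; exfalso.
  assert (Hu : U (mix n w p)) by (apply Q0, near_le with (2 := Hmix n), Rmin_l).
  destruct (Ck_cont n 1 U f _ HF Hu (Rabs (f w - f (mix n w p)))) as [d [Hd A]].
  { apply Rabs_pos_lt; lra. }
  apply (Rlt_irrefl (Rabs (f w - f (mix n w p)))), A.
  intros i Hi. rewrite Hm by easy. now rewrite Rminus_diag, Rabs_R0.
Qed.

Lemma sumn_ext m a b : (forall j, (j < m)%nat -> a j = b j) -> sumn m a = sumn m b.
Proof.
  induction m as [|m IH]; intros H; simpl; trivial.
  rewrite IH by (intros; apply H; lia). now rewrite H by lia.
Qed.

Lemma sumn_le m a b : (forall j, (j < m)%nat -> a j <= b j) -> sumn m a <= sumn m b.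
Proof.
  induction m as [|m IH]; intros H; simpl; [lra|].
  apply Rplus_le_compat; [apply IH; intros; apply H; lia | apply H; lia].
Qed.

Lemma sumn_nonneg m a : (forall j, (j < m)%nat -> 0 <= a j) -> 0 <= sumn m a.
Proof.
  induction m as [|m IH]; intros H; simpl; [lra|].
  assert (0 <= a m) by (apply H; lia). assert (0 <= sumn m a) by (apply IH; intros; apply H; lia).
  lra.
Qed.

Lemma sumn_scal m c a : sumn m (fun j => c * a j) = c * sumn m a.
Proof. induction m as [|m IH]; simpl; [ring | rewrite IH; ring]. Qed.

Lemma sumn_minus m a b : sumn m (fun j => a j - b j) = sumn m a - sumn m b.
Proof. induction m as [|m IH]; simpl; [ring | rewrite IH; ring]. Qed.

Lemma sumn_Rabs m a : Rabs (sumn m a) <= sumn m (fun j => Rabs (a j)).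
Proof.
  induction m as [|m IH]; simpl; [rewrite Rabs_R0; lra|].
  eapply Rle_trans; [apply Rabs_triang | lra].
Qed.

Lemma is_derive_eps (f : R -> R) x l :
  is_derive f x l <->
  forall eps, 0 < eps -> exists d, 0 < d /\ forall y, Rabs (y - x) < d ->
    Rabs (f y - f x - l * (y - x)) <= eps * Rabs (y - x).
Proof.
  split.
  - intros [_ H] eps He. specialize (H x (fun P h => h) (mkposreal eps He)).
    destruct H as [d Hd]. exists d; split; [apply cond_pos|].
    intros y Hy. specialize (Hd y Hy).
    unfold norm, minus, plus, opp, scal in Hd; simpl in Hd.
    unfold mult in Hd; simpl in Hd. unfold abs in Hd; simpl in Hd.
    replace (f y - f x - l * (y - x)) with (f y + - f x + - ((y + - x) * l)) by ring.
    exact Hd.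
  - intros H; split; [apply is_linear_scal_l|].
    intros x' Hx' eps. 
    assert (E := @is_filter_lim_locally_unique R_AbsRing R_NormedModule x x' Hx'). subst x'.
    destruct (H eps (cond_pos eps)) as [d [Hd A]].
    exists (mkposreal d Hd); intros y Hy. specialize (A y Hy).
    unfold norm, minus, plus, opp, scal; simpl.
    unfold mult; simpl. unfold abs; simpl.
    replace (f y + - f x + - ((y + - x) * l)) with (f y - f x - l * (y - x)) by ring.
    exact A.
Qed.

Lemma chain_rule n U f (c : nat -> R -> R) (dc : nat -> R) t :
  Open n U -> Ck n 1 U f -> U (fun j => c j t) ->
  (forall j, (j < n)%nat -> is_derive (c j) t (dc j)) ->
  is_derive (fun s => f (fun j => c j s)) t
    (sumn n (fun j => PD j f (fun j => c j t) * dc j)).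
Proof.
  intros HU HF Hp Hc. apply is_derive_eps; intros eps He.
  set (p := fun j => c j t) in *.
  set (L := sumn n (fun j => Rabs (dc j) + 1)).
  assert (HL : 0 <= L).
  { apply sumn_nonneg; intros; generalize (Rabs_pos (dc j)); lra. }
  set (Mx := sumn n (fun j => Rabs (PD j f p))).
  assert (HM : 0 <= Mx) by (apply sumn_nonneg; intros; apply Rabs_pos).
  (* Half of eps pays for the nonlinearity of f, amplified by the speed bound L of the curve; the
     other half, through [e2], for the nonlinearity of the curve, amplified by the gradient bound
     [Mx]. The cap [e2 <= 1] is what makes L a speed bound. *)
  set (e1 := eps / (2 * (L + 1))).
  assert (He1 : 0 < e1) by (apply Rdiv_lt_0_compat; lra).
  set (e2 := Rmin 1 (eps / (2 * (Mx + 1)))).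
  assert (He2' : 0 < eps / (2 * (Mx + 1))) by (apply Rdiv_lt_0_compat; lra).
  assert (He2 : 0 < e2) by (apply Rmin_glb_lt; lra).
  destruct (total_increment n U f p HU HF Hp e1 He1) as [d1 [P1 Q1]].
  destruct (fin_delta n (fun j d => forall y, Rabs (y - t) < d ->
      Rabs (c j y - c j t - dc j * (y - t)) <= e2 * Rabs (y - t))) as [d2 [P2 Q2]].
  { intros j d d' Hd H y Hy; apply H; lra. }
  { intros j Hj. apply is_derive_eps; auto. }
  assert (B : forall j y, (j < n)%nat -> Rabs (y - t) < d2 ->
     Rabs (c j y - c j t) <= (Rabs (dc j) + 1) * Rabs (y - t)).
  { intros j y Hj Hy. specialize (Q2 j Hj y Hy).
    replace (c j y - c j t) with ((c j y - c j t - dc j * (y - t)) + dc j * (y - t)) by ring.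
    eapply Rle_trans; [apply Rabs_triang|]. rewrite Rabs_mult.
    assert (e2 <= 1) by apply Rmin_l. generalize (Rabs_pos (y - t)); nra. }
  set (d3 := d1 / (L + 1)).
  assert (P3 : 0 < d3) by (apply Rdiv_lt_0_compat; lra).
  exists (Rmin d2 d3); split; [now apply Rmin_glb_lt|]. intros y Hy.
  assert (Hy2 : Rabs (y - t) < d2) by (apply Rlt_le_trans with (1 := Hy), Rmin_l).
  assert (Hy3 : Rabs (y - t) < d3) by (apply Rlt_le_trans with (1 := Hy), Rmin_r).
  assert (N : near n d1 p (fun j => c j y)).
  { intros j Hj; unfold p. eapply Rle_lt_trans; [now apply B|].
    assert (Rabs (dc j) + 1 <= L).
    { unfold L. clear - Hj. induction n as [|n IH]; [lia|]. simpl.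
      assert (Hnn : 0 <= sumn n (fun j => Rabs (dc j) + 1)).
      { apply sumn_nonneg; intros i _; generalize (Rabs_pos (dc i)); lra. }
      destruct (Nat.eq_dec j n) as [->|]; [lra|].
      assert (A := IH ltac:(lia)). generalize (Rabs_pos (dc n)); lra. }
    assert (E : d3 * (L + 1) = d1) by (unfold d3; field; lra).
    generalize (Rabs_pos (y - t)); nra. }
  specialize (Q1 _ N).
  replace (f (fun j => c j y) - f p - sumn n (fun j => PD j f p * dc j) * (y - t))
    with ((f (fun j => c j y) - f p - sumn n (fun j => PD j f p * (c j y - p j)))
          + sumn n (fun j => PD j f p * (c j y - c j t - dc j * (y - t)))).
  2:{ assert (E : sumn n (fun j => PD j f p * (c j y - c j t - dc j * (y - t)))
        = sumn n (fun j => PD j f p * (c j y - p j)) - (y - t) * sumn n (fun j => PD j f p * dc j)).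
      { rewrite <- sumn_scal, <- sumn_minus. apply sumn_ext; intros; unfold p; ring. }
      rewrite E; ring. }
  eapply Rle_trans; [apply Rabs_triang|].
  assert (A1 : sumn n (fun j => Rabs (c j y - p j)) <= L * Rabs (y - t)).
  { rewrite Rmult_comm. unfold L. rewrite <- sumn_scal. apply sumn_le; intros j Hj.
    rewrite Rmult_comm; now apply B. }
  assert (A2 : Rabs (sumn n (fun j => PD j f p * (c j y - c j t - dc j * (y - t))))
     <= e2 * Rabs (y - t) * Mx).
  { eapply Rle_trans; [apply sumn_Rabs|]. unfold Mx. rewrite <- sumn_scal.
    apply sumn_le; intros j Hj. rewrite Rabs_mult, (Rmult_comm (Rabs (PD j f p))).
    apply Rmult_le_compat_r; [apply Rabs_pos | now apply Q2]. }
  assert (E1 : e1 * (L + 1) = eps / 2) by (unfold e1; field; lra).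
  assert (E2 : e2 * (Mx + 1) <= eps / 2).
  { apply Rle_trans with (eps / (2 * (Mx + 1)) * (Mx + 1)).
    - apply Rmult_le_compat_r; [lra | apply Rmin_r].
    - right; field; lra. }
  generalize (Rabs_pos (y - t)); intros Hp0.
  assert (e1 * sumn n (fun j => Rabs (c j y - p j)) <= e1 * (L * Rabs (y - t)))
    by (apply Rmult_le_compat_l; lra).
  assert (e1 * (L * Rabs (y - t)) <= eps / 2 * Rabs (y - t)) by (rewrite <- E1; nra).
  assert (e2 * Rabs (y - t) * Mx <= eps / 2 * Rabs (y - t)) by nra.
  lra.
Qed.

Lemma cont_comp n m f (g : nat -> env -> R) v :
  cont m f (fun j => g j v) -> (forall j, (j < m)%nat -> cont n (g j) v) ->
  cont n (fun v => f (fun j => g j v)) v.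
Proof.
  intros F G eps He. destruct (F eps He) as [d [Hd A]].
  destruct (fin_delta m (fun j d' => forall w, near n d' v w ->
      Rabs (g j w - g j v) < d)) as [d1 [P1 Q1]].
  { intros j a b Hab H w Hw; apply H; now apply near_le with b. }
  { intros j Hj; apply (G j Hj d Hd). }
  exists d1; split; trivial. intros w Hw; apply A. intros j Hj; now apply Q1.
Qed.

(** The partials of the composite are sums of products of composites of one order less, so the
    induction on k keeps f general. *)
Lemma Ck_comp n m k U V (g : nat -> env -> R) : Open n U -> Open m V ->
  (forall v, U v -> V (fun j => g j v)) ->
  forall f, Ck m k V f -> (forall j, (j < m)%nat -> Ck n k U (g j)) ->
  Ck n k U (fun v => f (fun j => g j v)).
Proof.
  intros HU HV HUV; induction k as [|k IH]; intros f F G.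
  - split; trivial; intros v Hv. apply cont_comp with m.
    + apply (Ck_cont m 0 V); auto.
    + intros j Hj; apply (Ck_cont n 0 U); auto.
  - apply Ck_intro; trivial.
    + intros v Hv; apply cont_comp with m.
      * apply (Ck_cont m (S k) V); auto.
      * intros j Hj; apply (Ck_cont n (S k) U); auto.
    + intros i Hi.
      exists (fun v => sumn m (fun j => PD j f (fun j => g j v) * PD i (g j) v)); split.
      * intros v Hv.
        assert (A := chain_rule m V f (fun j s => g j (upd v i s)) (fun j => PD i (g j) v) (v i)
          HV (Ck_le m 1 (S k) V f ltac:(lia) F)).
        cbv beta in A. rewrite upd_id in A. apply A; auto.
        intros j Hj. apply (Ck_is_derive n k U); auto.
      * apply Ck_sumn; trivial. intros j Hj. apply Ck_mult; trivial.
        -- apply IH; [now apply Ck_D|]. intros l Hl; now apply Ck_S, G.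
        -- apply Ck_D; auto.
Qed.

(** * Smooth functions of one variable and parametric integrals *)

Definition open1 (V : R -> Prop) : Prop :=
  forall x, V x -> exists d, 0 < d /\ forall y, Rabs (y - x) < d -> V y.

Definition Ck1 (k : nat) (V : R -> Prop) (h : R -> R) : Prop :=
  Ck 1 k (fun v => V (v O)) (fun v => h (v O)).

Lemma open1_Open V : open1 V -> Open 1 (fun v => V (v O)).
Proof.
  intros HV v Hv; destruct (HV _ Hv) as [d [P Q]].
  exists d; split; trivial. intros w Hw; apply Q, Hw; lia.
Qed.

Lemma open1_All : open1 (fun _ => True).
Proof. intros x _; exists 1; split; [lra | easy]. Qed.

Lemma Ck1_O V h : (forall x, V x -> continuous h x) -> Ck1 0 V h.
Proof.
  intros H; split; trivial. intros v Hv eps He.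
  apply H, continuity_pt_filterlim in Hv.
  destruct (Hv eps He) as [d [P Q]].
  exists d; split; trivial. intros w Hw.
  destruct (Req_dec (v O) (w O)) as [E|N].
  - rewrite E, Rminus_diag, Rabs_R0; lra.
  - apply Q; split; [split; trivial; exact Logic.I|]. apply Hw; lia.
Qed.

Lemma Ck1_S k V h h' : open1 V -> (forall x, V x -> is_derive h x (h' x)) ->
  Ck1 k V h' -> Ck1 (S k) V h.
Proof.
  intros HV H H'. apply Ck_intro.
  - now apply open1_Open.
  - apply Ck1_O. intros x Hx. apply (@ex_derive_continuous R_AbsRing R_NormedModule).
    exists (h' x); auto.
  - intros i Hi. assert (i = O) by lia; subst i.
    exists (fun v => h' (v O)); split; trivial. intros v Hv.
    apply is_derive_ext with (fun s => h s); [intros; now rewrite upd_eq | auto].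
Qed.

Lemma Ck_app n k U V h g : Open n U -> open1 V -> Ck1 k V h -> Ck n k U g ->
  (forall v, U v -> V (g v)) -> Ck n k U (fun v => h (g v)).
Proof.
  intros HU HV Hh Hg HUV.
  apply (Ck_comp n 1 k U (fun v => V (v O)) (fun _ => g)) with (f := fun v => h (v O)); trivial.
  now apply open1_Open.
Qed.

Lemma Ck_app_all n k U h g : Open n U -> Ck1 k (fun _ => True) h -> Ck n k U g ->
  Ck n k U (fun v => h (g v)).
Proof. intros; apply Ck_app with (fun _ => True); trivial. apply open1_All. Qed.

(** The derivative is a polynomial in the function itself, which lets the induction on k close. *)
Lemma Ck1_inv k : Ck1 k (fun x => x <> 0) Rinv.
Proof.
  assert (HV : open1 (fun x => x <> 0)).
  { intros x Hx; exists (Rabs x); split; [now apply Rabs_pos_lt|].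
    intros y Hy E; subst y. rewrite Rminus_0_l, Rabs_Ropp in Hy; lra. }
  assert (HD : forall x, x <> 0 -> is_derive Rinv x (- (/ x * / x))).
  { intros x Hx. auto_derive; trivial. now field. }
  induction k as [|k IH].
  - apply Ck1_O; intros x Hx. apply (@ex_derive_continuous R_AbsRing R_NormedModule).
    exists (- (/ x * / x)); auto.
  - apply Ck1_S with (2 := HD); trivial. unfold Ck1.
    apply open1_Open in HV. apply Ck_opp, Ck_mult; trivial.
Qed.

Lemma open1_pos : open1 (fun x => 0 < x).
Proof.
  intros x Hx; exists x; split; trivial. intros y Hy; apply Rabs_def2 in Hy; lra.
Qed.

Lemma Ck_inv n k U g : Open n U -> Ck n k U g -> (forall v, U v -> g v <> 0) ->
  Ck n k U (fun v => / g v).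
Proof.
  intros HU Hg H. apply Ck_app with (fun x => x <> 0); trivial; [|apply Ck1_inv].
  intros x Hx; exists (Rabs x); split; [now apply Rabs_pos_lt|].
  intros y Hy E; subst y. rewrite Rminus_0_l, Rabs_Ropp in Hy; lra.
Qed.

Lemma Ck1_sqrt k : Ck1 k (fun x => 0 < x) sqrt.
Proof.
  assert (HD : forall x, 0 < x -> is_derive sqrt x (/ (2 * sqrt x))).
  { intros x Hx. auto_derive; trivial. field. apply Rgt_not_eq, sqrt_lt_R0; lra. }
  induction k as [|k IH].
  - apply Ck1_O; intros x Hx. apply (@ex_derive_continuous R_AbsRing R_NormedModule).
    exists (/ (2 * sqrt x)); auto.
  - apply Ck1_S with (2 := HD); [apply open1_pos|]. unfold Ck1.
    assert (HV := open1_Open _ open1_pos).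
    apply Ck_inv; trivial.
    + apply Ck_mult; trivial. now apply Ck_const.
    + intros v Hv. assert (0 < sqrt (v O)) by now apply sqrt_lt_R0. lra.
Qed.

Lemma Ck_sqrt n k U g : Open n U -> Ck n k U g -> (forall v, U v -> 0 < g v) ->
  Ck n k U (fun v => sqrt (g v)).
Proof. intros; apply Ck_app with (fun x => 0 < x); trivial; [apply open1_pos | apply Ck1_sqrt]. Qed.

Lemma Ck1_sin_cos k : Ck1 k (fun _ => True) sin /\ Ck1 k (fun _ => True) cos.
Proof.
  assert (HS : forall x, is_derive sin x (cos x)) by (intros; auto_derive; trivial; ring).
  assert (HC : forall x, is_derive cos x (- sin x)) by (intros; auto_derive; trivial; ring).
  induction k as [|k [IH1 IH2]].
  - split; apply Ck1_O; intros x _; apply (@ex_derive_continuous R_AbsRing R_NormedModule);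
      eexists; eauto.
  - split.
    + now apply Ck1_S with cos; [apply open1_All|..].
    + apply Ck1_S with (fun x => - sin x); [apply open1_All | auto|].
      unfold Ck1; apply Ck_opp; trivial. apply (open1_Open _ open1_All).
Qed.

Lemma Ck_sin n k U g : Open n U -> Ck n k U g -> Ck n k U (fun v => sin (g v)).
Proof. intros; apply Ck_app_all; trivial. apply Ck1_sin_cos. Qed.

Lemma Ck_cos n k U g : Open n U -> Ck n k U g -> Ck n k U (fun v => cos (g v)).
Proof. intros; apply Ck_app_all; trivial. apply Ck1_sin_cos. Qed.

Lemma Smooth1_Derive h : Smooth1 h -> Smooth1 (Derive h).
Proof.
  intros H [|n] x; simpl; trivial.
  assert (A := H (S (S n)) x). apply ex_derive_ext with (2 := A).
  intros t. change (Derive h) with (Derive_n h 1).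
  now rewrite Derive_n_comp, Nat.add_1_r.
Qed.

Lemma Smooth1_Ck1 k : forall h, Smooth1 h -> Ck1 k (fun _ => True) h.
Proof.
  induction k as [|k IH]; intros h H.
  - apply Ck1_O; intros x _; apply (@ex_derive_continuous R_AbsRing R_NormedModule).
    apply (H 1%nat).
  - apply Ck1_S with (Derive h); [apply open1_All | | apply IH, Smooth1_Derive, H].
    intros x _; apply Derive_correct, (H 1%nat).
Qed.

(** * Translation between [SmoothOn] and [Ck] *)

Definition Cinf (n : nat) (U : env -> Prop) (f : env -> R) : Prop := forall k, Ck n k U f.

Lemma Cinf_D n U f i : Cinf n U f -> (i < n)%nat -> Cinf n U (PD i f).
Proof. intros H Hi k; now apply Ck_D. Qed.

Definition lift (f : fun4) : env -> R := fun v => f (v 0%nat) (v 1%nat) (v 2%nat) (v 3%nat).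

Definition idx (i : Idx) : nat :=
  match i with I0 => 0%nat | I1 => 1%nat | I2 => 2%nat | I3 => 3%nat end.

Lemma lift_pd i f : lift (pd i f) = PD (idx i) (lift f).
Proof. now destruct i. Qed.

Definition env4 (a b c d : R) : env :=
  fun j => match j with 0%nat => a | 1%nat => b | 2%nat => c | 3%nat => d | _ => 0 end.

Lemma upd_env4 a b c d s :
  upd (env4 a b c d) 0 s = env4 s b c d /\ upd (env4 a b c d) 1 s = env4 a s c d /\
  upd (env4 a b c d) 2 s = env4 a b s d /\ upd (env4 a b c d) 3 s = env4 a b c s.
Proof. repeat split; apply functional_extensionality; intros [|[|[|[|j]]]]; reflexivity. Qed.

Lemma cont4_cont f v : cont4 f (v 0%nat) (v 1%nat) (v 2%nat) (v 3%nat) -> cont 4 (lift f) v.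
Proof.
  intros H eps He.
  destruct (proj1 (filterlim_locally _ _) H (mkposreal eps He)) as [d Hd].
  exists d; split; [apply cond_pos|]. intros w Hw.
  apply (Hd (w 0%nat, w 1%nat, w 2%nat, w 3%nat)).
  repeat split; apply Hw; lia.
Qed.

Lemma cont_cont4 f v : cont 4 (lift f) v -> cont4 f (v 0%nat) (v 1%nat) (v 2%nat) (v 3%nat).
Proof.
  intros H. apply filterlim_locally; intros eps.
  destruct (H eps (cond_pos eps)) as [d [Hd A]].
  exists (mkposreal d Hd). intros [[[a b] c] e] [[[H0 H1] H2] H3].
  apply (A (env4 a b c e)). intros i Hi. destruct i as [|[|[|[|i]]]]; trivial; lia.
Qed.

(** The head of the list is the outermost derivative, whereas [Ck] peels off the innermost one
    first; appending reconciles the two recursions. *)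
Lemma dparts_pd l i f : dparts l (pd i f) = dparts (l ++ i :: nil) f.
Proof. unfold dparts; now rewrite fold_right_app. Qed.

Lemma SmoothOn_Cinf U f : SmoothOn U f ->
  Cinf 4 (fun v => U (v 0%nat) (v 1%nat) (v 2%nat) (v 3%nat)) (lift f).
Proof.
  intros H k; revert f H; induction k as [|k IH]; intros f H; split; trivial;
    try (intros v Hv; apply cont4_cont, (H nil); trivial).
  intros i Hi.
  assert (E : exists I, i = idx I).
  { destruct i as [|[|[|[|i]]]]; [exists I0 | exists I1 | exists I2 | exists I3 | lia]; trivial. }
  destruct E as [j ->]. split.
  - intros v Hv. destruct (H nil _ _ _ _ Hv) as [A _]. specialize (A j). now destruct j.
  - rewrite <- lift_pd. apply IH. intros l a b c d Hu. rewrite dparts_pd. now apply H.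
Qed.

Lemma Cinf_SmoothOn f : Cinf 4 All (lift f) -> SmoothOn (fun _ _ _ _ => True) f.
Proof.
  intros H l.
  assert (A : Cinf 4 All (lift (dparts l f))).
  { induction l as [|i l IH]; trivial.
    change (dparts (i :: l) f) with (pd i (dparts l f)). rewrite lift_pd.
    apply Cinf_D; trivial. destruct i; simpl; lia. }
  intros a b c d _. split.
  - intros i. destruct (A 1%nat) as [_ B].
    assert (Hi : (idx i < 4)%nat) by (destruct i; simpl; lia).
    destruct (B _ Hi) as [C _]. specialize (C (env4 a b c d) Logic.I). now destruct i.
  - apply (cont_cont4 _ (env4 a b c d)). apply (Ck_cont 4 0 All); [apply A | easy].
Qed.

(** * Integrals depending on parameters *)

Definition INT (n : nat) (a b : R) (f : env -> R) : env -> R :=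
  fun v => RInt (fun s => f (upd v n s)) a b.

Lemma continuous_upd n f v i s : cont n f (upd v i s) ->
  continuous (fun s => f (upd v i s)) s.
Proof.
  intros H. apply filterlim_locally; intros eps.
  destruct (H eps (cond_pos eps)) as [d [Hd A]].
  exists (mkposreal d Hd). intros t Ht. apply A.
  rewrite <- (upd_upd v i s t). apply near_upd; trivial. now rewrite upd_eq.
Qed.

Lemma ex_RInt_upd n f v a b : Ck (S n) 0 All f -> ex_RInt (fun s => f (upd v n s)) a b.
Proof.
  intros H. apply (@ex_RInt_continuous R_CompleteNormedModule). intros s _.
  apply continuous_upd with (S n). now apply (Ck_cont (S n) 0 All).
Qed.

(** Compactness of the segment over v gives one radius for all s. Half of each continuity radius is
    spent on reaching the nearest centre and half on the displacement of w. *)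
Lemma unif_cont_slab n f v a b : Ck (S n) 0 All f -> forall eps, 0 < eps ->
  exists d, 0 < d /\ forall w s, near n d v w -> a <= s <= b ->
    Rabs (f (upd w n s) - f (upd v n s)) < eps.
Proof.
  intros H eps He.
  assert (K : forall s, exists d, 0 < d /\ forall w, near (S n) d (upd v n s) w ->
    Rabs (f w - f (upd v n s)) < eps / 2).
  { intros s. apply (Ck_cont (S n) 0 All f); trivial; [easy | lra]. }
  destruct (choice _ K) as [del Hdel].
  assert (P2 : forall s, 0 < del s / 2) by (intros s; destruct (Hdel s); lra).
  destruct (compactness_value_1d a b (fun s => mkposreal _ (P2 s))) as [d Hd].
  exists d; split; [apply cond_pos|]. intros w s Hw Hs.
  destruct (NNPP _ (Hd s Hs)) as [t [_ [H1 H2]]]. simpl in H1, H2. destruct (Hdel t) as [Pt Qt].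
  assert (A : Rabs (f (upd w n s) - f (upd v n t)) < eps / 2).
  { apply Qt. intros i Hi. destruct (Nat.eq_dec i n) as [->|Ni].
    - rewrite !upd_eq; lra.
    - rewrite !upd_neq by trivial. assert (B := Hw i ltac:(lia)). lra. }
  assert (B : Rabs (f (upd v n s) - f (upd v n t)) < eps / 2).
  { apply Qt. intros i Hi. destruct (Nat.eq_dec i n) as [->|Ni].
    - rewrite !upd_eq; lra.
    - rewrite !upd_neq by trivial. rewrite Rminus_diag, Rabs_R0; lra. }
  replace (f (upd w n s) - f (upd v n s))
    with ((f (upd w n s) - f (upd v n t)) - (f (upd v n s) - f (upd v n t))) by ring.
  eapply Rle_lt_trans; [apply Rabs_triang|]. rewrite Rabs_Ropp; lra.
Qed.

Lemma cont_INT n f v a b : a <= b -> Ck (S n) 0 All f -> cont n (INT n a b f) v.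
Proof.
  intros Hab H eps He.
  destruct (unif_cont_slab n f v a b H (eps / (b - a + 1))) as [d [Hd A]].
  { apply Rdiv_lt_0_compat; lra. }
  exists d; split; trivial. intros w Hw. unfold INT.
  rewrite <- (@RInt_minus R_CompleteNormedModule) by now apply ex_RInt_upd.
  eapply Rle_lt_trans.
  - apply abs_RInt_le_const with (M := eps / (b - a + 1)); trivial.
    + apply (@ex_RInt_minus R_NormedModule); now apply ex_RInt_upd.
    + intros s Hs. left. now apply A.
  - apply Rlt_le_trans with ((b - a + 1) * (eps / (b - a + 1))); [|right; field; lra].
    apply Rmult_lt_compat_r; [apply Rdiv_lt_0_compat; lra | lra].
Qed.

Lemma is_derive_INT n f v a b i : Ck (S n) 1 All f -> (i < n)%nat ->
  is_derive (fun s => INT n a b f (upd v i s)) (v i) (INT n a b (PD i f) v).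
Proof.
  intros H Hi. unfold INT.
  assert (E : forall u, upd (upd v i (v i)) n u = upd v n u) by (intros; now rewrite upd_id).
  assert (A := is_derive_RInt_param (fun s u => f (upd (upd v i s) n u)) a b (v i)).
  cbv beta in A.
  assert (B : RInt (fun t => Derive (fun u => f (upd (upd v i u) n t)) (v i)) a b
     = RInt (fun s => PD i f (upd v n s)) a b).
  { apply RInt_ext; intros s _. unfold PD. rewrite upd_neq by lia.
    apply Derive_ext; intros u. now rewrite upd_comm by lia. }
  rewrite B in A. apply A.
  - apply filter_forall; intros x t _.
    assert (C := Ck_is_derive_at (S n) 0 f i (upd v n t) x H ltac:(lia)).
    exists (PD i f (upd (upd v n t) i x)). apply is_derive_ext with (2 := C).
    intros u; now rewrite upd_comm by lia.
  - intros t _ eps.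
    assert (C := Ck_D (S n) 0 All f i H ltac:(lia)).
    destruct (Ck_cont _ _ _ _ (upd (upd v i (v i)) n t) C Logic.I eps (cond_pos eps)) as [d [Hd Q]].
    assert (DD : forall x y, Derive (fun z => f (upd (upd v i z) n y)) x
                   = PD i f (upd (upd v i x) n y)).
    { intros x y. unfold PD. rewrite upd_neq, upd_eq by lia.
      apply Derive_ext; intros u. rewrite (upd_comm _ n i) by lia. now rewrite upd_upd. }
    exists (mkposreal d Hd). intros x y Hx Hy. simpl in Hx, Hy. rewrite !DD. apply Q.
    intros j _. destruct (Nat.eq_dec j n) as [->|N1].
    + now rewrite !upd_eq.
    + rewrite !(upd_neq _ n j) by trivial. destruct (Nat.eq_dec j i) as [->|N2].
      * now rewrite !upd_eq.
      * rewrite !upd_neq by trivial. now rewrite Rminus_diag, Rabs_R0.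
  - apply filter_forall; intros x. apply ex_RInt_upd. now apply (Ck_le _ 0 1); [lia|].
Qed.

Lemma D_INT n f a b i : Ck (S n) 1 All f -> (i < n)%nat ->
  PD i (INT n a b f) = INT n a b (PD i f).
Proof.
  intros H Hi. apply functional_extensionality; intros v.
  apply is_derive_unique. now apply is_derive_INT.
Qed.

Lemma Ck_INT n k a b : a <= b -> forall f, Ck (S n) k All f -> Ck n k All (INT n a b f).
Proof.
  intros Hab; induction k as [|k IH]; intros f H.
  - split; trivial. intros; now apply cont_INT.
  - assert (H1 : Ck (S n) 1 All f) by (apply Ck_le with (2 := H); lia).
    apply Ck_intro.
    + apply Open_All.
    + intros; apply cont_INT; trivial. apply Ck_le with (2 := H); lia.
    + intros i Hi. exists (INT n a b (PD i f)); split.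
      * intros; now apply is_derive_INT.
      * apply IH, Ck_D; trivial; lia.
Qed.

Lemma INT_D n f v a b : Ck (S n) 1 All f -> INT n a b (PD n f) v = f (upd v n b) - f (upd v n a).
Proof.
  intros H. apply is_RInt_unique.
  apply (@is_RInt_derive R_CompleteNormedModule (fun s => f (upd v n s))).
  - intros s _. now apply (Ck_is_derive_at (S n) 0); [|lia].
  - intros s _. apply continuous_upd with (S n). apply (Ck_cont (S n) 0 All); [|easy].
    now apply Ck_D; [|lia].
Qed.

Lemma INT_ext n a b f g v : a <= b -> (forall s, a <= s <= b -> f (upd v n s) = g (upd v n s)) ->
  INT n a b f v = INT n a b g v.
Proof.
  intros Hab H. apply RInt_ext. intros s. rewrite Rmin_left, Rmax_right by trivial.
  intros Hs; apply H; lra.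
Qed.

Lemma INT_plus n a b f g v : Ck (S n) 0 All f -> Ck (S n) 0 All g ->
  INT n a b (fun v => f v + g v) v = INT n a b f v + INT n a b g v.
Proof.
  intros F G. apply (@RInt_plus R_CompleteNormedModule); now apply ex_RInt_upd.
Qed.

Lemma INT_scal n a b c f v : Ck (S n) 0 All f ->
  INT n a b (fun v => c * f v) v = c * INT n a b f v.
Proof. intros F. apply (@RInt_scal R_CompleteNormedModule); now apply ex_RInt_upd. Qed.

Lemma INT_le n a b f g v : a <= b -> Ck (S n) 0 All f -> Ck (S n) 0 All g ->
  (forall s, a <= s <= b -> f (upd v n s) <= g (upd v n s)) ->
  INT n a b f v <= INT n a b g v.
Proof.
  intros Hab F G H. apply RInt_le; trivial; try now apply ex_RInt_upd.
  intros s Hs; apply H; lra.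
Qed.

(** * Integrals over the sphere *)

Ltac ck :=
  cbv beta;
  repeat first [ assumption | match goal with
    | |- Open _ All => apply Open_All
    | |- Ck _ _ _ (fun _ => ?c) => apply Ck_const
    | |- Ck _ _ _ (fun v => v ?i) => apply Ck_proj; [|lia]
    | |- Ck _ _ _ (fun v => @?f v + @?g v) => apply Ck_plus
    | |- Ck _ _ _ (fun v => @?f v - @?g v) => apply Ck_minus
    | |- Ck _ _ _ (fun v => @?f v * @?g v) => apply Ck_mult
    | |- Ck _ _ _ (fun v => - @?f v) => apply Ck_opp
    | |- Ck _ _ _ (fun v => @?f v ^ ?p) => apply Ck_pow
    | |- Ck _ _ _ (fun v => sin (@?f v)) => apply Ck_sin
    | |- Ck _ _ _ (fun v => cos (@?f v)) => apply Ck_cos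
    end ]; trivial.

Definition DI (f : R -> R -> R) : R := RInt (fun th => RInt (fun ph => f th ph) 0 (2 * PI)) 0 PI.

Definition C2 (k : nat) (f : R -> R -> R) : Prop := Ck 2 k All (fun v => f (v 0%nat) (v 1%nat)).

Definition SI (n : nat) (f : env -> R) : env -> R := INT n 0 PI (INT (S n) 0 (2 * PI) f).

Lemma SI_DI n f v : SI n f v = DI (fun th ph => f (upd (upd v n th) (S n) ph)).
Proof. reflexivity. Qed.

Lemma PI_nonneg : 0 <= PI.
Proof. generalize PI_RGT_0; lra. Qed.

Lemma PI2_nonneg : 0 <= 2 * PI.
Proof. generalize PI_RGT_0; lra. Qed.

Lemma Ck_SI n k f : Ck (S (S n)) k All f -> Ck n k All (SI n f).
Proof. intros H. apply Ck_INT, Ck_INT; trivial; [apply PI_nonneg | apply PI2_nonneg]. Qed.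

Lemma PD_SI n f i : Ck (S (S n)) 1 All f -> (i < n)%nat -> PD i (SI n f) = SI n (PD i f).
Proof.
  intros H Hi. unfold SI. rewrite D_INT; trivial.
  - now rewrite D_INT by (trivial; lia).
  - apply Ck_INT; trivial. apply PI2_nonneg.
Qed.

Lemma DI_SI f v : DI f = SI 0 (fun v => f (v 0%nat) (v 1%nat)) v.
Proof. reflexivity. Qed.

Lemma C2_slice n k f v : Ck (S (S n)) k All f ->
  C2 k (fun th ph => f (upd (upd v n th) (S n) ph)).
Proof.
  intros H. unfold C2.
  set (g := fun j => if Nat.eqb j (S n) then fun p : env => p 1%nat
                     else if Nat.eqb j n then fun p => p 0%nat else fun _ => v j).
  apply Ck_ext with (fun p => f (fun j => g j p)); [apply Open_All | |].
  - intros p _. f_equal. apply functional_extensionality; intros j. unfold g, upd.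
    destruct (Nat.eqb j (S n)); [|destruct (Nat.eqb j n)]; reflexivity.
  - apply Ck_comp with (S (S n)) All; trivial; try apply Open_All.
    intros j _. unfold g. destruct (Nat.eqb j (S n)); [|destruct (Nat.eqb j n)]; ck.
Qed.

Lemma DI_ext f g : (forall th ph, 0 <= th <= PI -> f th ph = g th ph) -> DI f = DI g.
Proof.
  intros H. apply RInt_ext. intros th. rewrite Rmin_left, Rmax_right by apply PI_nonneg.
  intros Hth. apply RInt_ext; intros ph _; apply H; lra.
Qed.

Lemma SI_plus n f g v : Ck (S (S n)) 0 All f -> Ck (S (S n)) 0 All g ->
  SI n (fun v => f v + g v) v = SI n f v + SI n g v.
Proof.
  intros F G. unfold SI.
  rewrite <- INT_plus by (apply Ck_INT; trivial; apply PI2_nonneg).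
  apply INT_ext; [apply PI_nonneg|]. intros s _. now rewrite <- INT_plus.
Qed.

Lemma SI_scal n c f v : Ck (S (S n)) 0 All f -> SI n (fun v => c * f v) v = c * SI n f v.
Proof.
  intros F. unfold SI.
  rewrite <- INT_scal by (apply Ck_INT; trivial; apply PI2_nonneg).
  apply INT_ext; [apply PI_nonneg|]. intros s _. now rewrite <- INT_scal.
Qed.

Lemma DI_plus f g : C2 0 f -> C2 0 g -> DI (fun a b => f a b + g a b) = DI f + DI g.
Proof. intros F G. rewrite !DI_SI with (v := fun _ => 0). now apply SI_plus. Qed.

Lemma DI_scal c f : C2 0 f -> DI (fun a b => c * f a b) = c * DI f.
Proof. intros F. rewrite !DI_SI with (v := fun _ => 0). now apply SI_scal. Qed.

Lemma DI_le f g : C2 0 f -> C2 0 g -> (forall th ph, 0 <= th <= PI -> f th ph <= g th ph) ->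
  DI f <= DI g.
Proof.
  intros F G H. rewrite !DI_SI with (v := fun _ => 0). unfold SI.
  apply INT_le; [apply PI_nonneg | apply Ck_INT; trivial; apply PI2_nonneg ..|].
  intros th Hth. apply INT_le; trivial; [apply PI2_nonneg|]. intros ph _. now apply H.
Qed.

Lemma DI_abs f g : C2 0 f -> C2 0 g -> (forall th ph, 0 <= th <= PI -> Rabs (f th ph) <= g th ph) ->
  Rabs (DI f) <= DI g.
Proof.
  intros F G H. apply Rabs_le. split.
  - replace (- DI g) with ((-1) * DI g) by ring. rewrite <- DI_scal by trivial.
    apply DI_le; trivial; [unfold C2; ck|].
    intros th ph Hth. specialize (H th ph Hth). apply Rabs_le_between in H; lra.
  - apply DI_le; trivial. intros th ph Hth. specialize (H th ph Hth).
    apply Rabs_le_between in H; lra.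
Qed.

(** The fundamental theorem of calculus in each angle leaves no boundary terms: A vanishes at both
    poles and B agrees at the two ends of its period. *)
Lemma DI_divergence A B a b : C2 1 A -> C2 1 B ->
  (forall th ph, is_derive (fun s => A s ph) th (a th ph)) ->
  (forall th ph, is_derive (fun s => B th s) ph (b th ph)) ->
  (forall ph, A 0 ph = 0) -> (forall ph, A PI ph = 0) ->
  (forall th, B th 0 = B th (2 * PI)) ->
  DI (fun th ph => a th ph + b th ph) = 0.
Proof.
  intros CA CB HA HB A0 AP BP.
  set (A' := fun v : env => A (v 0%nat) (v 1%nat)).
  set (B' := fun v : env => B (v 0%nat) (v 1%nat)).
  assert (EA : PD 0 A' = (fun v => a (v 0%nat) (v 1%nat))).
  { apply functional_extensionality; intros v. apply is_derive_unique, HA. }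
  assert (EB : PD 1 B' = (fun v => b (v 0%nat) (v 1%nat))).
  { apply functional_extensionality; intros v. apply is_derive_unique, HB. }
  assert (Ca : C2 0 a) by (unfold C2; rewrite <- EA; apply Ck_D; [exact CA | lia]).
  assert (Cb : C2 0 b) by (unfold C2; rewrite <- EB; apply Ck_D; [exact CB | lia]).
  rewrite DI_plus by trivial. rewrite !DI_SI with (v := fun _ => 0). rewrite <- EA, <- EB.
  unfold SI. rewrite <- D_INT by (trivial; lia).
  rewrite INT_D by (apply Ck_INT; trivial; apply PI2_nonneg).
  assert (Z : forall th, th = 0 \/ th = PI ->
     INT 1 0 (2 * PI) A' (upd (fun _ => 0) 0 th) = 0).
  { intros th Hth. unfold INT. rewrite (RInt_ext _ (fun _ => 0)).
    - rewrite RInt_const. apply Rmult_0_r.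
    - intros s _. unfold A', upd; simpl. destruct Hth; subst; auto. }
  rewrite !Z by auto.
  replace (INT 0 0 PI (INT 1 0 (2 * PI) (PD 1 B')) (fun _ => 0)) with 0; [ring|].
  symmetry. unfold INT at 1. rewrite (RInt_ext _ (fun _ => 0)).
  - rewrite RInt_const. apply Rmult_0_r.
  - intros s _. rewrite INT_D by trivial. unfold B', upd; simpl. rewrite BP; ring.
Qed.

Definition env3 (a b c : R) : env :=
  fun j => match j with 0%nat => a | 1%nat => b | 2%nat => c | _ => 0 end.

Definition sv (th ph : R) : env := env3 (sin th * cos ph) (sin th * sin ph) (cos th).

Lemma chain3 g (a b c : R -> R) a' b' c' t : Ck 3 1 All g ->
  is_derive a t a' -> is_derive b t b' -> is_derive c t c' ->
  is_derive (fun s => g (env3 (a s) (b s) (c s))) t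
    (PD 0 g (env3 (a t) (b t) (c t)) * a' + PD 1 g (env3 (a t) (b t) (c t)) * b'
     + PD 2 g (env3 (a t) (b t) (c t)) * c').
Proof.
  intros G Ha Hb Hc.
  assert (E : forall s, (fun j => match j with 0%nat => a | 1%nat => b | 2%nat => c | _ => fun _ => 0 end s)
                = env3 (a s) (b s) (c s)).
  { intros s; apply functional_extensionality; intros [|[|[|j]]]; trivial. }
  assert (H := chain_rule 3 All g
    (fun j => match j with 0%nat => a | 1%nat => b | 2%nat => c | _ => fun _ => 0 end)
    (fun j => match j with 0%nat => a' | 1%nat => b' | 2%nat => c' | _ => 0 end) t
    (Open_All 3) G Logic.I).
  cbv beta in H. simpl sumn in H. rewrite E in H. rewrite Rplus_0_l in H.
  apply is_derive_ext with (2 := H ltac:(intros [|[|[|j]]] Hj; trivial; lia)).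
  intros s; now rewrite E.
Qed.

Lemma Ck_env3 n k U g (a b c : env -> R) : Open n U -> Ck 3 k All g ->
  Ck n k U a -> Ck n k U b -> Ck n k U c -> Ck n k U (fun v => g (env3 (a v) (b v) (c v))).
Proof.
  intros HU G Ha Hb Hc.
  assert (H := Ck_comp n 3 k U All
    (fun j => match j with 0%nat => a | 1%nat => b | 2%nat => c | _ => fun _ => 0 end)
    HU (Open_All 3) (fun v _ => Logic.I) g G).
  apply Ck_ext with (3 := H ltac:(intros [|[|[|j]]] Hj; trivial; lia)); trivial.
  intros v _. f_equal. apply functional_extensionality; intros [|[|[|j]]]; trivial.
Qed.

Lemma C2_sv k g : Ck 3 k All g -> C2 k (fun th ph => g (sv th ph)).
Proof. intros G. unfold C2, sv. apply Ck_env3; ck. Qed.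

Lemma prod_derive (p f : R -> R) x p' f' : is_derive p x p' -> is_derive f x f' ->
  is_derive (fun s => p s * f s) x (p' * f x + p x * f').
Proof. intros P F. apply (is_derive_mult p f x p' f' P F Rmult_comm). Qed.

(** * Rotation fields and Archimedes' theorem *)

Section Rotations.
Context (g : env -> R) (Hg : Ck 3 1 All g).

Lemma sv_derive_th th ph : is_derive (fun s => g (sv s ph)) th
  (PD 0 g (sv th ph) * (cos th * cos ph) + PD 1 g (sv th ph) * (cos th * sin ph)
   + PD 2 g (sv th ph) * (- sin th)).
Proof.
  apply (chain3 g (fun s => sin s * cos ph) (fun s => sin s * sin ph) cos); trivial;
    auto_derive; trivial; ring.
Qed.

Lemma sv_derive_ph th ph : is_derive (fun s => g (sv th s)) ph
  (PD 0 g (sv th ph) * (sin th * - sin ph) + PD 1 g (sv th ph) * (sin th * cos ph)).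
Proof.
  replace (PD 0 g (sv th ph) * (sin th * - sin ph) + PD 1 g (sv th ph) * (sin th * cos ph))
    with (PD 0 g (sv th ph) * (sin th * - sin ph) + PD 1 g (sv th ph) * (sin th * cos ph)
      + PD 2 g (sv th ph) * 0) by ring.
  apply (chain3 g (fun s => sin th * cos s) (fun s => sin th * sin s) (fun _ => cos th)); trivial;
    auto_derive; trivial; ring.
Qed.

(** Rotation about the third axis is d/dph, and the area weight sin th does not depend on ph. *)
Lemma DI_rot12 :
  DI (fun th ph => (sin th * cos ph * PD 1 g (sv th ph)
                    - sin th * sin ph * PD 0 g (sv th ph)) * sin th) = 0.
Proof.
  rewrite (DI_ext _ (fun th ph => 0 + sin th *
    (PD 0 g (sv th ph) * (sin th * - sin ph) + PD 1 g (sv th ph) * (sin th * cos ph)))).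
  2:{ intros; ring. }
  apply DI_divergence with (A := fun _ _ => 0) (B := fun th ph => sin th * g (sv th ph)); trivial.
  - unfold C2; ck.
  - unfold C2; ck. now apply C2_sv.
  - intros; apply @is_derive_const.
  - intros th ph. apply (is_derive_scal (fun s => g (sv th s))), sv_derive_ph.
  - intros th. unfold sv. now rewrite sin_2PI, cos_2PI, sin_0, cos_0.
Qed.

(** In angles the field z d_x - x d_z is cos ph d_th - cot th sin ph d_ph. Its product with sin th
    is regular at the poles and divergence free, so the integrand is the divergence of g times that
    product. *)
Lemma DI_rot31 :
  DI (fun th ph => (cos th * PD 0 g (sv th ph)
                    - sin th * cos ph * PD 2 g (sv th ph)) * sin th) = 0.
Proof.
  rewrite (DI_ext _ (fun th ph =>
    (cos th * cos ph * g (sv th ph) + sin th * cos ph *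
      (PD 0 g (sv th ph) * (cos th * cos ph) + PD 1 g (sv th ph) * (cos th * sin ph)
       + PD 2 g (sv th ph) * (- sin th)))
    + (- cos th * cos ph * g (sv th ph) + - cos th * sin ph *
     (PD 0 g (sv th ph) * (sin th * - sin ph) + PD 1 g (sv th ph) * (sin th * cos ph))))).
  2:{ intros th ph _. assert (E := sin2_cos2 ph). unfold Rsqr in E.
      transitivity (sin th * ((sin ph * sin ph + cos ph * cos ph) * cos th * PD 0 g (sv th ph)
        - sin th * cos ph * PD 2 g (sv th ph))); [rewrite E|]; ring. }
  apply DI_divergence with (A := fun th ph => (sin th * cos ph) * g (sv th ph))
                           (B := fun th ph => (- cos th * sin ph) * g (sv th ph)).
  - unfold C2; ck; now apply C2_sv.
  - unfold C2; ck; now apply C2_sv.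
  - intros th ph. apply (prod_derive (fun s => sin s * cos ph) (fun s => g (sv s ph))).
    + auto_derive; trivial; ring.
    + apply sv_derive_th.
  - intros th ph. apply (prod_derive (fun s => - cos th * sin s) (fun s => g (sv th s))).
    + auto_derive; trivial; ring.
    + apply sv_derive_ph.
  - intros ph. rewrite sin_0; ring.
  - intros ph. rewrite sin_PI; ring.
  - intros th. unfold sv. now rewrite sin_2PI, cos_2PI, sin_0, cos_0.
Qed.

Lemma DI_rot32 :
  DI (fun th ph => (cos th * PD 1 g (sv th ph)
                    - sin th * sin ph * PD 2 g (sv th ph)) * sin th) = 0.
Proof.
  rewrite (DI_ext _ (fun th ph =>
    (cos th * sin ph * g (sv th ph) + sin th * sin ph *
      (PD 0 g (sv th ph) * (cos th * cos ph) + PD 1 g (sv th ph) * (cos th * sin ph)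
       + PD 2 g (sv th ph) * (- sin th)))
    + (- cos th * sin ph * g (sv th ph) + cos th * cos ph *
     (PD 0 g (sv th ph) * (sin th * - sin ph) + PD 1 g (sv th ph) * (sin th * cos ph))))).
  2:{ intros th ph _. assert (E := sin2_cos2 ph). unfold Rsqr in E.
      transitivity (sin th * ((sin ph * sin ph + cos ph * cos ph) * cos th * PD 1 g (sv th ph)
        - sin th * sin ph * PD 2 g (sv th ph))); [rewrite E|]; ring. }
  apply DI_divergence with (A := fun th ph => (sin th * sin ph) * g (sv th ph))
                           (B := fun th ph => (cos th * cos ph) * g (sv th ph)).
  - unfold C2; ck; now apply C2_sv.
  - unfold C2; ck; now apply C2_sv.
  - intros th ph. apply (prod_derive (fun s => sin s * sin ph) (fun s => g (sv s ph))).
    + auto_derive; trivial; ring.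
    + apply sv_derive_th.
  - intros th ph. apply (prod_derive (fun s => cos th * cos s) (fun s => g (sv th s))).
    + auto_derive; trivial; ring.
    + apply sv_derive_ph.
  - intros ph. rewrite sin_0; ring.
  - intros ph. rewrite sin_PI; ring.
  - intros th. unfold sv. now rewrite sin_2PI, cos_2PI, sin_0, cos_0.
Qed.

End Rotations.

Definition dot (a b c th ph : R) : R := a * (sin th * cos ph) + b * (sin th * sin ph) + c * cos th.

(** Places w at arclength al on the great circle that leaves the pole in the horizontal direction
    (a, b); [hat_box] moves its axis along this circle. *)
Lemma horizontal_frame w1 w2 w3 : w1 ^ 2 + w2 ^ 2 + w3 ^ 2 = 1 ->
  exists al a b, 0 <= al /\ a ^ 2 + b ^ 2 = 1 /\ w1 = sin al * a /\ w2 = sin al * b /\ w3 = cos al.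
Proof.
  intros Hw. assert (H3 : -1 <= w3 <= 1) by nra.
  assert (HC := cos_acos w3 H3). assert (HS := sin_acos w3 H3).
  assert (Hb := acos_bound w3).
  destruct (Req_dec (sin (acos w3)) 0) as [Z|NZ].
  (* At the poles any horizontal direction will do. *)
  - assert (w1 = 0 /\ w2 = 0) as [-> ->].
    { assert (E := sin2_cos2 (acos w3)). unfold Rsqr in E. rewrite Z, HC in E. split; nra. }
    exists (acos w3), 1, 0. rewrite Z, HC. repeat split; try ring; lra.
  - exists (acos w3), (w1 / sin (acos w3)), (w2 / sin (acos w3)).
    repeat split; try (now field); try lra; auto.
    assert (E := sin2_cos2 (acos w3)). unfold Rsqr in E. rewrite HC in E.
    replace ((w1 / sin (acos w3)) ^ 2 + (w2 / sin (acos w3)) ^ 2)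
      with ((w1 ^ 2 + w2 ^ 2) / (sin (acos w3) * sin (acos w3))) by (field; trivial).
    replace (w1 ^ 2 + w2 ^ 2) with (sin (acos w3) * sin (acos w3)) by lra. now field.
Qed.

(* Archimedes' hat-box theorem; the integral does not depend on the axis because its derivative
   along a great circle is the integral of a rotation field. *)
Lemma hat_box (h H : R -> R) w1 w2 w3 : Ck1 1 (fun _ => True) h ->
  (forall u, is_derive H u (h u)) -> w1 ^ 2 + w2 ^ 2 + w3 ^ 2 = 1 ->
  DI (fun th ph => h (dot w1 w2 w3 th ph) * sin th) = 2 * PI * (H 1 - H (-1)).
Proof.
  intros Ch HH Hw.
  destruct (horizontal_frame w1 w2 w3 Hw) as [al [a [b [Hal [Hab [-> [-> ->]]]]]]].
  set (F := fun v : env => h (dot (sin (v 0%nat) * a) (sin (v 0%nat) * b) (cos (v 0%nat))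
                                 (v 1%nat) (v 2%nat)) * sin (v 1%nat)).
  assert (CF : Ck 3 1 All F).
  { unfold F, dot. ck. apply Ck_app_all; ck. }
  set (Iv := fun s => SI 1 F (upd (fun _ => 0) 0 s)).
  assert (Dh : forall x, is_derive h x (Derive h x)).
  { intros x. destruct Ch as [_ Ch]. destruct (Ch 0%nat) as [Q _]; [lia|].
    apply Derive_correct, (Q (fun _ => x) Logic.I). }
  assert (ID : forall s, is_derive Iv s zero).
  { intros s.
    assert (A := Ck_is_derive_at 1 0 (SI 1 F) 0 (fun _ => 0) s (Ck_SI 1 1 F CF) ltac:(lia)).
    rewrite PD_SI in A by (trivial; lia).
    (* Turning the axis acts like rotating the sphere the other way: with g the function h of the
       linear form given by the axis, the s-derivative of the integrand is a combination, with
       coefficients -a and -b, of two rotation fields applied to g. *)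
    replace (SI 1 (PD 0 F) (upd (fun _ => 0) 0 s)) with 0 in A; [exact A|].
    set (g := fun v : env => h (sin s * a * v 0%nat + sin s * b * v 1%nat + cos s * v 2%nat)).
    assert (Cg : Ck 3 1 All g) by (unfold g; apply Ck_app_all; ck).
    assert (G0 : forall v, PD 0 g v
      = sin s * a * Derive h (sin s * a * v 0%nat + sin s * b * v 1%nat + cos s * v 2%nat)).
    { intros v. apply is_derive_unique. unfold g, upd; simpl.
      apply (is_derive_comp h (fun u => sin s * a * u + sin s * b * v 1%nat + cos s * v 2%nat));
        [apply Dh | auto_derive; trivial; ring]. }
    assert (G1 : forall v, PD 1 g v
      = sin s * b * Derive h (sin s * a * v 0%nat + sin s * b * v 1%nat + cos s * v 2%nat)).
    { intros v. apply is_derive_unique. unfold g, upd; simpl.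
      apply (is_derive_comp h (fun u => sin s * a * v 0%nat + sin s * b * u + cos s * v 2%nat));
        [apply Dh | auto_derive; trivial; ring]. }
    assert (G2 : forall v, PD 2 g v
      = cos s * Derive h (sin s * a * v 0%nat + sin s * b * v 1%nat + cos s * v 2%nat)).
    { intros v. apply is_derive_unique. unfold g, upd; simpl.
      apply (is_derive_comp h (fun u => sin s * a * v 0%nat + sin s * b * v 1%nat + cos s * u));
        [apply Dh | auto_derive; trivial; ring]. }
    rewrite SI_DI.
    rewrite (DI_ext _ (fun th ph =>
       - a * ((cos th * PD 0 g (sv th ph) - sin th * cos ph * PD 2 g (sv th ph)) * sin th)
       + - b * ((cos th * PD 1 g (sv th ph) - sin th * sin ph * PD 2 g (sv th ph)) * sin th))).
    - assert (C0 : forall i, (i < 3)%nat -> C2 0 (fun th ph => PD i g (sv th ph))).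
      { intros i Hi. apply C2_sv. now apply Ck_D. }
      rewrite DI_plus, !DI_scal, DI_rot31, DI_rot32; trivial; [ring |..];
        unfold C2; ck; (now apply (C0 0%nat); lia) || (now apply (C0 1%nat); lia)
         || (now apply (C0 2%nat); lia).
    - intros th ph _. rewrite G0, G1, G2. unfold sv; simpl.
      apply is_derive_unique. unfold F, upd, dot; simpl.
      set (y := sin s * a * (sin th * cos ph) + sin s * b * (sin th * sin ph) + cos s * cos th).
      replace (- a * ((cos th * (sin s * a * Derive h y) - sin th * cos ph * (cos s * Derive h y)) * sin th) +
         - b * ((cos th * (sin s * b * Derive h y) - sin th * sin ph * (cos s * Derive h y)) * sin th))
       with ((cos s * a * (sin th * cos ph) + cos s * b * (sin th * sin ph)
               - sin s * cos th) * Derive h y * sin th).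
      2:{ transitivity (sin th * Derive h y * (cos s * sin th * (a * cos ph + b * sin ph)
            - (a ^ 2 + b ^ 2) * (sin s * cos th))); [rewrite Hab|]; ring. }
      apply (is_derive_ext (fun u => sin th * h (sin u * a * (sin th * cos ph)
         + sin u * b * (sin th * sin ph) + cos u * cos th))); [intros u; apply Rmult_comm|].
      match goal with |- is_derive _ _ (?A * ?B) => rewrite (Rmult_comm A B) end.
      apply (is_derive_scal (fun u => h (sin u * a * (sin th * cos ph)
         + sin u * b * (sin th * sin ph) + cos u * cos th))).
      apply (is_derive_comp h (fun u => sin u * a * (sin th * cos ph)
         + sin u * b * (sin th * sin ph) + cos u * cos th)); [apply Dh | auto_derive; trivial; ring]. }
  change (Iv al = 2 * PI * (H 1 - H (-1))).
  assert (E : Iv al = Iv 0).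
  { destruct (Req_dec 0 al) as [<-|N]; trivial. symmetry.
    apply (eq_is_derive Iv 0 al); [auto | lra]. }
  (* With the axis at the pole the integrand depends on th only, and - H (cos th) is a primitive of
     it. *)
  rewrite E. unfold Iv. rewrite SI_DI. unfold DI.
  rewrite (RInt_ext _ (fun th => scal (2 * PI) (h (cos th) * sin th))).
  2:{ intros th _. rewrite (RInt_ext _ (fun _ => h (cos th) * sin th)).
      - rewrite RInt_const. now rewrite Rminus_0_r.
      - intros ph _. unfold F, dot, upd; simpl. rewrite sin_0, cos_0.
        f_equal; f_equal; ring. }
  assert (Ch0 : forall x, continuous (fun th => h (cos th) * sin th) x).
  { intros x. apply (@ex_derive_continuous R_AbsRing R_NormedModule).
    apply (ex_derive_mult (fun th => h (cos th)) sin); [|auto_derive; trivial].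
    apply (ex_derive_comp h cos); [eexists; apply Dh | auto_derive; trivial]. }
  rewrite (@RInt_scal R_CompleteNormedModule (fun th => h (cos th) * sin th)).
  2:{ apply (@ex_RInt_continuous R_CompleteNormedModule); auto. }
  apply (f_equal (Rmult (2 * PI))).
  apply is_RInt_unique.
  replace (H 1 - H (-1)) with (minus (- H (cos PI)) (- H (cos 0))).
  2:{ rewrite cos_PI, cos_0. unfold minus, plus, opp; simpl. ring. }
  apply (is_RInt_derive (fun th => - H (cos th))); auto.
  intros x _. replace (h (cos x) * sin x) with (- (- sin x * h (cos x))) by ring.
  apply (@is_derive_opp R_AbsRing R_NormedModule (fun th => H (cos th))).
  apply (is_derive_comp H cos); [apply HH | auto_derive; trivial; ring].
Qed.

(** * Spherical means along light cones *)

Lemma continuity_2d_upd n f v i j x y : i <> j -> cont n f (upd (upd v i x) j y) ->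
  continuity_2d_pt (fun a b => f (upd (upd v i a) j b)) x y.
Proof.
  intros Hij H eps. destruct (H eps (cond_pos eps)) as [d [Hd Q]].
  exists (mkposreal d Hd). intros a b Ha Hb. simpl in Ha, Hb. apply Q. intros l _.
  destruct (Nat.eq_dec l j) as [->|N1].
  - now rewrite !upd_eq.
  - rewrite !(upd_neq _ j l) by trivial. destruct (Nat.eq_dec l i) as [->|N2].
    + now rewrite !upd_eq.
    + rewrite !upd_neq by trivial. now rewrite Rminus_diag, Rabs_R0.
Qed.

Lemma PD_comm n F i j v : Ck n 2 All F -> (i < n)%nat -> (j < n)%nat ->
  PD i (PD j F) v = PD j (PD i F) v.
Proof.
  intros H Hi Hj. destruct (Nat.eq_dec i j) as [->|N]; trivial.
  assert (Ci := Ck_D _ _ _ _ i H Hi). assert (Cj := Ck_D _ _ _ _ j H Hj).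
  assert (E1 : forall a b, Derive (fun t => F (upd (upd v i a) j t)) b
                 = PD j F (upd (upd v i a) j b)).
  { intros a b. unfold PD. rewrite upd_eq. apply Derive_ext; intros; now rewrite upd_upd. }
  assert (E2 : forall a b, Derive (fun t => F (upd (upd v i t) j b)) a
                 = PD i F (upd (upd v i a) j b)).
  { intros a b. unfold PD. rewrite upd_neq, upd_eq by trivial. apply Derive_ext; intros t.
    rewrite (upd_comm _ j i) by auto. now rewrite upd_upd. }
  assert (E3 : forall a b, Derive (fun z => Derive (fun t => F (upd (upd v i z) j t)) b) a
                 = PD i (PD j F) (upd (upd v i a) j b)).
  { intros a b. unfold PD at 1. rewrite upd_neq, upd_eq by trivial. apply Derive_ext; intros t.
    rewrite E1. rewrite (upd_comm _ j i) by auto. now rewrite upd_upd. }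
  assert (E4 : forall a b, Derive (fun z => Derive (fun t => F (upd (upd v i t) j z)) a) b
                 = PD j (PD i F) (upd (upd v i a) j b)).
  { intros a b. unfold PD at 1. rewrite upd_eq. apply Derive_ext; intros t.
    rewrite E2. now rewrite upd_upd. }
  assert (S := Schwarz (fun a b => F (upd (upd v i a) j b)) (v i) (v j)).
  cbv beta in S. rewrite E3, E4 in S. rewrite upd_id, upd_id in S. apply S.
  - exists (mkposreal 1 Rlt_0_1). intros a b _ _. repeat split.
    + exists (PD i F (upd (upd v i a) j b)).
      assert (Q := Ck_is_derive_at n 1 F i (upd v j b) a H Hi).
      rewrite (upd_comm _ j i) in Q by auto. apply is_derive_ext with (2 := Q).
      intros t; now rewrite (upd_comm _ j i) by auto.
    + exists (PD j F (upd (upd v i a) j b)). apply (Ck_is_derive_at n 1 F j (upd v i a) b H Hj).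
    + exists (PD i (PD j F) (upd (upd v i a) j b)).
      assert (Q := Ck_is_derive_at n 0 (PD j F) i (upd v j b) a Cj Hi).
      rewrite (upd_comm _ j i) in Q by auto. apply is_derive_ext with (2 := Q).
      intros t. rewrite E1. now rewrite (upd_comm _ j i) by auto.
    + exists (PD j (PD i F) (upd (upd v i a) j b)).
      apply (is_derive_ext (fun z => PD i F (upd (upd v i a) j z))).
      * intros t; now rewrite E2.
      * apply (Ck_is_derive_at n 0 (PD i F) j (upd v i a) b Ci Hj).
  - apply continuity_2d_pt_ext with (fun a b => PD i (PD j F) (upd (upd v i a) j b)).
    + intros; now rewrite E3.
    + apply continuity_2d_upd with n; trivial. apply (Ck_cont n 0 All); [|easy].
      now apply Ck_D.
  - apply continuity_2d_pt_ext with (fun a b => PD j (PD i F) (upd (upd v i a) j b)).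
    + intros; now rewrite E4.
    + apply continuity_2d_upd with n; trivial. apply (Ck_cont n 0 All); [|easy].
      now apply Ck_D.
Qed.

Lemma chain4 U g (a b c d : R -> R) a' b' c' d' t : Open 4 U -> Ck 4 1 U g ->
  U (env4 (a t) (b t) (c t) (d t)) ->
  is_derive a t a' -> is_derive b t b' -> is_derive c t c' -> is_derive d t d' ->
  is_derive (fun s => g (env4 (a s) (b s) (c s) (d s))) t
    (PD 0 g (env4 (a t) (b t) (c t) (d t)) * a' + PD 1 g (env4 (a t) (b t) (c t) (d t)) * b'
     + PD 2 g (env4 (a t) (b t) (c t) (d t)) * c' + PD 3 g (env4 (a t) (b t) (c t) (d t)) * d').
Proof.
  intros HU G Hu Ha Hb Hc Hd.
  set (cv := fun j => match j with 0%nat => a | 1%nat => b | 2%nat => c | 3%nat => d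
                       | _ => fun _ => 0 end).
  assert (E : forall s, (fun j => cv j s) = env4 (a s) (b s) (c s) (d s)).
  { intros s; apply functional_extensionality; intros [|[|[|[|j]]]]; trivial. }
  rewrite <- E in Hu.
  assert (H := chain_rule 4 U g cv
    (fun j => match j with 0%nat => a' | 1%nat => b' | 2%nat => c' | 3%nat => d' | _ => 0 end) t
    HU G Hu).
  cbv beta in H. simpl sumn in H. rewrite E in H. rewrite Rplus_0_l in H.
  apply is_derive_ext with (2 := H ltac:(intros [|[|[|[|j]]]] Hj; trivial; lia)).
  intros s; now rewrite E.
Qed.

Lemma Ck_env4 n k U V g (a b c d : env -> R) : Open n U -> Open 4 V -> Ck 4 k V g ->
  (forall v, U v -> V (env4 (a v) (b v) (c v) (d v))) ->
  Ck n k U a -> Ck n k U b -> Ck n k U c -> Ck n k U d ->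
  Ck n k U (fun v => g (env4 (a v) (b v) (c v) (d v))).
Proof.
  intros HU HV G HUV Ha Hb Hc Hd.
  set (cv := fun j => match j with 0%nat => a | 1%nat => b | 2%nat => c | 3%nat => d
                       | _ => fun _ => 0 end).
  assert (E : forall v, (fun j => cv j v) = env4 (a v) (b v) (c v) (d v)).
  { intros s; apply functional_extensionality; intros [|[|[|[|j]]]]; trivial. }
  assert (H : Ck n k U (fun v => g (fun j => cv j v))).
  { apply Ck_comp with 4%nat V; trivial.
    - intros v Hv; rewrite E; auto.
    - intros [|[|[|[|j]]]] Hj; trivial; lia. }
  apply Ck_ext with (3 := H); trivial. intros v _. now rewrite E.
Qed.

Lemma sphere_sq th ph : (sin th * cos ph) ^ 2 + (sin th * sin ph) ^ 2 + cos th ^ 2 = 1.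
Proof.
  assert (E := sin2_cos2 th). assert (E' := sin2_cos2 ph). unfold Rsqr in *.
  transitivity (sin th * sin th * (sin ph * sin ph + cos ph * cos ph) + cos th * cos th); [ring|].
  rewrite E'. lra.
Qed.

Lemma is_derive_eq (f : R -> R) (x l l' : R) : is_derive f x l -> l = l' -> is_derive f x l'.
Proof. now intros H <-. Qed.

Section Cone.
Context (F : env -> R) (HF : Cinf 4 All F) (t x y z : R).

Definition cone (r th ph : R) : env :=
  env4 (t + r) (x + r * (sin th * cos ph)) (y + r * (sin th * sin ph)) (z + r * cos th).

Lemma Ck_cone n k g (a b c : env -> R) : Cinf 4 All g ->
  Ck n k All a -> Ck n k All b -> Ck n k All c ->
  Ck n k All (fun v => g (cone (a v) (b v) (c v))).
Proof.
  intros G Ha Hb Hc. unfold cone.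
  apply Ck_env4 with All; trivial; try apply Open_All; ck.
Qed.

Lemma C2_cone k g r : Cinf 4 All g -> C2 k (fun th ph => g (cone r th ph)).
Proof. intros G. apply Ck_cone with (a := fun _ => r); trivial; ck. Qed.

Lemma cone_derive g r th ph : Cinf 4 All g ->
  is_derive (fun r => g (cone r th ph)) r
    (PD 0 g (cone r th ph) + PD 1 g (cone r th ph) * (sin th * cos ph)
     + PD 2 g (cone r th ph) * (sin th * sin ph) + PD 3 g (cone r th ph) * cos th).
Proof.
  intros G. rewrite <- (Rmult_1_r (PD 0 g (cone r th ph))).
  apply (chain4 All g (fun r => t + r) (fun r => x + r * (sin th * cos ph))
    (fun r => y + r * (sin th * sin ph)) (fun r => z + r * cos th));
    try apply Open_All; try easy; try apply G; auto_derive; trivial; ring.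
Qed.

Definition lapl (v : env) : R := PD 1 (PD 1 F) v + PD 2 (PD 2 F) v + PD 3 (PD 3 F) v.

Definition hess (r th ph : R) : R :=
  let v := cone r th ph in
  PD 1 (PD 1 F) v * (sin th * cos ph) ^ 2 + PD 2 (PD 2 F) v * (sin th * sin ph) ^ 2
  + PD 3 (PD 3 F) v * cos th ^ 2
  + 2 * (PD 1 (PD 2 F) v * (sin th * cos ph) * (sin th * sin ph)
         + PD 1 (PD 3 F) v * (sin th * cos ph) * cos th
         + PD 2 (PD 3 F) v * (sin th * sin ph) * cos th).

Definition grad (r th ph : R) : R :=
  let v := cone r th ph in
  PD 1 F v * (sin th * cos ph) + PD 2 F v * (sin th * sin ph) + PD 3 F v * cos th.

(* The spherical Laplacian is the sum of the squares of the three rotation fields, so it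
   integrates to zero. *)
Lemma DI_spherical_laplacian r :
  DI (fun th ph => (r * lapl (cone r th ph) - r * hess r th ph - 2 * grad r th ph) * sin th) = 0.
Proof.
  set (e := fun v : env => env4 (t + r) (x + r * v 0%nat) (y + r * v 1%nat) (z + r * v 2%nat)).
  set (f := fun j v => PD j F (e v)).
  assert (CF1 : forall j, (j < 4)%nat -> Cinf 4 All (PD j F)) by (intros; now apply Cinf_D).
  assert (Cf : forall j, (j < 4)%nat -> Ck 3 1 All (f j)).
  { intros j Hj. unfold f, e. apply Ck_env4 with All; try apply Open_All; try easy; try apply CF1;
      trivial; ck. }
  assert (Df : forall j k v, (j < 4)%nat -> (k < 3)%nat ->
     is_derive (fun s => f j (upd v k s)) (v k) (r * PD (S k) (PD j F) (e v))).
  { intros j k v Hj Hk. unfold f, e. destruct k as [|[|[|k]]]; try lia; unfold upd; simpl.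
    - eapply is_derive_eq.
      + apply (chain4 All (PD j F) (fun _ => t + r) (fun s => x + r * s)
          (fun s => y + r * v 1%nat) (fun s => z + r * v 2%nat) 0 r 0 0); [apply Open_All | now apply CF1 | easy | auto_derive; trivial; ring ..].
      + cbv beta; unfold e; ring.
    - eapply is_derive_eq.
      + apply (chain4 All (PD j F) (fun _ => t + r) (fun s => x + r * v 0%nat)
          (fun s => y + r * s) (fun s => z + r * v 2%nat) 0 0 r 0); [apply Open_All | now apply CF1 | easy | auto_derive; trivial; ring ..].
      + cbv beta; unfold e; ring.
    - eapply is_derive_eq.
      + apply (chain4 All (PD j F) (fun _ => t + r) (fun s => x + r * v 0%nat)
          (fun s => y + r * v 1%nat) (fun s => z + r * s) 0 0 0 r); [apply Open_All | now apply CF1 | easy | auto_derive; trivial; ring ..].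
      + cbv beta; unfold e; ring. }
  (* Up to a factor r this is a rotation field applied to the restriction of F to the sphere; the
     rotation identities below integrate the second application of the field. *)
  set (g := fun i j (v : env) => v i * f (S j) v - v j * f (S i) v).
  assert (Cg : forall i j, (i < 3)%nat -> (j < 3)%nat -> Ck 3 1 All (g i j)).
  { intros i j Hi Hj. unfold g; ck; apply Cf; lia. }
  assert (Dg : forall i j k v, (i < 3)%nat -> (j < 3)%nat -> (k < 3)%nat ->
    PD k (g i j) v = ((if Nat.eqb i k then 1 else 0) * f (S j) v
                      + v i * (r * PD (S k) (PD (S j) F) (e v)))
                     - ((if Nat.eqb j k then 1 else 0) * f (S i) v
                      + v j * (r * PD (S k) (PD (S i) F) (e v)))).
  { intros i j k v Hi Hj Hk. apply is_derive_unique. unfold g.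
    assert (P : forall i, (i < 3)%nat -> is_derive (fun s => upd v k s i) (v k)
              (if Nat.eqb i k then 1 else 0)).
    { intros l Hl. unfold upd. destruct (Nat.eqb l k).
      - apply @is_derive_id.
      - apply @is_derive_const. }
    assert (A1 := prod_derive _ _ _ _ _ (P i Hi) (Df (S j) k v ltac:(lia) Hk)).
    assert (A2 := prod_derive _ _ _ _ _ (P j Hj) (Df (S i) k v ltac:(lia) Hk)).
    cbv beta in A1, A2. rewrite upd_id in A1, A2.
    exact (is_derive_minus _ _ _ _ _ A1 A2). }
  assert (R1 := DI_rot12 (g 0%nat 1%nat) (Cg 0%nat 1%nat ltac:(lia) ltac:(lia))).
  assert (R2 := DI_rot31 (g 2%nat 0%nat) (Cg 2%nat 0%nat ltac:(lia) ltac:(lia))).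
  assert (R3 := DI_rot32 (g 2%nat 1%nat) (Cg 2%nat 1%nat ltac:(lia) ltac:(lia))).
  assert (Cg0 : forall i j k, (i < 3)%nat -> (j < 3)%nat -> (k < 3)%nat ->
    Ck 2 0 All (fun v => PD k (g i j) (sv (v 0%nat) (v 1%nat)))).
  { intros i j k Hi Hj Hk. apply (C2_sv 0). apply Ck_D; auto. }
  rewrite (DI_ext _ (fun th ph =>
    (sin th * cos ph * PD 1 (g 0%nat 1%nat) (sv th ph)
      - sin th * sin ph * PD 0 (g 0%nat 1%nat) (sv th ph)) * sin th
    + ((cos th * PD 0 (g 2%nat 0%nat) (sv th ph)
      - sin th * cos ph * PD 2 (g 2%nat 0%nat) (sv th ph)) * sin th
    + (cos th * PD 1 (g 2%nat 1%nat) (sv th ph)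
      - sin th * sin ph * PD 2 (g 2%nat 1%nat) (sv th ph)) * sin th))).
  - rewrite !DI_plus, R1, R2, R3; [ring | ..]; unfold C2; ck; apply Cg0; lia.
  - intros th ph _. rewrite !Dg by lia.
    change (e (sv th ph)) with (cone r th ph). unfold f. change (e (sv th ph)) with (cone r th ph).
    unfold lapl, hess, grad, sv, env3. cbn [Nat.eqb].
    rewrite (PD_comm 4 F 2 1), (PD_comm 4 F 3 1), (PD_comm 4 F 3 2) by (trivial; lia).
    assert (E := sphere_sq th ph).
    set (a := sin th * cos ph) in *. set (b := sin th * sin ph) in *. set (c := cos th) in *.
    set (v := cone r th ph).
    transitivity ((r * ((a ^ 2 + b ^ 2 + c ^ 2) * (PD 1 (PD 1 F) v + PD 2 (PD 2 F) v + PD 3 (PD 3 F) v))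
      - r * (PD 1 (PD 1 F) v * a ^ 2 + PD 2 (PD 2 F) v * b ^ 2 + PD 3 (PD 3 F) v * c ^ 2
       + 2 * (PD 1 (PD 2 F) v * a * b + PD 1 (PD 3 F) v * a * c + PD 2 (PD 3 F) v * b * c))
      - 2 * (PD 1 F v * a + PD 2 F v * b + PD 3 F v * c)) * sin th).
    + rewrite E; ring.
    + ring.
Qed.

Definition Aint (r : R) : R :=
  DI (fun th ph => (grad r th ph - PD 0 F (cone r th ph)) * sin th).
Definition Bint (r : R) : R := DI (fun th ph => F (cone r th ph) * sin th).

Lemma param_derive (f df : R -> R -> R -> R) r :
  Ck 3 1 All (fun v => f (v 0%nat) (v 1%nat) (v 2%nat)) ->
  (forall r th ph, is_derive (fun s => f s th ph) r (df r th ph)) ->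
  is_derive (fun r => DI (f r)) r (DI (df r)).
Proof.
  intros Cf Hf. set (f' := fun v : env => f (v 0%nat) (v 1%nat) (v 2%nat)) in *.
  assert (A := Ck_is_derive_at 1 0 (SI 1 f') 0 (fun _ => 0) r (Ck_SI 1 1 f' Cf) ltac:(lia)).
  rewrite PD_SI in A by (trivial; lia).
  replace (PD 0 f') with (fun v : env => df (v 0%nat) (v 1%nat) (v 2%nat)) in A.
  - exact A.
  - symmetry. apply functional_extensionality; intros v. apply is_derive_unique, Hf.
Qed.

(** If U (t, r) denotes the integral of F over the directions at distance r from x, then r U obeys
    the wave equation in one space dimension, with r times the integral of Box F on the right. Here
    [r * Aint + Bint] is (d_r - d_t)(r U) on the cone, and differentiation along the forward cone
    applies the other factor d_r + d_t. *)
Lemma cone_energy r :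
  is_derive (fun r => r * Aint r + Bint r) r
    (r * DI (fun th ph => (lapl (cone r th ph) - PD 0 (PD 0 F) (cone r th ph)) * sin th)).
Proof.
  assert (CF1 : forall j, (j < 4)%nat -> Cinf 4 All (PD j F)) by (intros; now apply Cinf_D).
  assert (CF2 : forall i j, (i < 4)%nat -> (j < 4)%nat -> Cinf 4 All (PD i (PD j F)))
    by (intros; apply Cinf_D; auto).
  assert (HA : is_derive Aint r (DI (fun th ph =>
     (hess r th ph - PD 0 (PD 0 F) (cone r th ph)) * sin th))).
  { apply (param_derive (fun r th ph => (grad r th ph - PD 0 F (cone r th ph)) * sin th)
      (fun r th ph => (hess r th ph - PD 0 (PD 0 F) (cone r th ph)) * sin th)).
    - unfold grad. ck; apply Ck_cone; ck; apply CF1; lia.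
    - intros r' th ph. unfold grad.
      assert (D0 := cone_derive (PD 0 F) r' th ph (CF1 0%nat ltac:(lia))).
      assert (D1 := cone_derive (PD 1 F) r' th ph (CF1 1%nat ltac:(lia))).
      assert (D2 := cone_derive (PD 2 F) r' th ph (CF1 2%nat ltac:(lia))).
      assert (D3 := cone_derive (PD 3 F) r' th ph (CF1 3%nat ltac:(lia))).
      eapply is_derive_eq.
      + apply (is_derive_ext (fun s => sin th * (
           (sin th * cos ph * PD 1 F (cone s th ph) + sin th * sin ph * PD 2 F (cone s th ph)
             + cos th * PD 3 F (cone s th ph)) - PD 0 F (cone s th ph)))); [intros u|].
        { change (sin th * (
           (sin th * cos ph * PD 1 F (cone u th ph) + sin th * sin ph * PD 2 F (cone u th ph)
             + cos th * PD 3 F (cone u th ph)) - PD 0 F (cone u th ph)) =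
            (PD 1 F (cone u th ph) * (sin th * cos ph) + PD 2 F (cone u th ph) * (sin th * sin ph)
             + PD 3 F (cone u th ph) * cos th - PD 0 F (cone u th ph)) * sin th). ring. }
        apply (is_derive_scal (fun s =>
           (sin th * cos ph * PD 1 F (cone s th ph) + sin th * sin ph * PD 2 F (cone s th ph)
             + cos th * PD 3 F (cone s th ph)) - PD 0 F (cone s th ph))).
        apply (is_derive_minus (fun s => sin th * cos ph * PD 1 F (cone s th ph)
             + sin th * sin ph * PD 2 F (cone s th ph)
             + cos th * PD 3 F (cone s th ph))); [|exact D0].
        apply (is_derive_plus (fun s => sin th * cos ph * PD 1 F (cone s th ph)
             + sin th * sin ph * PD 2 F (cone s th ph)));
          [|apply (is_derive_scal (fun s => PD 3 F (cone s th ph))), D3].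
        apply (is_derive_plus (fun s => sin th * cos ph * PD 1 F (cone s th ph)));
          [apply (is_derive_scal (fun s => PD 1 F (cone s th ph))), D1
          |apply (is_derive_scal (fun s => PD 2 F (cone s th ph))), D2].
      + unfold minus, plus, opp, hess; simpl.
        rewrite (PD_comm 4 F 2 1), (PD_comm 4 F 3 1), (PD_comm 4 F 3 2),
          (PD_comm 4 F 0 1), (PD_comm 4 F 0 2), (PD_comm 4 F 0 3) by (apply HF || lia).
        ring. }
  assert (HB : is_derive Bint r (DI (fun th ph =>
     (PD 0 F (cone r th ph) + grad r th ph) * sin th))).
  { apply (param_derive (fun r th ph => F (cone r th ph) * sin th)
      (fun r th ph => (PD 0 F (cone r th ph) + grad r th ph) * sin th)).
    - ck; apply Ck_cone; ck; apply HF.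
    - intros r' th ph. rewrite Rmult_comm.
      apply (is_derive_ext (fun s => sin th * F (cone s th ph))); [intros; apply Rmult_comm|].
      apply (is_derive_scal (fun s => F (cone s th ph))).
      eapply is_derive_eq; [apply cone_derive, HF | unfold grad; ring]. }
  eapply is_derive_eq.
  - apply (is_derive_plus (fun r => r * Aint r)); [|exact HB].
    apply (prod_derive (fun r => r) Aint); [apply @is_derive_id | exact HA].
  - unfold plus, one; simpl. rewrite Rmult_1_l. unfold Aint.
    assert (L := DI_spherical_laplacian r).
    assert (C0 : forall i, (i < 4)%nat -> C2 0 (fun th ph => PD i F (cone r th ph)))
      by (intros; now apply C2_cone, CF1).
    assert (C00 : forall i j, (i < 4)%nat -> (j < 4)%nat ->
      C2 0 (fun th ph => PD i (PD j F) (cone r th ph))) by (intros; now apply C2_cone, CF2).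
    unfold C2 in C0, C00.
    rewrite <- !DI_scal by (unfold C2, lapl, hess, grad; cbv beta zeta; ck; (apply C0 || apply C00); lia). rewrite <- !DI_plus by (unfold C2, lapl, hess, grad; cbv beta zeta; ck; (apply C0 || apply C00); lia).
    (* Adding the vanishing integral trades [r * hess + 2 * grad] for [r * lapl]. *)
    rewrite <- (Rplus_0_r (DI _)), <- L at 1. rewrite <- !DI_plus by (unfold C2, lapl, hess, grad; cbv beta zeta; ck; (apply C0 || apply C00); lia).
    apply DI_ext; intros; ring.
Qed.
End Cone.

(** * The source near null infinity *)

Lemma jb_ge1 q : 1 <= jb q.
Proof. unfold jb. rewrite <- sqrt_1 at 1. apply sqrt_le_1_alt. nra. Qed.

Lemma jb_sq q : jb q * jb q = 1 + q ^ 2.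
Proof. apply sqrt_sqrt; nra. Qed.

Lemma jb_opp q : jb (- q) = jb q.
Proof. unfold jb; f_equal; ring. Qed.

Lemma nrm_ge0 x y z : 0 <= nrm x y z.
Proof. apply sqrt_pos. Qed.

Lemma nrm_sq x y z : nrm x y z * nrm x y z = x ^ 2 + y ^ 2 + z ^ 2.
Proof. apply sqrt_sqrt; nra. Qed.

Lemma nrm_scal c x y z : 0 <= c -> nrm (c * x) (c * y) (c * z) = c * nrm x y z.
Proof.
  intros Hc. unfold nrm.
  replace ((c * x) ^ 2 + (c * y) ^ 2 + (c * z) ^ 2) with (c ^ 2 * (x ^ 2 + y ^ 2 + z ^ 2)) by ring.
  rewrite sqrt_mult_alt by nra. now rewrite sqrt_pow2.
Qed.

Lemma nrm_pos x y z : 0 < x ^ 2 + y ^ 2 + z ^ 2 -> 0 < nrm x y z.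
Proof. apply sqrt_lt_R0. Qed.

Lemma Ck1_jb k : Ck1 k (fun _ => True) jb.
Proof.
  unfold Ck1, jb. apply Ck_sqrt; [apply (open1_Open _ open1_All)| |intros; nra].
  assert (H := open1_Open _ open1_All). ck.
Qed.

Lemma Open_pos n f : Ck n 0 All f -> Open n (fun v => 0 < f v).
Proof.
  intros H v Hv. destruct (Ck_cont n 0 All f v H Logic.I (f v) Hv) as [d [Hd Q]].
  exists d; split; trivial. intros w Hw. specialize (Q w Hw). apply Rabs_def2 in Q; lra.
Qed.

Definition sq (a b c : env -> R) : env -> R := fun v => a v ^ 2 + b v ^ 2 + c v ^ 2.

Lemma Ck_nrm n k U a b c : Open n U -> Ck n k U a -> Ck n k U b -> Ck n k U c ->
  (forall v, U v -> 0 < sq a b c v) -> Ck n k U (fun v => nrm (a v) (b v) (c v)).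
Proof. intros HU Ha Hb Hc HP. unfold nrm. apply Ck_sqrt; ck. Qed.

Lemma Open_punct : Open 4 (fun v => punct (v 0%nat) (v 1%nat) (v 2%nat) (v 3%nat)).
Proof.
  intros v Hv.
  assert (P : 0 < sq (fun v => v 1%nat) (fun v => v 2%nat) (fun v => v 3%nat) v).
  { unfold punct in Hv. unfold sq. nra. }
  destruct (Open_pos 4 (sq (fun v => v 1%nat) (fun v => v 2%nat) (fun v => v 3%nat))) with (v := v)
    as [d [Hd Q]]; trivial.
  { unfold sq; ck. }
  exists d; split; trivial. intros w Hw. specialize (Q w Hw). unfold sq in Q. unfold punct; lra.
Qed.

(* With [q] the value of [|x| - t] and [e] a scale, [psi q x e] is [e^-3] times the source at
   [x / e]; it vanishes for [|x| < e], and at [x = 0] because Rocq's [/ 0] is [0]. *)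
Definition psi (chi : R -> R) (m : fun4) (q x y z e : R) : R :=
  homext m q x y z / nrm x y z ^ 3 * chi (jb q * e / nrm x y z).

Section Source.
Context (chi : R -> R) (Hchi_s : Smooth1 chi) (Hchi_0 : forall s, s > 1 / 2 -> chi s = 0).
Context (m : fun4) (Hm_s : SmoothOn punct (homext m)).

(** As [jb q >= 1], the argument of the cutoff exceeds 1 when 0 < |x| < e. *)
Lemma psi_zero q x y z e : 0 < e -> x ^ 2 + y ^ 2 + z ^ 2 < e ^ 2 -> psi chi m q x y z e = 0.
Proof.
  intros He Hx. unfold psi.
  destruct (Req_dec (nrm x y z) 0) as [Z|NZ].
  - rewrite Z. unfold Rdiv. rewrite pow_i, Rinv_0 by lia. ring.
  - assert (P := nrm_ge0 x y z). assert (S := nrm_sq x y z).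
    assert (L : nrm x y z < e) by nra.
    rewrite Hchi_0; [ring|].
    assert (J := jb_ge1 q). apply Rlt_gt, Rlt_le_trans with 1; [lra|].
    apply Rmult_le_reg_r with (nrm x y z); [lra|].
    unfold Rdiv. rewrite Rmult_assoc, Rinv_l by trivial. nra.
Qed.

(** Where x is nonzero every factor is smooth; near a zero of x the scale e is positive and [psi]
    vanishes identically. So q, which involves |x| in the applications, has to be smooth only off
    the zeros of x. *)
Lemma Ck_psi n k q a b c e : Ck n k All a -> Ck n k All b -> Ck n k All c -> Ck n k All e ->
  Ck n k (fun v => 0 < sq a b c v) q ->
  (forall v, ~ 0 < sq a b c v -> 0 < e v) ->
  Ck n k All (fun v => psi chi m (q v) (a v) (b v) (c v) (e v)).
Proof.
  intros Ha Hb Hc He Hq HP.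
  assert (Csq : Ck n 0 All (sq a b c)).
  { unfold sq; ck; apply (Ck_le n 0 k); trivial; lia. }
  apply Ck_local; intros v _.
  destruct (Rlt_dec 0 (sq a b c v)) as [P|N].
  - exists (fun v => 0 < sq a b c v); split; trivial.
    assert (HU := Open_pos _ _ Csq).
    assert (S : forall f, Ck n k All f -> Ck n k (fun v => 0 < sq a b c v) f).
    { intros f; now apply Ck_sub. }
    assert (Cn : Ck n k (fun v => 0 < sq a b c v) (fun v => nrm (a v) (b v) (c v))).
    { apply Ck_nrm; auto. }
    assert (NZ : forall v, 0 < sq a b c v -> nrm (a v) (b v) (c v) <> 0).
    { intros w Hw. apply Rgt_not_eq, nrm_pos, Hw. }
    unfold psi, Rdiv. apply Ck_mult; trivial; [apply Ck_mult; trivial|].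
    + apply (Ck_env4 n k _ (fun v => punct (v 0%nat) (v 1%nat) (v 2%nat) (v 3%nat))
        (lift (homext m)) q a b c); auto.
      * apply Open_punct.
      * now apply SmoothOn_Cinf.
      * intros w Hw. unfold punct; simpl. unfold sq in Hw. lra.
    + apply Ck_inv; ck. intros w Hw. apply pow_nonzero; auto.
    + apply Ck_app_all; trivial; [now apply Smooth1_Ck1|].
      ck; auto.
      * apply Ck_app_all; trivial. apply Ck1_jb.
      * apply Ck_inv; auto.
  - exists (fun v => 0 < e v /\ 0 < e v ^ 2 - sq a b c v); split.
    + specialize (HP v N). split; trivial.
      assert (sq a b c v = 0); [|nra].
      unfold sq in *. generalize (pow2_ge_0 (a v)) (pow2_ge_0 (b v)) (pow2_ge_0 (c v)); lra.
    + assert (He0 : Ck n 0 All e) by (apply (Ck_le n 0 k); trivial; lia).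
      assert (HU : Open n (fun v => 0 < e v /\ 0 < e v ^ 2 - sq a b c v)).
      { apply Open_and; apply Open_pos; trivial. apply Ck_minus; [apply Open_All | ck | exact Csq]. }
      apply Ck_ext with (fun _ => 0); trivial; [|now apply Ck_const].
      intros w [W1 W2]. symmetry; apply psi_zero; trivial. unfold sq in W2; lra.
Qed.

Definition source : fun4 := fun t x y z => psi chi m (nrm x y z - t) x y z 1.

Lemma Cinf_source : Cinf 4 All (lift source).
Proof.
  intros k.
  assert (HU : Open 4 (fun v => 0 < sq (fun v => v 1%nat) (fun v => v 2%nat) (fun v => v 3%nat) v)).
  { apply Open_pos; unfold sq; ck. }
  unfold lift, source.
  apply Ck_psi with (q := fun v => nrm (v 1%nat) (v 2%nat) (v 3%nat) - v 0%nat)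
    (a := fun v => v 1%nat) (b := fun v => v 2%nat) (c := fun v => v 3%nat) (e := fun _ => 1); ck.
  - apply Ck_nrm; ck.
  - intros v _; exact Rlt_0_1.
Qed.

(* Coordinates on the light cone: index 0 to 3 for [(t, x)], 4 for [s], where the radius is
   [rho = (1 - s^2) / s^2], and 5, 6 for the angles.  Then [cv i] is the [i]-th component of
   [s^2 (x + rho sigma)] and [cq] is [|x + rho sigma| - (t + rho)], rationalised so that it is
   smooth up to [s = 0], i.e. up to null infinity. *)
Definition sg (i : nat) (w : env) : R := sv (w 5%nat) (w 6%nat) i.
Definition cv (i : nat) (w : env) : R := w 4%nat ^ 2 * w (S i) + (1 - w 4%nat ^ 2) * sg i w.
Definition cn (w : env) : R := nrm (cv 0 w) (cv 1 w) (cv 2 w).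
Definition cq (w : env) : R :=
  (w 4%nat ^ 2 * (w 1%nat ^ 2 + w 2%nat ^ 2 + w 3%nat ^ 2)
   + 2 * (1 - w 4%nat ^ 2) * (w 1%nat * sg 0 w + w 2%nat * sg 1 w + w 3%nat * sg 2 w)
   - 2 + w 4%nat ^ 2) / (cn w + 1) - w 0%nat + 1.

Definition Psi (w : env) : R := psi chi m (cq w) (cv 0 w) (cv 1 w) (cv 2 w) (w 4%nat ^ 2).

Lemma sg_sq w : sg 0 w ^ 2 + sg 1 w ^ 2 + sg 2 w ^ 2 = 1.
Proof. apply sphere_sq. Qed.

Lemma Cinf_sg i : (i < 3)%nat -> Cinf 7 All (sg i).
Proof. intros Hi k. unfold sg, sv, env3. destruct i as [|[|[|i]]]; try lia; ck. Qed.

Lemma Cinf_cv i : (i < 3)%nat -> Cinf 7 All (cv i).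
Proof. intros Hi k. unfold cv; ck. now apply Cinf_sg. Qed.

Lemma Cinf_Psi : Cinf 7 All Psi.
Proof.
  intros k. unfold Psi. apply Ck_psi; [apply Cinf_cv; lia .. | ck | |].
  - assert (HU : Open 7 (fun v => 0 < sq (cv 0) (cv 1) (cv 2) v)).
    { apply Open_pos. unfold sq; ck; apply Cinf_cv; lia. }
    assert (S : forall f, Cinf 7 All f -> Ck 7 k (fun v => 0 < sq (cv 0) (cv 1) (cv 2) v) f).
    { intros f Hf; now apply Ck_sub with All. }
    assert (Cs : forall i, (i < 3)%nat -> Ck 7 k (fun v => 0 < sq (cv 0) (cv 1) (cv 2) v) (sg i)).
    { intros; apply S; now apply Cinf_sg. }
    unfold cq, Rdiv. ck; try (apply Cs; lia). apply Ck_inv; trivial.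
    + ck. apply Ck_nrm; trivial; apply S, Cinf_cv; lia.
    + intros v _. unfold cn. generalize (nrm_ge0 (cv 0 v) (cv 1 v) (cv 2 v)); lra.
  (* At s = 0 the rescaled point is the unit vector sigma, so it can vanish only where the scale s^2
     is positive. *)
  - intros v N. destruct (Req_dec (v 4%nat) 0) as [Z|NZ]; [|nra].
    exfalso; apply N. unfold sq, cv. rewrite Z.
    generalize (sg_sq v). intros E. ring_simplify. ring_simplify in E. lra.
Qed.

Definition rho (s : R) : R := (1 - s ^ 2) / s ^ 2.

(** Shows cn^2 - 1 to be s^2 times the numerator in [cq]; this is why the phase has a finite limit
    at s = 0. *)
Lemma cn_sq w : cn w * cn w = w 4%nat ^ 2 * (w 4%nat ^ 2 * (w 1%nat ^ 2 + w 2%nat ^ 2 + w 3%nat ^ 2)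
   + 2 * (1 - w 4%nat ^ 2) * (w 1%nat * sg 0 w + w 2%nat * sg 1 w + w 3%nat * sg 2 w)
   - 2 + w 4%nat ^ 2) + 1.
Proof.
  unfold cn. rewrite nrm_sq. unfold cv. generalize (sg_sq w).
  generalize (sg 0 w) (sg 1 w) (sg 2 w). intros a b c E.
  transitivity (w 4%nat ^ 2 * w 4%nat ^ 2 * (w 1%nat ^ 2 + w 2%nat ^ 2 + w 3%nat ^ 2)
    + 2 * w 4%nat ^ 2 * (1 - w 4%nat ^ 2) * (w 1%nat * a + w 2%nat * b + w 3%nat * c)
    + (1 - w 4%nat ^ 2) ^ 2 * (a ^ 2 + b ^ 2 + c ^ 2)); [ring|]. rewrite E; ring.
Qed.

(** The identity cq = |x + rho sigma| - (t + rho), multiplied by s^2 to make sense at s = 0. It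
    comes from cn^2 - 1 = (cn - 1)(cn + 1). *)
Lemma cq_scaled w : w 4%nat ^ 2 * (cq w + w 0%nat - 1) = cn w - 1.
Proof.
  assert (P : 0 <= cn w) by apply nrm_ge0.
  assert (E := cn_sq w). unfold cq.
  match type of E with _ = _ * ?X + 1 => set (N := X) in * end.
  replace (w 4%nat ^ 2 * (N / (cn w + 1) - w 0%nat + 1 + w 0%nat - 1))
    with ((w 4%nat ^ 2 * N) / (cn w + 1)) by (field; lra).
  replace (w 4%nat ^ 2 * N) with ((cn w - 1) * (cn w + 1)) by lra. field; lra.
Qed.

Definition conew (w : env) : env :=
  cone (w 0%nat) (w 1%nat) (w 2%nat) (w 3%nat) (rho (w 4%nat)) (w 5%nat) (w 6%nat).

(** Scaling x and e in [psi] by a common factor c > 0 multiplies it by c^-3, and here c = s^2. *)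
Lemma Psi_source w : w 4%nat <> 0 -> Psi w = / (w 4%nat ^ 6) * lift source (conew w).
Proof.
  intros Hs. assert (He : 0 < w 4%nat ^ 2) by nra.
  set (e := w 4%nat ^ 2) in *.
  assert (X : forall i, (i < 3)%nat -> conew w (S i) = / e * cv i w).
  { intros i Hi. unfold conew, cone, cv, rho, sg, sv. fold e.
    destruct i as [|[|[|i]]]; try lia; simpl; field; nra. }
  unfold lift, source. rewrite (X 0%nat), (X 1%nat), (X 2%nat) by lia.
  rewrite nrm_scal by (left; now apply Rinv_0_lt_compat). fold (cn w).
  assert (T : conew w 0%nat = w 0%nat + (1 - e) / e) by reflexivity. rewrite T.
  assert (Q := cq_scaled w). fold e in Q.
  replace (/ e * cn w - (w 0%nat + (1 - e) / e)) with (cq w).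
  2:{ apply Rmult_eq_reg_l with e; [|lra]. field_simplify; [|lra]. lra. }
  unfold Psi, psi. fold (cn w). fold e.
  rewrite nrm_scal by (left; now apply Rinv_0_lt_compat). fold (cn w).
  assert (E6 : w 4%nat ^ 6 = e ^ 3) by (unfold e; ring). rewrite E6.
  destruct (Req_dec (cn w) 0) as [Z|NZ].
  (* If x + rho sigma = 0, both sides are 0 through the default value of the inverse of 0. *)
  - rewrite Z, Rmult_0_r. unfold Rdiv. rewrite pow_i, Rinv_0 by lia. ring.
  - assert (H : homext m (cq w) (/ e * cv 0 w) (/ e * cv 1 w) (/ e * cv 2 w)
       = homext m (cq w) (cv 0 w) (cv 1 w) (cv 2 w)).
    { unfold homext. rewrite nrm_scal by (left; now apply Rinv_0_lt_compat). fold (cn w).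
      f_equal; field; lra. }
    rewrite H. replace (jb (cq w) * 1 / (/ e * cn w)) with (jb (cq w) * e / cn w) by (field; lra).
    field. split; lra.
Qed.

(** Moving the vertex translates the whole cone, so derivatives in t and x pass through [conew]
    without a Jacobian; [cf] stands for the power of s in front. *)
Lemma conew_PD_gen G cf i w (f : env -> R) : Cinf 4 All G -> (i < 4)%nat -> w 4%nat <> 0 ->
  (forall u, cf (upd w i u) = cf w) ->
  (forall w, w 4%nat <> 0 -> f w = cf w * G (conew w)) ->
  PD i f w = cf w * PD i G (conew w).
Proof.
  intros HG Hi Hw Hcf Hf. apply is_derive_unique.
  apply (is_derive_ext (fun u => cf w * G (conew (upd w i u)))).
  { intros u. rewrite <- (Hcf u). symmetry; apply Hf. now rewrite upd_neq by lia. }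
  apply (is_derive_scal (fun u => G (conew (upd w i u)))).
  assert (P : forall (a b c d : R -> R) (u a' b' c' d' : R),
    is_derive a u a' -> is_derive b u b' -> is_derive c u c' -> is_derive d u d' ->
    is_derive (fun s => G (env4 (a s) (b s) (c s) (d s))) u
    (PD 0 G (env4 (a u) (b u) (c u) (d u)) * a' + PD 1 G (env4 (a u) (b u) (c u) (d u)) * b'
     + PD 2 G (env4 (a u) (b u) (c u) (d u)) * c' + PD 3 G (env4 (a u) (b u) (c u) (d u)) * d')).
  { intros. apply (chain4 All); [apply Open_All | apply HG | easy | assumption ..]. }
  unfold conew, cone, upd.
  destruct i as [|[|[|[|i]]]]; try lia; simpl.
  - eapply is_derive_eq; [apply (P (fun s => s + rho (w 4%nat)) (fun _ => _) (fun _ => _) (fun _ => _)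
      (w 0%nat) 1 0 0 0); auto_derive; trivial; ring | ring].
  - eapply is_derive_eq; [apply (P (fun _ => _) (fun s => s + _) (fun _ => _) (fun _ => _)
      (w 1%nat) 0 1 0 0); auto_derive; trivial; ring | ring].
  - eapply is_derive_eq; [apply (P (fun _ => _) (fun _ => _) (fun s => s + _) (fun _ => _)
      (w 2%nat) 0 0 1 0); auto_derive; trivial; ring | ring].
  - eapply is_derive_eq; [apply (P (fun _ => _) (fun _ => _) (fun _ => _) (fun s => s + _)
      (w 3%nat) 0 0 0 1); auto_derive; trivial; ring | ring].
Qed.

Lemma PD_Psi i w : (i < 4)%nat -> w 4%nat <> 0 ->
  PD i Psi w = / (w 4%nat ^ 6) * PD i (lift source) (conew w).
Proof.
  intros Hi Hw. apply (conew_PD_gen _ (fun w => / (w 4%nat ^ 6))); trivial.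
  - apply Cinf_source.
  - intros u; now rewrite upd_neq by lia.
  - apply Psi_source.
Qed.

Lemma PD2_Psi i w : (i < 4)%nat -> w 4%nat <> 0 ->
  PD i (PD i Psi) w = / (w 4%nat ^ 6) * PD i (PD i (lift source)) (conew w).
Proof.
  intros Hi Hw. apply (conew_PD_gen _ (fun w => / (w 4%nat ^ 6))); trivial.
  - apply Cinf_D; trivial. apply Cinf_source.
  - intros u; now rewrite upd_neq by lia.
  - intros; now apply PD_Psi.
Qed.
End Source.

(** * The advanced potential *)

Definition of_env (c : R) (G : env -> R) : fun4 := fun t x y z => c * G (env4 t x y z).

Lemma pd_of_env i c G : pd i (of_env c G) = of_env c (PD (idx i) G).
Proof.
  apply functional_extensionality; intros t. apply functional_extensionality; intros x.
  apply functional_extensionality; intros y. apply functional_extensionality; intros z.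
  unfold of_env, PD. destruct i; unfold pd, idx; rewrite Derive_scal; f_equal;
    apply Derive_ext; intros s; destruct (upd_env4 t x y z s) as [E0 [E1 [E2 E3]]]; congruence.
Qed.

Lemma Cinf_of_env c G : Cinf 4 All G -> Cinf 4 All (lift (of_env c G)).
Proof.
  intros H k. unfold lift, of_env. apply Ck_mult; ck.
  apply Ck_env4 with All; trivial; ck.
Qed.

Lemma box_of_env c G t x y z : box (of_env c G) t x y z =
  c * (- PD 0 (PD 0 G) (env4 t x y z) + PD 1 (PD 1 G) (env4 t x y z)
       + PD 2 (PD 2 G) (env4 t x y z) + PD 3 (PD 3 G) (env4 t x y z)).
Proof. unfold box. rewrite !pd_of_env. unfold of_env. simpl idx. ring. Qed.

Lemma DI_sin : DI (fun th _ => sin th) = 4 * PI.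
Proof.
  rewrite (DI_ext _ (fun th ph => (fun _ => 1) (dot 0 0 1 th ph) * sin th)) by (intros; ring).
  rewrite (hat_box (fun _ => 1) (fun u => u) 0 0 1); [ring | | | ring].
  - unfold Ck1. apply Ck_const, (open1_Open _ open1_All).
  - intros; apply @is_derive_id.
Qed.

Section Advanced.
Context (chi : R -> R) (Hchi_s : Smooth1 chi) (Hchi_0 : forall s, s > 1 / 2 -> chi s = 0).
Context (m : fun4) (Hm_s : SmoothOn punct (homext m)).

(* The source on the cone is [s^6 * Psi], so [kadv] is the source times [rho |d rho / ds|] and the
   area element of the sphere. *)
Definition kco (w : env) : R := 2 * w 4%nat * (1 - w 4%nat ^ 2) * sin (w 5%nat).
Definition kadv (w : env) : R := kco w * Psi chi m w.
Definition advanced : fun4 := of_env (/ (4 * PI)) (INT 4 0 1 (SI 5 kadv)).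

Lemma Cinf_kadv : Cinf 7 All kadv.
Proof. intros k. unfold kadv, kco. ck. now apply Cinf_Psi. Qed.

Lemma Cinf_INT n a b f : a <= b -> Cinf (S n) All f -> Cinf n All (INT n a b f).
Proof. intros Hab H k; now apply Ck_INT. Qed.

Lemma Cinf_SI n f : Cinf (S (S n)) All f -> Cinf n All (SI n f).
Proof. intros H k; now apply Ck_SI. Qed.

Lemma advanced_smooth : Cinf 4 All (lift advanced).
Proof.
  apply Cinf_of_env, Cinf_INT; [lra|]. apply Cinf_SI, Cinf_kadv.
Qed.

Lemma PD_coef (f g : env -> R) co i : (forall w u, co (upd w i u) = co w) ->
  (forall w, f w = co w * g w) -> forall w, PD i f w = co w * PD i g w.
Proof.
  intros Hco Hf w. unfold PD. rewrite <- Derive_scal. apply Derive_ext; intros u.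
  now rewrite Hf, Hco.
Qed.

Lemma PD_kadv i w : (i < 4)%nat -> PD i (PD i kadv) w = kco w * PD i (PD i (Psi chi m)) w.
Proof.
  intros Hi.
  assert (Hco : forall w u, kco (upd w i u) = kco w).
  { intros; unfold kco. now rewrite !upd_neq by lia. }
  revert w. apply PD_coef; trivial. now apply PD_coef.
Qed.

Definition boxPsi (w : env) : R :=
  - PD 0 (PD 0 (Psi chi m)) w + PD 1 (PD 1 (Psi chi m)) w + PD 2 (PD 2 (Psi chi m)) w
  + PD 3 (PD 3 (Psi chi m)) w.

Lemma Cinf_boxPsi : Cinf 7 All boxPsi.
Proof.
  intros k. unfold boxPsi. assert (H := Cinf_Psi chi Hchi_s Hchi_0 m Hm_s).
  ck; repeat (apply Cinf_D; [|lia]); trivial.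
Qed.

Lemma box_advanced_INT t x y z : box advanced t x y z =
  / (4 * PI) * INT 4 0 1 (SI 5 (fun w => kco w * boxPsi w)) (env4 t x y z).
Proof.
  unfold advanced. rewrite box_of_env. f_equal.
  assert (C0 := Cinf_kadv).
  assert (H : forall i, (i < 4)%nat -> PD i (PD i (INT 4 0 1 (SI 5 kadv)))
     = INT 4 0 1 (SI 5 (fun w => kco w * PD i (PD i (Psi chi m)) w))).
  { intros i Hi.
    assert (C1 := Cinf_D 7 All kadv i C0 ltac:(lia)).
    rewrite (D_INT 4 (SI 5 kadv)) by (trivial; now apply Cinf_SI).
    rewrite PD_SI by (apply C0 || lia).
    rewrite (D_INT 4 (SI 5 (PD i kadv))) by (trivial; now apply Cinf_SI).
    rewrite PD_SI by (apply C1 || lia).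
    do 2 f_equal. apply functional_extensionality; intros w. now apply PD_kadv. }
  rewrite !H by lia.
  assert (CP : forall i, (i < 4)%nat -> Ck 7 0 All (fun w => kco w * PD i (PD i (Psi chi m)) w)).
  { intros i Hi. unfold kco. ck. repeat (apply (Cinf_D 7); [|lia]). now apply Cinf_Psi. }
  transitivity (-1 * INT 4 0 1 (SI 5 (fun w => kco w * PD 0 (PD 0 (Psi chi m)) w)) (env4 t x y z)
    + INT 4 0 1 (SI 5 (fun w => kco w * PD 1 (PD 1 (Psi chi m)) w)) (env4 t x y z)
    + INT 4 0 1 (SI 5 (fun w => kco w * PD 2 (PD 2 (Psi chi m)) w)) (env4 t x y z)
    + INT 4 0 1 (SI 5 (fun w => kco w * PD 3 (PD 3 (Psi chi m)) w)) (env4 t x y z)); [ring|].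
  assert (P0 := CP 0%nat ltac:(lia)). assert (P1 := CP 1%nat ltac:(lia)).
  assert (P2 := CP 2%nat ltac:(lia)). assert (P3 := CP 3%nat ltac:(lia)).
  rewrite <- INT_scal by now apply Ck_SI.
  rewrite <- !INT_plus by (ck; now apply Ck_SI).
  apply INT_ext; [lra|]. intros s _.
  rewrite <- SI_scal by ck. rewrite <- !SI_plus by ck.
  f_equal. apply functional_extensionality; intros w. unfold boxPsi; ring.
Qed.

Definition slice (t x y z s : R) : env := upd (env4 t x y z) 4 s.

(** Kirchhoff's formula as a fundamental theorem of calculus along the cone: by [cone_energy] the
    integrand is minus the derivative of a quantity P that vanishes at null infinity, s = 0, and
    equals 4 pi times the source at the vertex, s = 1. *)
Lemma kirchhoff_FTC t x y z :
  INT 4 0 1 (SI 5 (fun w => kco w * boxPsi w)) (env4 t x y z) = - (4 * PI * source chi m t x y z).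
Proof.
  set (F := lift (source chi m)).
  assert (HF : Cinf 4 All F) by now apply Cinf_source.
  assert (HP : Cinf 7 All (Psi chi m)) by now apply Cinf_Psi.
  set (n1 := fun w => (PD 1 (Psi chi m) w * sg 0 w + PD 2 (Psi chi m) w * sg 1 w
                       + PD 3 (Psi chi m) w * sg 2 w - PD 0 (Psi chi m) w) * sin (w 5%nat)).
  set (n2 := fun w => Psi chi m w * sin (w 5%nat)).
  assert (C1 : Ck 7 1 All n1).
  { unfold n1. ck; try (apply (Cinf_sg); lia); apply Cinf_D; trivial; lia. }
  assert (C2' : Ck 7 1 All n2) by (unfold n2; ck; apply HP).
  set (I1 := fun s => SI 5 n1 (slice t x y z s)).
  set (I2 := fun s => SI 5 n2 (slice t x y z s)).
  assert (D1 : forall s, is_derive I1 s (PD 4 (SI 5 n1) (slice t x y z s))).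
  { intros s. apply (Ck_is_derive_at 5 0 (SI 5 n1) 4); [now apply Ck_SI | lia]. }
  assert (D2 : forall s, is_derive I2 s (PD 4 (SI 5 n2) (slice t x y z s))).
  { intros s. apply (Ck_is_derive_at 5 0 (SI 5 n2) 4); [now apply Ck_SI | lia]. }
  set (J := fun s => SI 5 (fun w => kco w * boxPsi w) (slice t x y z s)).
  (* This is [rho * Aint + Bint] expressed through [Psi], which extends it smoothly to s = 0 with
     the vanishing factors s^4 and s^6. *)
  set (P := fun s => (1 - s ^ 2) * s ^ 4 * I1 s + s ^ 6 * I2 s).
  assert (N1 : forall s, s <> 0 -> I1 s = / s ^ 6 * Aint F t x y z (rho s)).
  { intros s Hs. unfold I1. rewrite SI_DI. unfold Aint.
    assert (CG : C2 0 (fun th ph => (grad F t x y z (rho s) th ph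
      - PD 0 F (cone t x y z (rho s) th ph)) * sin th)).
    { unfold C2, grad. ck; apply C2_cone; apply Cinf_D; trivial; lia. }
    rewrite <- (DI_scal (/ s ^ 6)) by trivial.
    apply DI_ext; intros th ph _. unfold n1. rewrite !PD_Psi by (trivial; lia).
    unfold grad, sg, sv, env3, slice, upd. simpl (Nat.eqb _ _). cbv iota.
    change (conew _) with (cone t x y z (rho s) th ph). fold F. ring. }
  assert (N2 : forall s, s <> 0 -> I2 s = / s ^ 6 * Bint F t x y z (rho s)).
  { intros s Hs. unfold I2. rewrite SI_DI. unfold Bint.
    rewrite <- (DI_scal (/ s ^ 6)) by (unfold C2; ck; now apply C2_cone).
    apply DI_ext; intros th ph _. unfold n2. rewrite Psi_source by trivial.
    unfold slice, upd. simpl (Nat.eqb _ _). cbv iota.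
    change (conew _) with (cone t x y z (rho s) th ph). fold F. ring. }
  assert (NJ : forall s, s <> 0 -> J s = 2 * s * (1 - s ^ 2) * / s ^ 6 *
     DI (fun th ph => (lapl F (cone t x y z (rho s) th ph)
         - PD 0 (PD 0 F) (cone t x y z (rho s) th ph)) * sin th)).
  { intros s Hs. unfold J. rewrite SI_DI.
    rewrite <- DI_scal.
    2:{ unfold C2, lapl. ck; apply C2_cone; repeat (apply Cinf_D; [|lia]); trivial. }
    apply DI_ext; intros th ph _. unfold kco, boxPsi. rewrite !PD2_Psi by (trivial; lia).
    unfold lapl, slice, upd. simpl (Nat.eqb _ _). cbv iota.
    change (conew _) with (cone t x y z (rho s) th ph). fold F. ring. }
  assert (PE : forall s, s <> 0 -> rho s * Aint F t x y z (rho s) + Bint F t x y z (rho s) = P s).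
  { intros s Hs. unfold P. rewrite N1, N2 by trivial. unfold rho. field; trivial. }
  (* The sign is that of d rho / ds = - 2 / s^3. At s = 0, where rho does not describe the cone, the
     powers of s annihilate the derivative of P and the factor s of [kco] annihilates J. *)
  assert (DP : forall s, is_derive P s (- J s)).
  { intros s. destruct (Req_dec s 0) as [->|Hs].
    - assert (J0 : J 0 = 0).
      { unfold J. rewrite SI_DI. rewrite (DI_ext _ (fun _ _ => 0 * 0)).
        - rewrite (DI_scal 0 (fun _ _ => 0)) by (unfold C2; ck). ring.
        - intros th ph _. unfold kco, slice, upd; simpl. ring. }
      rewrite J0. unfold P.
      eapply is_derive_eq.
      + apply (is_derive_plus (fun s => (1 - s ^ 2) * s ^ 4 * I1 s) (fun s => s ^ 6 * I2 s)).
        * apply (prod_derive (fun s => (1 - s ^ 2) * s ^ 4) I1 0 0); [|apply D1].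
          auto_derive; trivial; ring.
        * apply (prod_derive (fun s => s ^ 6) I2 0 0); [|apply D2]. auto_derive; trivial; ring.
      + unfold plus; simpl; ring.
    - apply (is_derive_ext_loc (fun s => rho s * Aint F t x y z (rho s) + Bint F t x y z (rho s))).
      + exists (mkposreal _ (Rabs_pos_lt s Hs)). intros u Hu.
        assert (Hu0 : u <> 0).
        { intros ->. unfold ball in Hu; simpl in Hu. unfold AbsRing_ball, abs, minus, plus, opp in Hu;
            simpl in Hu. rewrite Rplus_0_l, Rabs_Ropp in Hu. lra. }
        now apply PE.
      + assert (DR : is_derive rho s (- 2 / s ^ 3)).
        { unfold rho. auto_derive; [nra | field; trivial]. }
        eapply is_derive_eq.
        * exact (is_derive_comp _ _ _ _ _ (cone_energy F HF t x y z (rho s)) DR).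
        * rewrite NJ by trivial. unfold scal; simpl; unfold mult; simpl. unfold rho. field; trivial. }
  change (RInt J 0 1 = - (4 * PI * source chi m t x y z)).
  assert (CJ : forall s, continuous J s).
  { intros s. apply continuous_upd with 5%nat. apply (Ck_cont 5 0 All); [|easy].
    apply Ck_SI. unfold kco; ck. apply Cinf_boxPsi. }
  assert (E : is_RInt (fun s => - J s) 0 1 (minus (P 1) (P 0))).
  { apply (is_RInt_derive P); auto. intros s _. apply (@continuous_opp R_UniformSpace R_AbsRing R_NormedModule J); auto. }
  apply is_RInt_unique. apply is_RInt_opp in E.
  replace (- (4 * PI * source chi m t x y z)) with (opp (minus (P 1) (P 0))).
  - apply is_RInt_ext with (2 := E). intros s _. apply Ropp_involutive.
  (* At s = 1 the radius is 0: the sphere has collapsed to the vertex. *)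
  - change (- (P 1 - P 0) = - (4 * PI * source chi m t x y z)). unfold P. rewrite N2 by lra.
    replace (rho 1) with 0 by (unfold rho; field).
    replace (Bint F t x y z 0) with (4 * PI * source chi m t x y z); [field|].
    unfold Bint. rewrite <- DI_sin, Rmult_comm, <- DI_scal by (unfold C2; ck).
    apply DI_ext; intros th ph _. f_equal.
    unfold F, lift, cone; simpl. f_equal; ring.
Qed.

Lemma box_advanced t x y z : box advanced t x y z = - source chi m t x y z.
Proof.
  rewrite box_advanced_INT, kirchhoff_FTC. field. apply PI_neq0.
Qed.
End Advanced.

(** * Decay of the advanced potential *)

Lemma Rpower_jb_le q s n : INR n <= s -> Rpower (jb q) (- s) <= / jb q ^ n.
Proof.
  intros Hs. assert (J := jb_ge1 q).
  apply Rle_trans with (Rpower (jb q) (- INR n)).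
  - apply Rle_Rpower; lra.
  - rewrite Rpower_Ropp, Rpower_pow by lra. lra.
Qed.

Lemma homext_normalize f q x y z : nrm x y z <> 0 ->
  homext f q x y z = homext f q (x / nrm x y z) (y / nrm x y z) (z / nrm x y z).
Proof.
  intros H. unfold homext at 2.
  assert (P := nrm_ge0 x y z).
  assert (E : nrm (x / nrm x y z) (y / nrm x y z) (z / nrm x y z) = 1).
  { unfold Rdiv. rewrite !(Rmult_comm _ (/ nrm x y z)).
    rewrite nrm_scal by (left; apply Rinv_0_lt_compat; lra). now field. }
  rewrite E, !Rdiv_1_r. reflexivity.
Qed.

Lemma normalized_unit x y z : nrm x y z <> 0 ->
  (x / nrm x y z) ^ 2 + (y / nrm x y z) ^ 2 + (z / nrm x y z) ^ 2 = 1.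
Proof.
  intros H. assert (S := nrm_sq x y z).
  replace ((x / nrm x y z) ^ 2 + (y / nrm x y z) ^ 2 + (z / nrm x y z) ^ 2)
    with ((x ^ 2 + y ^ 2 + z ^ 2) / (nrm x y z * nrm x y z)) by (field; trivial).
  rewrite S. field. rewrite <- S. nra.
Qed.

Lemma symbol_le (C q s X : R) n : INR n <= s -> X <= C * Rpower (jb q) (- s) ->
  X <= Rabs C / jb q ^ n.
Proof.
  intros Hs HX. eapply Rle_trans; [exact HX|].
  assert (P : 0 < Rpower (jb q) (- s)) by apply exp_pos.
  apply Rle_trans with (Rabs C * Rpower (jb q) (- s)).
  - apply Rmult_le_compat_r; [lra | apply Rle_abs].
  - apply Rmult_le_compat_l; [apply Rabs_pos | now apply Rpower_jb_le].
Qed.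

Lemma SymbolBound_homext f s n : INR n <= s -> SymbolBound f s ->
  exists C, 0 <= C /\ forall q x y z, nrm x y z <> 0 ->
    Rabs (homext f q x y z) <= C / jb q ^ n.
Proof.
  intros Hs Hb. destruct (Hb nil) as [C HC]. simpl in HC.
  exists (Rabs C); split; [apply Rabs_pos|]. intros q x y z Hn.
  rewrite homext_normalize by trivial.
  apply symbol_le with s; trivial. apply HC, normalized_unit; trivial.
Qed.

Lemma cutoff_bounded chi : Smooth1 chi -> (forall s, s < 1 / 4 -> chi s = 1) ->
  (forall s, s > 1 / 2 -> chi s = 0) -> exists C, forall s, Rabs (chi s) <= C.
Proof.
  intros Hs H1 H0.
  destruct (bounded_continuity chi (1 / 4) (1 / 2)) as [M HM].
  { intros x _. apply (@ex_derive_continuous R_AbsRing R_NormedModule), (Hs 1%nat). }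
  exists (Rmax 1 M). intros s.
  destruct (Rlt_dec s (1 / 4)) as [A|A]; [|destruct (Rlt_dec (1 / 2) s) as [B|B]].
  - rewrite H1, Rabs_R1 by trivial. apply Rmax_l.
  - rewrite H0, Rabs_R0 by lra. apply Rle_trans with 1; [lra | apply Rmax_l].
  - apply Rle_trans with M; [|apply Rmax_r]. left. apply (HM s); lra.
Qed.

(** Peetre's inequality: decay in b becomes decay in the distance from a, at the cost of a factor
    depending on a. *)
Lemma peetre2 a b : 1 + (a - b) ^ 2 <= 2 * (1 + a ^ 2) * (1 + b ^ 2).
Proof. generalize (pow2_ge_0 (a + b)) (pow2_ge_0 (a * b)); nra. Qed.

Lemma dot_bound w1 w2 w3 th ph : w1 ^ 2 + w2 ^ 2 + w3 ^ 2 = 1 -> -1 <= dot w1 w2 w3 th ph <= 1.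
Proof.
  intros Hw. assert (E := sphere_sq th ph). unfold dot.
  set (a := sin th * cos ph) in *. set (b := sin th * sin ph) in *. set (c := cos th) in *.
  assert (P := pow2_ge_0 (w1 - a)). assert (P' := pow2_ge_0 (w2 - b)).
  assert (P'' := pow2_ge_0 (w3 - c)). assert (N := pow2_ge_0 (w1 + a)).
  assert (N' := pow2_ge_0 (w2 + b)). assert (N'' := pow2_ge_0 (w3 + c)).
  clearbody a b c. split; nra.
Qed.

(** Lorentz profile in 1 - cos, concentrated at angles with 1 - u of size 1 / k. It is the angular
    majorant both for the advanced potential and for the error of the free wave. *)
Definition lor (k u : R) : R := / (1 + k ^ 2 * (1 - u) ^ 2).

Lemma lor_den k u : 0 < 1 + k ^ 2 * (1 - u) ^ 2.
Proof. generalize (pow2_ge_0 (k * (1 - u))). rewrite Rpow_mult_distr. lra. Qed.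

Lemma Ck1_lor j k : Ck1 j (fun _ => True) (lor k).
Proof.
  assert (H := open1_Open _ open1_All). unfold Ck1, lor. apply Ck_inv; ck.
  intros v _. apply Rgt_not_eq, lor_den.
Qed.

Lemma C2_dot k h w1 w2 w3 : Ck1 k (fun _ => True) h ->
  C2 k (fun th ph => h (dot w1 w2 w3 th ph) * sin th).
Proof. intros Hh. unfold C2, dot. ck. apply Ck_app_all; ck. Qed.

(** Archimedes' theorem reduces it to an arctangent divided by k, and arctangents stay below pi /
    2. *)
Lemma lor_integral k w1 w2 w3 : 0 < k -> w1 ^ 2 + w2 ^ 2 + w3 ^ 2 = 1 ->
  DI (fun th ph => lor k (dot w1 w2 w3 th ph) * sin th) <= PI ^ 2 / k.
Proof.
  intros Hk Hw.
  rewrite (hat_box (lor k) (fun u => - (atan (k * (1 - u)) / k))); trivial.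
  - replace (k * (1 - 1)) with 0 by ring. rewrite atan_0.
    replace (k * (1 - -1)) with (2 * k) by ring.
    assert (B := proj2 (atan_bound (2 * k))). assert (P := PI_RGT_0).
    replace (2 * PI * (- (0 / k) - - (atan (2 * k) / k))) with (2 * PI * atan (2 * k) / k)
      by (field; lra).
    unfold Rdiv. apply Rmult_le_compat_r; [left; now apply Rinv_0_lt_compat|]. nra.
  - apply Ck1_lor.
  - intros u. unfold lor. auto_derive; trivial. assert (P := lor_den k u). unfold Rsqr. field. split; nra.
Qed.

Section Decay.
Context (chi : R -> R) (Hchi_s : Smooth1 chi) (Hchi_0 : forall s, s > 1 / 2 -> chi s = 0).
Context (m : fun4) (Hm_s : SmoothOn punct (homext m)).
Context (Cc : R) (HCc : forall s, Rabs (chi s) <= Cc).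
Context (Cm : R) (HCm : forall q x y z, nrm x y z <> 0 -> Rabs (homext m q x y z) <= Cm / jb q ^ 2).

(** Here d is s^2 (r + rho), which is [cn] when sigma points along x and an upper bound for it in
    general. The constant is 2 * 27: the 2 is Peetre's, the 27 is the cube of the 3 in
    [d <= 3 * cn]. *)
Lemma Psi_bound r q0 w1 w2 w3 s th ph :
  w1 ^ 2 + w2 ^ 2 + w3 ^ 2 = 1 -> 1 <= r -> 2 * Rabs q0 <= r -> 0 <= s <= 1 ->
  let d := 1 + s ^ 2 * (r - 1) in
  let k := r * (1 - s ^ 2) / d in
  Rabs (Psi chi m (upd (upd (slice (r - q0) (r * w1) (r * w2) (r * w3) s) 5 th) 6 ph))
    <= 54 * Cm * Cc * (1 + q0 ^ 2) / d ^ 3 * lor k (dot w1 w2 w3 th ph).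
Proof.
  intros Hw Hr Hq Hs d k.
  set (w := upd _ 6 ph).
  assert (HCc0 : 0 <= Cc) by (generalize (HCc 0) (Rabs_pos (chi 0)); lra).
  assert (HCm0 : 0 <= Cm).
  { assert (N : nrm 1 0 0 <> 0) by (apply Rgt_not_eq, nrm_pos; lra).
    assert (A := HCm 0 1 0 0 N). assert (B := Rabs_pos (homext m 0 1 0 0)).
    assert (J := jb_sq 0). replace (jb 0 ^ 2) with 1 in A by lra. lra. }
  assert (He : 0 <= s ^ 2 <= 1) by nra.
  assert (Hd : 1 <= d) by (unfold d; nra).
  assert (Hk : 0 <= k).
  { unfold k, Rdiv. apply Rmult_le_pos; [nra|]. left; apply Rinv_0_lt_compat; lra. }
  assert (HD := dot_bound w1 w2 w3 th ph Hw).
  set (u := dot w1 w2 w3 th ph) in *.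
  assert (RHS0 : 0 <= 54 * Cm * Cc * (1 + q0 ^ 2) / d ^ 3 * lor k u).
  { unfold lor, Rdiv. repeat apply Rmult_le_pos; try nra; left; apply Rinv_0_lt_compat.
    - apply pow_lt; lra.
    - apply lor_den. }
  assert (N0 := nrm_ge0 (cv 0 w) (cv 1 w) (cv 2 w)). fold (cn w) in N0.
  assert (S := cn_sq w). assert (Q := cq_scaled w).
  assert (W4 : w 4%nat = s) by reflexivity.
  assert (W0 : w 0%nat = r - q0) by reflexivity.
  assert (U : w 1%nat * sg 0 w + w 2%nat * sg 1 w + w 3%nat * sg 2 w = r * u).
  { unfold u, dot, sg, sv, env3. change (w 1%nat) with (r * w1). change (w 2%nat) with (r * w2).
    change (w 3%nat) with (r * w3). change (w 5%nat) with th. change (w 6%nat) with ph. ring. }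
  assert (X : w 1%nat ^ 2 + w 2%nat ^ 2 + w 3%nat ^ 2 = r ^ 2).
  { transitivity (r ^ 2 * (w1 ^ 2 + w2 ^ 2 + w3 ^ 2)); [unfold w; cbn; ring | rewrite Hw; ring]. }
  assert (Sd : cn w * cn w = d ^ 2 - 2 * s ^ 2 * (1 - s ^ 2) * r * (1 - u)).
  { rewrite S, X, U, W4. unfold d; ring. }
  assert (Hpos : 0 <= 2 * s ^ 2 * (1 - s ^ 2) * r * (1 - u)).
  { repeat apply Rmult_le_pos; lra. }
  assert (Hcd : cn w <= d) by nra.
  (* The phase moves away from [q0] linearly in [1 - cos], cos being that of the angle to [x]. *)
  assert (Hq' : (q0 - cq w) * (cn w + d) = 2 * r * (1 - s ^ 2) * (1 - u)).
  { unfold cq. rewrite X, U, W0, W4.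
    apply Rmult_eq_reg_r with (cn w + 1); [|lra].
    replace ((q0 - ((s ^ 2 * r ^ 2 + 2 * (1 - s ^ 2) * (r * u) - 2 + s ^ 2) / (cn w + 1)
       - (r - q0) + 1)) * (cn w + d) * (cn w + 1))
     with (((r - 1) * (cn w + 1) - (s ^ 2 * r ^ 2 + 2 * (1 - s ^ 2) * (r * u) - 2 + s ^ 2))
            * (cn w + d)) by (field; lra).
    assert (E : (r - 1) * (cn w * cn w) = (r - 1) * (d ^ 2 - 2 * s ^ 2 * (1 - s ^ 2) * r * (1 - u)))
      by now rewrite Sd.
    unfold d in *. nra. }
  unfold Psi, psi. fold (cn w). rewrite W4.
  destruct (Req_dec (cn w) 0) as [Z|NZ].
  { rewrite Z. unfold Rdiv at 1. rewrite pow_i, Rinv_0, Rmult_0_r, Rmult_0_l, Rabs_R0 by lia. trivial. }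
  assert (P : 0 < cn w) by lra.
  assert (J1 := jb_ge1 (cq w)).
  (* Where the cutoff vanishes there is nothing to bound; elsewhere s^2 |cq| <= cn / 2, which keeps
     cn comparable with d. *)
  destruct (Rlt_dec (1 / 2) (jb (cq w) * s ^ 2 / cn w)) as [A|A].
  { rewrite Hchi_0, Rmult_0_r, Rabs_R0 by trivial. trivial. }
  assert (A' : jb (cq w) * s ^ 2 <= cn w / 2).
  { apply Rnot_lt_le in A. apply Rmult_le_compat_r with (r := cn w) in A; [|lra].
    unfold Rdiv in A at 1. rewrite Rmult_assoc, Rinv_l in A by trivial. lra. }
  assert (Jq : Rabs (cq w) <= jb (cq w)).
  { rewrite <- sqrt_Rsqr_abs. apply sqrt_le_1_alt. unfold Rsqr; nra. }
  (* [cq_scaled] reads cn = d + s^2 (cq - q0). Its terms obey s^2 |cq| <= cn / 2 and s^2 q0 <= s^2 r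
     / 2 <= d / 2. *)
  assert (L : d <= 3 * cn w).
  { rewrite W4, W0 in Q.
    assert (- (jb (cq w) * s ^ 2) <= s ^ 2 * cq w).
    { assert (B := Rle_abs (- cq w)). rewrite Rabs_Ropp in B. nra. }
    assert (s ^ 2 * q0 <= s ^ 2 * r / 2).
    { assert (B := Rle_abs q0). nra. }
    unfold d in *. nra. }
  (* By [Hq'] and [cn w <= d], the difference q0 - cq is at least k (1 - u). *)
  assert (M1 : 1 + k ^ 2 * (1 - u) ^ 2 <= 2 * (1 + q0 ^ 2) * (1 + cq w ^ 2)).
  { eapply Rle_trans; [|apply peetre2]. apply Rplus_le_compat_l.
    rewrite <- Rpow_mult_distr. apply pow_incr; split; [apply Rmult_le_pos; lra|].
    unfold k. apply Rmult_le_reg_r with (d * (cn w + d)); [nra|].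
    replace (r * (1 - s ^ 2) / d * (1 - u) * (d * (cn w + d)))
      with (r * (1 - s ^ 2) * (1 - u) * (cn w + d)) by (field; lra).
    replace ((q0 - cq w) * (d * (cn w + d))) with ((q0 - cq w) * (cn w + d) * d) by ring.
    rewrite Hq'. assert (0 <= r * (1 - s ^ 2) * (1 - u)) by (repeat apply Rmult_le_pos; lra). nra. }
  rewrite Rabs_mult. unfold Rdiv at 1. rewrite Rabs_mult, Rabs_inv, (Rabs_pos_eq (cn w ^ 3)) by (apply pow_le; lra).
  assert (B1 : Rabs (homext m (cq w) (cv 0 w) (cv 1 w) (cv 2 w))
     <= 2 * Cm * (1 + q0 ^ 2) * lor k u).
  { eapply Rle_trans; [now apply HCm|].
    replace (jb (cq w) ^ 2) with (1 + cq w ^ 2) by (rewrite <- jb_sq; ring).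
    unfold lor. assert (0 < 1 + k ^ 2 * (1 - u) ^ 2) by apply lor_den.
    assert (0 < 1 + cq w ^ 2) by nra.
    apply Rmult_le_reg_r with ((1 + k ^ 2 * (1 - u) ^ 2) * (1 + cq w ^ 2)); [nra|].
    replace (Cm / (1 + cq w ^ 2) * ((1 + k ^ 2 * (1 - u) ^ 2) * (1 + cq w ^ 2)))
      with (Cm * (1 + k ^ 2 * (1 - u) ^ 2)) by (field; lra).
    replace (2 * Cm * (1 + q0 ^ 2) * / (1 + k ^ 2 * (1 - u) ^ 2) *
       ((1 + k ^ 2 * (1 - u) ^ 2) * (1 + cq w ^ 2))) with (Cm * (2 * (1 + q0 ^ 2) * (1 + cq w ^ 2)))
      by (field; lra).
    now apply Rmult_le_compat_l. }
  assert (B2 : / cn w ^ 3 <= 27 / d ^ 3).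
  { replace (27 / d ^ 3) with (/ (d / 3) ^ 3) by (field; lra).
    apply Rinv_le_contravar; [apply pow_lt; lra|]. apply pow_incr; lra. }
  replace (54 * Cm * Cc * (1 + q0 ^ 2) / d ^ 3 * lor k u)
    with (2 * Cm * (1 + q0 ^ 2) * lor k u * (27 / d ^ 3) * Cc) by (field; lra).
  assert (0 < / cn w ^ 3) by (apply Rinv_0_lt_compat, pow_lt; lra).
  apply Rmult_le_compat; trivial; try apply Rabs_pos.
  - apply Rmult_le_pos; [apply Rabs_pos | lra].
  - apply Rmult_le_compat; trivial; [apply Rabs_pos | lra].
Qed.

(** The angular integral contributes pi^2 / k = pi^2 d / (r (1 - s^2)), whose 1 - s^2 cancels
    against that of [kco]. What remains, 2 s / d^2, has the primitive s^2 / d and integral 1 / r. *)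
Lemma advanced_decay r q0 w1 w2 w3 :
  w1 ^ 2 + w2 ^ 2 + w3 ^ 2 = 1 -> 1 <= r -> 2 * Rabs q0 <= r ->
  Rabs (r * advanced chi m (r - q0) (r * w1) (r * w2) (r * w3))
    <= 54 * Cm * Cc * (1 + q0 ^ 2) * PI / 4 / r.
Proof.
  intros Hw Hr Hq.
  set (B := 54 * Cm * Cc * (1 + q0 ^ 2)).
  set (J := fun s => SI 5 (kadv chi m) (slice (r - q0) (r * w1) (r * w2) (r * w3) s)).
  assert (CK : Cinf 7 All (kadv chi m)) by now apply Cinf_kadv.
  assert (CJ : forall s, continuous J s).
  { intros s. apply continuous_upd with 5%nat. apply (Ck_cont 5 0 All); [|easy].
    apply Ck_SI, CK. }
  (* The sign is read off from the bound itself at s = 0, where d = 1. *)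
  assert (HB : 0 <= B).
  { assert (P := Psi_bound r q0 w1 w2 w3 0 0 0 Hw Hr Hq ltac:(lra)). cbv zeta in P. fold B in P.
    eapply Rle_trans in P; [|apply Rabs_pos].
    assert (0 < lor (r * (1 - 0 ^ 2) / (1 + 0 ^ 2 * (r - 1))) (dot w1 w2 w3 0 0)).
    { apply Rinv_0_lt_compat, lor_den. }
    replace ((1 + 0 ^ 2 * (r - 1)) ^ 3) with 1 in P by ring. rewrite Rdiv_1_r in P.
    destruct (Rle_dec 0 B); trivial. nra. }
  assert (BJ : forall s, 0 <= s <= 1 ->
     Rabs (J s) <= B * PI ^ 2 / r * (2 * s / (1 + s ^ 2 * (r - 1)) ^ 2)).
  { intros s Hs. unfold J. rewrite SI_DI.
    assert (Hd : 1 <= 1 + s ^ 2 * (r - 1)) by nra.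
    set (d := 1 + s ^ 2 * (r - 1)) in *.
    set (k := r * (1 - s ^ 2) / d).
    set (c := 2 * s * (1 - s ^ 2) * (B / d ^ 3)).
    assert (HBd : 0 <= B / d ^ 3).
    { apply Rmult_le_pos; trivial. left; apply Rinv_0_lt_compat, pow_lt; lra. }
    assert (Hs' : 0 <= 2 * s * (1 - s ^ 2)) by (repeat apply Rmult_le_pos; nra).
    assert (Hc : 0 <= c) by (unfold c; now apply Rmult_le_pos).
    assert (CL : C2 0 (fun th ph => lor k (dot w1 w2 w3 th ph) * sin th)) by apply C2_dot, Ck1_lor.
    apply Rle_trans with (DI (fun th ph => c * (lor k (dot w1 w2 w3 th ph) * sin th))).
    - apply DI_abs.
      + apply C2_slice, CK.
      + unfold C2; ck.
      + intros th ph Hth. unfold kadv, kco. rewrite Rabs_mult.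
        assert (St : 0 <= sin th) by (apply sin_ge_0; lra).
        assert (PB := Psi_bound r q0 w1 w2 w3 s th ph Hw Hr Hq Hs). cbv zeta in PB.
        fold B d in PB. fold k in PB.
        set (w := upd _ 6 ph) in *.
        change (w 4%nat) with s. change (w 5%nat) with th.
        assert (H0 : 0 <= 2 * s * (1 - s ^ 2) * sin th) by (repeat apply Rmult_le_pos; nra).
        rewrite (Rabs_pos_eq _ H0).
        replace (c * (lor k (dot w1 w2 w3 th ph) * sin th))
          with (2 * s * (1 - s ^ 2) * sin th * (B / d ^ 3 * lor k (dot w1 w2 w3 th ph)))
          by (unfold c; ring).
        now apply Rmult_le_compat_l.
    - rewrite DI_scal by trivial.
      assert (R0 : 0 <= B * PI ^ 2 / r * (2 * s / d ^ 2)).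
      { assert (0 < / r) by (apply Rinv_0_lt_compat; lra).
        assert (0 < / d ^ 2) by (apply Rinv_0_lt_compat, pow_lt; lra).
        apply Rmult_le_pos; [apply Rmult_le_pos; [apply Rmult_le_pos|] |apply Rmult_le_pos];
          trivial; try apply pow2_ge_0; lra. }
      (* At s = 1 the parameter k is 0, out of reach of [lor_integral], but the prefactor c
         vanishes. *)
      destruct (Req_dec s 1) as [S1|Hs1].
      + replace c with 0 by (unfold c; rewrite S1; ring). rewrite Rmult_0_l. trivial.
      + assert (Hs2 : 0 < 1 - s ^ 2) by nra.
        assert (Hk : 0 < k).
        { unfold k. apply Rdiv_lt_0_compat; [nra | lra]. }
        eapply Rle_trans; [apply Rmult_le_compat_l; [trivial | now apply lor_integral]|].
        right. unfold c, k. field. repeat split; try lra. }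
  assert (HI : is_RInt (fun s => B * PI ^ 2 / r * (2 * s / (1 + s ^ 2 * (r - 1)) ^ 2)) 0 1
     (B * PI ^ 2 / r * (1 / r))).
  { apply (@is_RInt_scal R_NormedModule (fun s => 2 * s / (1 + s ^ 2 * (r - 1)) ^ 2)).
    replace (1 / r) with (minus (1 ^ 2 / (1 + 1 ^ 2 * (r - 1))) (0 ^ 2 / (1 + 0 ^ 2 * (r - 1)))).
    2:{ unfold minus, plus, opp; simpl. field; lra. }
    apply (is_RInt_derive (fun s => s ^ 2 / (1 + s ^ 2 * (r - 1)))).
    - intros s _. assert (1 <= 1 + s ^ 2 * (r - 1)) by nra.
      auto_derive; [lra | field; lra].
    - intros s _. assert (1 <= 1 + s ^ 2 * (r - 1)) by nra.
      apply (@ex_derive_continuous R_AbsRing R_NormedModule).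
      auto_derive. simpl. rewrite !Rmult_1_r in *. nra. }
  assert (HJ : is_RInt J 0 1 (RInt J 0 1)).
  { apply (@RInt_correct R_CompleteNormedModule), (@ex_RInt_continuous R_CompleteNormedModule); auto. }
  assert (N := norm_RInt_le J _ 0 1 _ _ Rle_0_1 BJ HJ HI).
  change (Rabs (RInt J 0 1) <= B * PI ^ 2 / r * (1 / r)) in N.
  unfold advanced, of_env.
  change (INT 4 0 1 (SI 5 (kadv chi m)) (env4 (r - q0) (r * w1) (r * w2) (r * w3)))
    with (RInt J 0 1).
  assert (PP := PI_RGT_0).
  rewrite !Rabs_mult, (Rabs_pos_eq r), (Rabs_pos_eq (/ (4 * PI)))
    by (lra || (left; apply Rinv_0_lt_compat; lra)).
  replace (B * PI / 4 / r) with (r * (/ (4 * PI) * (B * PI ^ 2 / r * (1 / r)))) by (field; lra).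
  apply Rmult_le_compat_l; [lra|]. apply Rmult_le_compat_l; trivial.
  left; apply Rinv_0_lt_compat; lra.
Qed.
End Decay.

(** * Superpositions of plane waves *)

Lemma homext_scal f q c x y z : 0 < c -> homext f q (c * x) (c * y) (c * z) = homext f q x y z.
Proof.
  intros Hc. unfold homext. rewrite nrm_scal by lra.
  assert (E : forall a, c * a / (c * nrm x y z) = a / nrm x y z).
  { intros a. destruct (Req_dec (nrm x y z) 0) as [Z|NZ].
    - rewrite Z, Rmult_0_r. unfold Rdiv. rewrite Rinv_0; ring.
    - field; split; lra. }
  now rewrite !E.
Qed.

Lemma homext_unit f q x y z : x ^ 2 + y ^ 2 + z ^ 2 = 1 -> homext f q x y z = f q x y z.
Proof.
  intros H. unfold homext. assert (E : nrm x y z = 1) by (unfold nrm; rewrite H; apply sqrt_1).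
  now rewrite E, !Rdiv_1_r.
Qed.

Definition Punct (v : env) : Prop := punct (v 0%nat) (v 1%nat) (v 2%nat) (v 3%nat).

(** * Lipschitz dependence of the amplitude on the direction *)

Section Lipschitz.
Context (f : fun4) (Hs : SmoothOn punct (homext f)) (Hb : SymbolBound f 2).

Definition dq : env -> R := PD 0 (lift (homext f)).

Lemma Cinf_dq : Cinf 4 Punct dq.
Proof. apply Cinf_D; [now apply SmoothOn_Cinf | lia]. Qed.

Lemma dq_scal p c x y z : 0 < c -> dq (env4 p (c * x) (c * y) (c * z)) = dq (env4 p x y z).
Proof.
  intros Hc. unfold dq, PD. apply Derive_ext; intros s.
  destruct (upd_env4 p (c * x) (c * y) (c * z) s) as [-> _].
  destruct (upd_env4 p x y z s) as [-> _]. now apply homext_scal.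
Qed.

(** Spatial derivatives of a function homogeneous of degree 0 have degree -1. This carries the
    symbol bounds, given on the unit sphere, to the points of a chord. *)
Lemma PD_dq_scal i p c x y z : (0 < i < 4)%nat -> 0 < c -> x ^ 2 + y ^ 2 + z ^ 2 <> 0 ->
  PD i dq (env4 p x y z) = c * PD i dq (env4 p (c * x) (c * y) (c * z)).
Proof.
  intros Hi Hc Hx.
  assert (P : Punct (env4 p (c * x) (c * y) (c * z))).
  { unfold Punct, punct; simpl. intros E. apply Hx.
    assert (Q : c ^ 2 * (x ^ 2 + y ^ 2 + z ^ 2) = 0) by (rewrite <- E; ring).
    apply Rmult_integral in Q. destruct Q as [Q|Q]; [|exact Q]. nra. }
  assert (A := Ck_is_derive 4 0 Punct dq i _ (Cinf_dq 1%nat) ltac:(lia) P).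
  apply is_derive_unique.
  destruct i as [|[|[|[|i]]]]; try lia.
  - apply (is_derive_ext (fun s => dq (upd (env4 p (c * x) (c * y) (c * z)) 1 (c * s)))).
    + intros s. destruct (upd_env4 p (c * x) (c * y) (c * z) (c * s)) as [_ [-> _]].
      destruct (upd_env4 p x y z s) as [_ [-> _]]. now apply dq_scal.
    + apply (is_derive_comp (fun s => dq (upd (env4 p (c * x) (c * y) (c * z)) 1 s))
        (fun s => c * s)); [exact A | auto_derive; trivial; ring].
  - apply (is_derive_ext (fun s => dq (upd (env4 p (c * x) (c * y) (c * z)) 2 (c * s)))).
    + intros s. destruct (upd_env4 p (c * x) (c * y) (c * z) (c * s)) as [_ [_ [-> _]]].
      destruct (upd_env4 p x y z s) as [_ [_ [-> _]]]. now apply dq_scal.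
    + apply (is_derive_comp (fun s => dq (upd (env4 p (c * x) (c * y) (c * z)) 2 s))
        (fun s => c * s)); [exact A | auto_derive; trivial; ring].
  - apply (is_derive_ext (fun s => dq (upd (env4 p (c * x) (c * y) (c * z)) 3 (c * s)))).
    + intros s. destruct (upd_env4 p (c * x) (c * y) (c * z) (c * s)) as [_ [_ [_ ->]]].
      destruct (upd_env4 p x y z s) as [_ [_ [_ ->]]]. now apply dq_scal.
    + apply (is_derive_comp (fun s => dq (upd (env4 p (c * x) (c * y) (c * z)) 3 s))
        (fun s => c * s)); [exact A | auto_derive; trivial; ring].
Qed.

(** Dividing out the weight of the symbol operator [<q> d_q] turns the square into a cube. *)
Lemma jb_weighted_bound C p X : Rabs (jb p * X) <= C * Rpower (jb p) (- 2) ->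
  Rabs X <= Rabs C / jb p ^ 3.
Proof.
  intros H. assert (J := jb_ge1 p). apply (symbol_le C p 2 _ 2) in H; [|simpl; lra].
  rewrite Rabs_mult, (Rabs_pos_eq (jb p)) in H by lra.
  apply Rmult_le_reg_l with (jb p); [lra|].
  replace (jb p * (Rabs C / jb p ^ 3)) with (Rabs C / jb p ^ 2) by (field; lra). exact H.
Qed.

Lemma dq_bound : exists C, 0 <= C /\ forall p x y z, x ^ 2 + y ^ 2 + z ^ 2 = 1 ->
  Rabs (dq (env4 p x y z)) <= C / jb p ^ 3.
Proof.
  destruct (Hb (I0 :: nil)) as [C HC]. exists (Rabs C); split; [apply Rabs_pos|].
  intros p x y z H. apply jb_weighted_bound. exact (HC p x y z H).
Qed.

Lemma PD_dq_bound i : (0 < i < 4)%nat -> exists C, 0 <= C /\ forall p x y z,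
  x ^ 2 + y ^ 2 + z ^ 2 = 1 -> Rabs (PD i dq (env4 p x y z)) <= C / jb p ^ 3.
Proof.
  intros Hi.
  assert (E : exists I, i = idx I /\ I <> I0).
  { destruct i as [|[|[|[|i]]]]; [lia | exists I1 | exists I2 | exists I3 | lia]; easy. }
  destruct E as [j [-> Hj]].
  destruct (Hb (j :: I0 :: nil)) as [C HC]. exists (Rabs C); split; [apply Rabs_pos|].
  intros p x y z H. apply jb_weighted_bound. specialize (HC p x y z H).
  replace (sops (j :: I0 :: nil) (homext f) p x y z)
    with (jb p * PD (idx j) dq (env4 p x y z)) in HC; trivial.
  (* The angular derivative is the outer one, so the weight [jb p] is a constant for it. *)
  unfold PD at 1. rewrite <- Derive_scal.
  destruct j; [easy|..]; simpl; apply Derive_ext; intros s; unfold dq;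
    destruct (upd_env4 p x y z s) as [_ [E1 [E2 E3]]]; rewrite ?E1, ?E2, ?E3; reflexivity.
Qed.

Lemma Rabs_le_nrm1 a b c : Rabs a <= nrm a b c /\ Rabs b <= nrm a b c /\ Rabs c <= nrm a b c.
Proof.
  unfold nrm. rewrite <- !(sqrt_Rsqr_abs). unfold Rsqr.
  repeat split; apply sqrt_le_1_alt; nra.
Qed.

(** Mean value theorem along the chord between the two directions. If they are closer than 1, the
    chord stays outside the ball of radius 1/2, so homogeneity at most doubles the derivative
    bounds; if not, the supremum bound suffices. *)
Lemma dq_lipschitz : exists L, 0 <= L /\ forall p s1 s2 s3 w1 w2 w3,
  s1 ^ 2 + s2 ^ 2 + s3 ^ 2 = 1 -> w1 ^ 2 + w2 ^ 2 + w3 ^ 2 = 1 ->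
  Rabs (dq (env4 p s1 s2 s3) - dq (env4 p w1 w2 w3))
    <= L * nrm (s1 - w1) (s2 - w2) (s3 - w3) / jb p ^ 3.
Proof.
  destruct dq_bound as [C0 [P0 B0]].
  destruct (PD_dq_bound 1 ltac:(lia)) as [C1 [P1 B1]].
  destruct (PD_dq_bound 2 ltac:(lia)) as [C2 [P2 B2]].
  destruct (PD_dq_bound 3 ltac:(lia)) as [C3 [P3 B3]].
  exists (2 * C0 + 2 * (C1 + C2 + C3)); split; [lra|].
  intros p s1 s2 s3 w1 w2 w3 Hs1 Hw.
  set (n := nrm (s1 - w1) (s2 - w2) (s3 - w3)).
  assert (Hn0 : 0 <= n) by apply nrm_ge0.
  assert (Hn : n * n = 2 - 2 * (s1 * w1 + s2 * w2 + s3 * w3)).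
  { unfold n. rewrite nrm_sq.
    transitivity ((s1 ^ 2 + s2 ^ 2 + s3 ^ 2) + (w1 ^ 2 + w2 ^ 2 + w3 ^ 2)
       - 2 * (s1 * w1 + s2 * w2 + s3 * w3)); [ring | rewrite Hs1, Hw; ring]. }
  assert (J : 0 < / jb p ^ 3).
  { apply Rinv_0_lt_compat, pow_lt. generalize (jb_ge1 p); lra. }
  unfold Rdiv in *. set (j := / jb p ^ 3) in *.
  destruct (Rlt_dec n 1) as [Hn1|Hn1].
  2:{ eapply Rle_trans; [apply Rabs_triang|]. rewrite Rabs_Ropp.
      assert (A := B0 p s1 s2 s3 Hs1). assert (A' := B0 p w1 w2 w3 Hw).
      fold j in A, A'.
      assert (0 <= C0 * j) by nra.
      assert (0 <= (C1 + C2 + C3) * j) by nra.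
      replace ((2 * C0 + 2 * (C1 + C2 + C3)) * n * j)
        with (2 * (C0 * j + (C1 + C2 + C3) * j) * n) by ring.
      assert (2 * (C0 * j + (C1 + C2 + C3) * j) * 1 <= 2 * (C0 * j + (C1 + C2 + C3) * j) * n)
        by (apply Rmult_le_compat_l; lra).
      lra. }
  set (Y := fun t a b => b + t * (a - b)).
  assert (HY : forall t, 0 <= t <= 1 -> 1 / 4 <= Y t s1 w1 ^ 2 + Y t s2 w2 ^ 2 + Y t s3 w3 ^ 2).
  { intros t Ht. unfold Y.
    replace ((w1 + t * (s1 - w1)) ^ 2 + (w2 + t * (s2 - w2)) ^ 2 + (w3 + t * (s3 - w3)) ^ 2)
      with ((1 - t) ^ 2 * (w1 ^ 2 + w2 ^ 2 + w3 ^ 2) + t ^ 2 * (s1 ^ 2 + s2 ^ 2 + s3 ^ 2)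
        + 2 * t * (1 - t) * (s1 * w1 + s2 * w2 + s3 * w3)) by ring.
    rewrite Hs1, Hw.
    replace (s1 * w1 + s2 * w2 + s3 * w3) with (1 - n * n / 2) by lra.
    assert (0 <= t * (1 - t)) by nra. assert (T := pow2_ge_0 (t - 1 / 2)).
    assert (t * (1 - t) * (n * n) <= 1 / 4 * 1) by (apply Rmult_le_compat; nra).
    lra. }
  assert (BD : forall i C t, (0 < i < 4)%nat -> 0 <= C -> 0 <= t <= 1 ->
    (forall p x y z, x ^ 2 + y ^ 2 + z ^ 2 = 1 -> Rabs (PD i dq (env4 p x y z)) <= C * / jb p ^ 3) ->
    Rabs (PD i dq (env4 p (Y t s1 w1) (Y t s2 w2) (Y t s3 w3))) <= 2 * C * j).
  { intros i C t Hi HC Ht B. specialize (HY t Ht).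
    set (y1 := Y t s1 w1) in *. set (y2 := Y t s2 w2) in *. set (y3 := Y t s3 w3) in *.
    assert (N : 0 < nrm y1 y2 y3) by (apply nrm_pos; lra).
    assert (N2 := nrm_sq y1 y2 y3).
    assert (N3 : 1 / 2 <= nrm y1 y2 y3) by nra.
    rewrite (PD_dq_scal i p (/ nrm y1 y2 y3)) by (trivial; (now apply Rinv_0_lt_compat) || lra).
    rewrite Rabs_mult, Rabs_pos_eq by (left; now apply Rinv_0_lt_compat).
    assert (I2 : 0 < / nrm y1 y2 y3 <= 2).
    { split; [now apply Rinv_0_lt_compat|]. replace 2 with (/ (1 / 2)) by field.
      apply Rinv_le_contravar; lra. }
    replace (2 * C * j) with (2 * (C * j)) by ring.
    apply Rmult_le_compat; try lra; [apply Rabs_pos|]. apply B.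
    assert (U := normalized_unit y1 y2 y3 ltac:(lra)). unfold Rdiv in U.
    rewrite !(Rmult_comm (/ nrm y1 y2 y3)). exact U. }
  set (phi := fun t => dq (env4 p (Y t s1 w1) (Y t s2 w2) (Y t s3 w3))).
  set (dphi := fun t => PD 1 dq (env4 p (Y t s1 w1) (Y t s2 w2) (Y t s3 w3)) * (s1 - w1)
     + PD 2 dq (env4 p (Y t s1 w1) (Y t s2 w2) (Y t s3 w3)) * (s2 - w2)
     + PD 3 dq (env4 p (Y t s1 w1) (Y t s2 w2) (Y t s3 w3)) * (s3 - w3)).
  assert (DY : forall t a b, is_derive (fun t => Y t a b) t (a - b)).
  { intros; unfold Y; auto_derive; trivial; ring. }
  assert (Dphi : forall t, 0 <= t <= 1 -> is_derive phi t (dphi t)).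
  { intros t Ht. eapply is_derive_eq.
    - apply (chain4 Punct dq (fun _ => p) (fun t => Y t s1 w1) (fun t => Y t s2 w2)
        (fun t => Y t s3 w3) 0 (s1 - w1) (s2 - w2) (s3 - w3)); auto.
      + apply Open_punct.
      + apply Cinf_dq.
      + unfold Punct, punct; simpl. specialize (HY t Ht). lra.
      + apply @is_derive_const.
    - unfold dphi; ring. }
  destruct (MVT_gen phi 0 1 dphi) as [c [Hc E]].
  { intros t Ht. rewrite Rmin_left, Rmax_right in Ht by lra. apply Dphi; lra. }
  { intros t Ht. rewrite Rmin_left, Rmax_right in Ht by lra. apply continuity_pt_filterlim.
    apply (@ex_derive_continuous R_AbsRing R_NormedModule). exists (dphi t). apply Dphi; lra. }
  rewrite Rmin_left, Rmax_right in Hc by lra.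
  replace (dq (env4 p s1 s2 s3)) with (phi 1) by (unfold phi, Y; do 2 f_equal; ring).
  replace (dq (env4 p w1 w2 w3)) with (phi 0) by (unfold phi, Y; do 2 f_equal; ring).
  rewrite E, Rminus_0_r, Rmult_1_r. unfold dphi.
  destruct (Rabs_le_nrm1 (s1 - w1) (s2 - w2) (s3 - w3)) as [Q1 [Q2 Q3]]. fold n in Q1, Q2, Q3.
  assert (E1 := BD 1%nat C1 c ltac:(lia) P1 Hc B1).
  assert (E2 := BD 2%nat C2 c ltac:(lia) P2 Hc B2).
  assert (E3 := BD 3%nat C3 c ltac:(lia) P3 Hc B3).
  assert (F1 := Rmult_le_compat _ _ _ _ (Rabs_pos _) (Rabs_pos _) E1 Q1).
  assert (F2 := Rmult_le_compat _ _ _ _ (Rabs_pos _) (Rabs_pos _) E2 Q2).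
  assert (F3 := Rmult_le_compat _ _ _ _ (Rabs_pos _) (Rabs_pos _) E3 Q3).
  rewrite <- Rabs_mult in F1, F2, F3.
  eapply Rle_trans; [apply Rabs_triang|].
  eapply Rle_trans; [apply Rplus_le_compat_r, Rabs_triang|].
  assert (0 <= C0 * n * j) by (repeat apply Rmult_le_pos; lra).
  lra.
Qed.
End Lipschitz.

(** Coordinates 0 to 3 are (t, x); 4 and 5 are the angles of the direction sigma of a plane wave. *)
Definition sw (i : nat) (w : env) : R := sv (w 4%nat) (w 5%nat) i.
Definition phase (w : env) : R :=
  w 1%nat * sw 0 w + w 2%nat * sw 1 w + w 3%nat * sw 2 w - w 0%nat.
Definition plane (h : env -> R) (w : env) : R := h (env4 (phase w) (sw 0 w) (sw 1 w) (sw 2 w)).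
Definition dphase (i : nat) (w : env) : R :=
  match i with O => -1 | S j => sw j w end.

Lemma sw_punct w p : Punct (env4 p (sw 0 w) (sw 1 w) (sw 2 w)).
Proof.
  unfold Punct, punct, sw, sv, env3; simpl. assert (E := sphere_sq (w 4%nat) (w 5%nat)).
  simpl in E. lra.
Qed.

Lemma Cinf_sw i : (i < 3)%nat -> Cinf 6 All (sw i).
Proof. intros Hi k. unfold sw, sv, env3. destruct i as [|[|[|i]]]; try lia; ck. Qed.

Lemma Cinf_plane h : Cinf 4 Punct h -> Cinf 6 All (plane h).
Proof.
  intros Hh k. unfold plane.
  assert (S := fun i Hi => Cinf_sw i Hi k).
  apply Ck_env4 with Punct; try (apply S; lia).
  - apply Open_All.
  - apply Open_punct.
  - apply Hh.
  - intros; apply sw_punct.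
  - unfold phase. ck; apply S; lia.
Qed.

Lemma PD_plane h i w : Cinf 4 Punct h -> (i < 4)%nat ->
  PD i (plane h) w = dphase i w * plane (PD 0 h) w.
Proof.
  intros Hh Hi. apply is_derive_unique.
  assert (Sw : forall u j, sw j (upd w i u) = sw j w).
  { intros; unfold sw. now rewrite !upd_neq by lia. }
  apply (is_derive_ext (fun u => h (env4 (phase (upd w i u)) (sw 0 w) (sw 1 w) (sw 2 w)))).
  { intros u. unfold plane. now rewrite !Sw. }
  assert (DPh : is_derive (fun u => phase (upd w i u)) (w i) (dphase i w)).
  { apply (is_derive_ext (fun u => upd w i u 1%nat * sw 0 w + upd w i u 2%nat * sw 1 w
      + upd w i u 3%nat * sw 2 w - upd w i u 0%nat)).
    { intros u; unfold phase; now rewrite !Sw. }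
    unfold upd, dphase. destruct i as [|[|[|[|i]]]]; try lia; simpl; auto_derive; trivial; ring. }
  eapply is_derive_eq.
  - apply (chain4 Punct h (fun u => phase (upd w i u)) (fun _ => sw 0 w) (fun _ => sw 1 w)
      (fun _ => sw 2 w) (dphase i w) 0 0 0).
    + apply Open_punct.
    + apply Hh.
    + apply sw_punct.
    + exact DPh.
    + apply @is_derive_const.
    + apply @is_derive_const.
    + apply @is_derive_const.
  - unfold plane. rewrite upd_id. ring.
Qed.

Definition free_wave (h : env -> R) : fun4 :=
  of_env (/ (2 * PI)) (SI 4 (fun w => sin (w 4%nat) * plane h w)).

Lemma free_wave_smooth h : Cinf 4 Punct h -> Cinf 4 All (lift (free_wave h)).
Proof.
  intros Hh. apply Cinf_of_env, Cinf_SI. intros k. ck. now apply Cinf_plane.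
Qed.

Lemma box_free_wave h t x y z : Cinf 4 Punct h -> box (free_wave h) t x y z = 0.
Proof.
  intros Hh. unfold free_wave. rewrite box_of_env.
  set (K := fun w : env => sin (w 4%nat) * plane h w).
  assert (H1 : Cinf 4 Punct (PD 0 h)) by (apply Cinf_D; trivial; lia).
  assert (H2 : Cinf 4 Punct (PD 0 (PD 0 h))) by (apply Cinf_D; trivial; lia).
  assert (CK : Cinf 6 All K) by (intros k; unfold K; ck; now apply Cinf_plane).
  assert (Sn : forall i w u, (i < 4)%nat -> sin (upd w i u 4%nat) = sin (w 4%nat)).
  { intros; now rewrite upd_neq by lia. }
  assert (Dn : forall i j w u, (i < 4)%nat -> dphase j (upd w i u) = dphase j w).
  { intros i [|j] w u Hi; trivial. simpl. unfold sw. now rewrite !upd_neq by lia. }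
  assert (HK : forall i, (i < 4)%nat -> PD i (PD i (SI 4 K))
     = SI 4 (fun w => dphase i w ^ 2 * (sin (w 4%nat) * plane (PD 0 (PD 0 h)) w))).
  { intros i Hi.
    rewrite PD_SI by (apply CK || lia).
    rewrite PD_SI by (apply (Cinf_D 6 All K i CK ltac:(lia)) || lia).
    f_equal. apply functional_extensionality; intros w.
    rewrite (PD_coef (PD i K) (plane (PD 0 h)) (fun w => sin (w 4%nat) * dphase i w)).
    - rewrite PD_plane by trivial. ring.
    - intros; now rewrite Sn, Dn.
    - intros w'. rewrite (PD_coef K (plane h) (fun w => sin (w 4%nat))); auto.
      rewrite PD_plane by trivial. ring. }
  rewrite !HK by lia.
  assert (CP : forall i, (i < 4)%nat ->
    Ck 6 0 All (fun w => dphase i w ^ 2 * (sin (w 4%nat) * plane (PD 0 (PD 0 h)) w))).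
  { intros i Hi. ck.
    - destruct i; [apply (Ck_const 6 0 All (-1)), Open_All | apply Cinf_sw; lia].
    - now apply Cinf_plane. }
  assert (P0 := CP 0%nat ltac:(lia)). assert (P1 := CP 1%nat ltac:(lia)).
  assert (P2 := CP 2%nat ltac:(lia)). assert (P3 := CP 3%nat ltac:(lia)).
  match goal with |- _ * (- ?a + ?b + ?c + ?d) = 0 =>
    replace (- a + b + c + d) with (-1 * a + b + c + d) by ring end.
  rewrite <- SI_scal by ck. rewrite <- !SI_plus by ck.
  rewrite SI_DI, (DI_ext _ (fun _ _ => 0 * 0)).
  - rewrite (DI_scal 0 (fun _ _ => 0)) by (unfold C2; ck). ring.
  - intros th ph _. cbv beta. set (w := upd _ 5 ph).
    assert (E := sphere_sq (w 4%nat) (w 5%nat)).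
    change (sw 0 w ^ 2 + sw 1 w ^ 2 + sw 2 w ^ 2 = 1) in E. unfold dphase.
    (* The symbol |sigma|^2 - 1 of the wave operator vanishes on each plane wave. *)
    transitivity (((sw 0 w ^ 2 + sw 1 w ^ 2 + sw 2 w ^ 2) - 1) * (sin (w 4%nat) * plane (PD 0 (PD 0 h)) w));
      [ring | rewrite E; ring].
Qed.

(** * Radiation fields *)

Lemma is_lim_rate (f : R -> R) (l K R0 : R) : 0 <= K ->
  (forall r, R0 <= r -> 1 <= r -> Rabs (f r - l) <= K / sqrt r) -> is_lim f p_infty l.
Proof.
  intros HK H. apply is_lim_spec. intros eps.
  exists (Rmax (Rmax R0 1) (((K + 1) / eps) ^ 2)). intros r Hr.
  assert (H1 : R0 < r) by (eapply Rle_lt_trans; [|exact Hr]; eapply Rle_trans; apply Rmax_l).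
  assert (H2 : 1 < r).
  { eapply Rle_lt_trans; [|exact Hr]. eapply Rle_trans; [apply Rmax_r | apply Rmax_l]. }
  assert (H3 : ((K + 1) / eps) ^ 2 < r) by (eapply Rle_lt_trans; [apply Rmax_r | exact Hr]).
  assert (E := cond_pos eps).
  assert (P : 0 < (K + 1) / eps) by (apply Rdiv_lt_0_compat; lra).
  assert (S : (K + 1) / eps < sqrt r).
  { rewrite <- (sqrt_pow2 ((K + 1) / eps)) by lra. apply sqrt_lt_1_alt. split; [apply pow2_ge_0 | lra]. }
  eapply Rle_lt_trans; [apply H; lra|].
  apply Rmult_lt_reg_r with (sqrt r); [lra|].
  unfold Rdiv at 1. rewrite Rmult_assoc, Rinv_l, Rmult_1_r by lra.
  apply Rmult_lt_compat_l with (r := eps) in S; [|lra].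
  replace (eps * ((K + 1) / eps)) with (K + 1) in S by (field; lra). lra.
Qed.

Section Radiation.
Context (G0 : fun4) (Hs : SmoothOn punct (homext G0)) (Hb : SymbolBound G0 2).
Context (a : R -> R) (Ha : forall k, Ck1 k (fun _ => True) a).
Context (Ca : R) (Ha_b : forall p, p < -1 -> Rabs (a p) <= Ca / - p).

(** The q-derivative of a + G0. The summand a decays only like 1 / |p|, but it does not depend on
    the direction and cancels when two directions are compared. *)
Definition profile (v : env) : R := Derive a (v 0%nat) + dq G0 v.

Lemma a_derive p : is_derive a p (Derive a p).
Proof.
  destruct (Ha 1%nat) as [_ H]. destruct (H 0%nat) as [Q _]; [lia|].
  apply Derive_correct, (Q (fun _ => p) Logic.I).
Qed.

Lemma Ck1_Derive k : Ck1 k (fun _ => True) (Derive a).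
Proof. destruct (Ha (S k)) as [_ H]. destruct (H 0%nat) as [_ Q]; [lia|]. exact Q. Qed.

Lemma Cinf_profile : Cinf 4 Punct profile.
Proof.
  intros k. assert (HU := Open_punct). apply Ck_plus; trivial.
  - apply Ck_app_all; trivial; [apply Ck1_Derive|]. apply Ck_proj; trivial; lia.
  - now apply Cinf_dq.
Qed.

Lemma Ck1_profile w1 w2 w3 k q r : w1 ^ 2 + w2 ^ 2 + w3 ^ 2 = 1 ->
  Ck1 k (fun _ => True) (fun u => profile (env4 (q - r * (1 - u)) w1 w2 w3)).
Proof.
  intros Hw. unfold Ck1. assert (HU := open1_Open _ open1_All).
  apply (Ck_env4 1 k _ Punct profile (fun v => q - r * (1 - v 0%nat)) (fun _ => w1) (fun _ => w2)
    (fun _ => w3)); ck.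
  - apply Open_punct.
  - apply Cinf_profile.
  - intros v _. unfold Punct, punct; simpl. simpl in Hw. lra.
Qed.

(** Let X = 1 + r^2 (1 - u)^2 and let n be the distance of the directions, n^2 = 2 (1 - u). Peetre's
    inequality turns the cubic decay into X^(-3/2). Since 2 y <= 1 + y^2 for y = r (1 - u), n sqrt r
    <= sqrt X, so half a power of X buys r^(-1/2) and one full Lorentz profile is left. *)
Lemma profile_difference : exists M, 0 <= M /\ forall q r w1 w2 w3 th ph, 1 <= r ->
  w1 ^ 2 + w2 ^ 2 + w3 ^ 2 = 1 ->
  let p := q - r * (1 - dot w1 w2 w3 th ph) in
  Rabs (profile (env4 p (sin th * cos ph) (sin th * sin ph) (cos th)) - profile (env4 p w1 w2 w3))
    <= M * sqrt (2 * (1 + q ^ 2)) ^ 3 / sqrt r * lor r (dot w1 w2 w3 th ph).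
Proof.
  destruct (dq_lipschitz G0 Hs Hb) as [L [HL B]]. exists L; split; trivial.
  intros q r w1 w2 w3 th ph Hr Hw p.
  assert (Sp := sphere_sq th ph).
  specialize (B p (sin th * cos ph) (sin th * sin ph) (cos th) w1 w2 w3 Sp Hw).
  assert (HD := dot_bound w1 w2 w3 th ph Hw).
  set (u := dot w1 w2 w3 th ph) in *.
  set (n := nrm _ _ _) in B.
  assert (Hn0 : 0 <= n) by apply nrm_ge0.
  assert (Hn : n * n = 2 * (1 - u)).
  { unfold n. rewrite nrm_sq.
    transitivity (((sin th * cos ph) ^ 2 + (sin th * sin ph) ^ 2 + cos th ^ 2)
      + (w1 ^ 2 + w2 ^ 2 + w3 ^ 2) - 2 * u); [unfold u, dot; ring | rewrite Sp, Hw; ring]. }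
  unfold profile. simpl env4.
  replace (Derive a p + dq G0 (env4 p (sin th * cos ph) (sin th * sin ph) (cos th))
           - (Derive a p + dq G0 (env4 p w1 w2 w3)))
    with (dq G0 (env4 p (sin th * cos ph) (sin th * sin ph) (cos th)) - dq G0 (env4 p w1 w2 w3))
    by ring.
  eapply Rle_trans; [exact B|].
  set (X := 1 + r ^ 2 * (1 - u) ^ 2).
  assert (HX : 0 < X) by apply lor_den.
  assert (Sr : 0 < sqrt r) by (apply sqrt_lt_R0; lra).
  assert (Sr2 : sqrt r * sqrt r = r) by (apply sqrt_sqrt; lra).
  assert (SX : 0 < sqrt X) by (now apply sqrt_lt_R0).
  assert (SX2 : sqrt X * sqrt X = X) by (apply sqrt_sqrt; lra).
  assert (J := jb_ge1 p).
  set (A := sqrt (2 * (1 + q ^ 2))).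
  assert (HA : 0 <= A) by apply sqrt_pos.
  assert (K1 : sqrt X <= A * jb p).
  { unfold A, jb. rewrite <- sqrt_mult_alt by nra. apply sqrt_le_1_alt.
    replace X with (1 + (q - p) ^ 2) by (unfold X, p; ring). apply peetre2. }
  assert (K2 : n * sqrt r <= sqrt X).
  { apply Rsqr_incr_0_var; [|lra]. unfold Rsqr.
    replace (n * sqrt r * (n * sqrt r)) with ((n * n) * (sqrt r * sqrt r)) by ring.
    rewrite SX2, Sr2, Hn. unfold X. generalize (pow2_ge_0 (1 - r * (1 - u))); lra. }
  assert (K3 : n * sqrt r * X <= (A * jb p) ^ 3).
  { apply Rle_trans with (sqrt X ^ 3).
    - rewrite <- SX2 at 1. replace (sqrt X ^ 3) with (sqrt X * (sqrt X * sqrt X)) by ring.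
      apply Rmult_le_compat_r; nra.
    - apply pow_incr; lra. }
  unfold lor. fold X.
  assert (J3 : 0 < jb p ^ 3) by (apply pow_lt; lra).
  apply Rmult_le_reg_r with (sqrt r * X * jb p ^ 3).
  { repeat apply Rmult_lt_0_compat; lra. }
  replace (L * n / jb p ^ 3 * (sqrt r * X * jb p ^ 3)) with (L * (n * sqrt r * X)) by (field; lra).
  replace (L * A ^ 3 / sqrt r * / X * (sqrt r * X * jb p ^ 3)) with (L * (A * jb p) ^ 3)
    by (field; lra).
  now apply Rmult_le_compat_l.
Qed.

Lemma free_wave_limit q w1 w2 w3 : w1 ^ 2 + w2 ^ 2 + w3 ^ 2 = 1 ->
  exists K R0, 0 <= K /\ forall r, R0 <= r -> 1 <= r ->
    Rabs (r * free_wave profile (r - q) (r * w1) (r * w2) (r * w3) - (a q + G0 q w1 w2 w3))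
      <= K / sqrt r.
Proof.
  intros Hw.
  destruct profile_difference as [M0 [HM0 B]].
  destruct (SymbolBound_homext G0 2 2 ltac:(simpl; lra) Hb) as [Cg [HCg Bg]].
  assert (HCa : 0 <= Ca).
  { assert (A := Ha_b (-2) ltac:(lra)).
    replace (Ca / - -2) with (Ca / 2) in A by field. generalize (Rabs_pos (a (-2))). lra. }
  set (M := M0 * sqrt (2 * (1 + q ^ 2)) ^ 3).
  assert (HM : 0 <= M) by (apply Rmult_le_pos; trivial; apply pow_le, sqrt_pos).
  assert (PP := PI_RGT_0).
  (* The threshold makes the antipodal phase q - 2 r smaller than both -1 and -r. The summands of K
     bound a and G0 at that phase and the error in the direction. *)
  exists (Ca + Cg + M * PI / 2), (Rabs q + 2); split.
  { assert (0 <= M * PI) by (apply Rmult_le_pos; lra). lra. }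
  intros r Hr Hr1.
  assert (Sr : 0 < sqrt r) by (apply sqrt_lt_R0; lra).
  assert (Sr2 : sqrt r * sqrt r = r) by (apply sqrt_sqrt; lra).
  assert (Sr1 : 1 <= sqrt r) by (rewrite <- sqrt_1; now apply sqrt_le_1_alt).
  set (hw := fun u => profile (env4 (q - r * (1 - u)) w1 w2 w3)).
  set (Gw := fun p => a p + homext G0 p w1 w2 w3).
  (* With the amplitude frozen at the direction w, the integrand depends on u alone and has this
     primitive. Archimedes' theorem evaluates it at u = 1, phase q, and at u = -1, phase q - 2 r. *)
  set (Hh := fun u => / r * Gw (q - r * (1 - u))).
  assert (Cw : forall k, Ck1 k (fun _ => True) hw) by (intros; now apply Ck1_profile).
  assert (DH : forall u, is_derive Hh u (hw u)).
  { intros u.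
    assert (DG : forall p, is_derive Gw p (profile (env4 p w1 w2 w3))).
    { intros p. apply (is_derive_plus a); [apply a_derive|].
      assert (Pt : Punct (env4 p w1 w2 w3)).
      { unfold Punct, punct; simpl. simpl in Hw. lra. }
      apply (is_derive_ext (fun s => lift (homext G0) (upd (env4 p w1 w2 w3) 0 s))).
      { intros s. now destruct (upd_env4 p w1 w2 w3 s) as [-> _]. }
      apply (Ck_is_derive 4 0 Punct (lift (homext G0)) 0); trivial; [|lia].
      now apply SmoothOn_Cinf. }
    eapply is_derive_eq.
    - apply (is_derive_scal (fun u => Gw (q - r * (1 - u)))).
      apply (is_derive_comp Gw (fun u => q - r * (1 - u)) u
        (profile (env4 (q - r * (1 - u)) w1 w2 w3)) r); [apply DG|].
      auto_derive; trivial; ring.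
    - unfold hw, scal; simpl; unfold mult; simpl. field; lra. }
  set (f := fun th ph => sin th * profile (env4 (q - r * (1 - dot w1 w2 w3 th ph))
      (sin th * cos ph) (sin th * sin ph) (cos th))).
  assert (Ef : SI 4 (fun w => sin (w 4%nat) * plane profile w)
        (env4 (r - q) (r * w1) (r * w2) (r * w3)) = DI f).
  { rewrite SI_DI. apply DI_ext; intros th ph _. unfold f, plane, upd, sw, sv, env3; cbn.
    do 3 f_equal. unfold phase, dot, sw, sv, env3; cbn. ring. }
  assert (Cf : C2 0 f).
  { assert (C6 : Ck 6 0 All (fun w => sin (w 4%nat) * plane profile w)).
    { ck. apply Cinf_plane, Cinf_profile. }
    apply (C2_slice 4 0 _ (env4 (r - q) (r * w1) (r * w2) (r * w3))) in C6.
    apply Ck_ext with (3 := C6); [apply Open_All|]. intros v _.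
    unfold f, plane, upd, sw, sv, env3; cbn. do 3 f_equal. unfold phase, dot, sw, sv, env3; cbn. ring. }
  set (g := fun th ph => hw (dot w1 w2 w3 th ph) * sin th).
  assert (Cg' : C2 0 g) by (apply C2_dot, Cw).
  assert (Edf : DI f = DI g + DI (fun th ph => f th ph + -1 * g th ph)).
  { rewrite <- DI_plus; trivial; [|unfold C2; ck]. apply DI_ext; intros; ring. }
  assert (Eg : DI g = 2 * PI * (Hh 1 - Hh (-1))) by (apply hat_box; trivial).
  assert (Cl : C2 0 (fun th ph => lor r (dot w1 w2 w3 th ph) * sin th)) by apply C2_dot, Ck1_lor.
  assert (Err : Rabs (DI (fun th ph => f th ph + -1 * g th ph)) <= M / sqrt r * (PI ^ 2 / r)).
  { eapply Rle_trans.
    - apply (DI_abs _ (fun th ph => M / sqrt r * (lor r (dot w1 w2 w3 th ph) * sin th))).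
      + unfold C2; ck.
      + unfold C2; ck.
      + intros th ph Hth. assert (St : 0 <= sin th) by (apply sin_ge_0; lra).
        specialize (B q r w1 w2 w3 th ph Hr1 Hw). cbv zeta in B. fold M in B.
        unfold f, g, hw. set (p := q - r * (1 - dot w1 w2 w3 th ph)) in *.
        replace (sin th * profile (env4 p (sin th * cos ph) (sin th * sin ph) (cos th))
            + -1 * (profile (env4 p w1 w2 w3) * sin th))
          with (sin th * (profile (env4 p (sin th * cos ph) (sin th * sin ph) (cos th))
             - profile (env4 p w1 w2 w3))) by ring.
        rewrite Rabs_mult, (Rabs_pos_eq _ St).
        replace (M / sqrt r * (lor r (dot w1 w2 w3 th ph) * sin th))
          with (sin th * (M / sqrt r * lor r (dot w1 w2 w3 th ph))) by ring.
        now apply Rmult_le_compat_l.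
    - rewrite DI_scal by trivial. apply Rmult_le_compat_l.
      + apply Rmult_le_pos; trivial. left; now apply Rinv_0_lt_compat.
      + apply lor_integral; trivial; lra. }
  set (E := DI (fun th ph => f th ph + -1 * g th ph)) in *.
  assert (Tail : Rabs (Gw (q - 2 * r)) <= (Ca + Cg) / sqrt r).
  { assert (Q := Rle_abs q).
    assert (Pr : r <= - (q - 2 * r)) by lra.
    assert (T1 := Ha_b (q - 2 * r) ltac:(lra)).
    assert (N1 : nrm w1 w2 w3 <> 0) by (apply Rgt_not_eq, nrm_pos; lra).
    assert (T2 := Bg (q - 2 * r) w1 w2 w3 N1).
    assert (I1 : / - (q - 2 * r) <= / sqrt r) by (apply Rinv_le_contravar; nra).
    assert (I2 : / jb (q - 2 * r) ^ 2 <= / sqrt r).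
    { apply Rinv_le_contravar; trivial.
      replace (jb (q - 2 * r) ^ 2) with (1 + (q - 2 * r) ^ 2) by (rewrite <- jb_sq; ring). nra. }
    unfold Gw. eapply Rle_trans; [apply Rabs_triang|].
    unfold Rdiv in *. rewrite Rmult_plus_distr_r.
    apply Rplus_le_compat.
    - eapply Rle_trans; [exact T1 | now apply Rmult_le_compat_l].
    - eapply Rle_trans; [exact T2 | now apply Rmult_le_compat_l]. }
  unfold free_wave, of_env. rewrite Ef, Edf, Eg.
  replace (r * (/ (2 * PI) * (2 * PI * (Hh 1 - Hh (-1)) + E)) - (a q + G0 q w1 w2 w3))
    with (- Gw (q - 2 * r) + r / (2 * PI) * E).
  2:{ unfold Hh. replace (q - r * (1 - 1)) with q by ring.
      replace (q - r * (1 - -1)) with (q - 2 * r) by ring.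
      replace (Gw q) with (a q + G0 q w1 w2 w3).
      - field. split; lra.
      - unfold Gw. now rewrite homext_unit. }
  eapply Rle_trans; [apply Rabs_triang|]. rewrite Rabs_Ropp, Rabs_mult.
  rewrite (Rabs_pos_eq (r / (2 * PI))) by (apply Rlt_le, Rdiv_lt_0_compat; lra).
  replace ((Ca + Cg + M * PI / 2) / sqrt r)
    with ((Ca + Cg) / sqrt r + r / (2 * PI) * (M / sqrt r * (PI ^ 2 / r))) by (field; lra).
  apply Rplus_le_compat; trivial. apply Rmult_le_compat_l; trivial.
  apply Rlt_le, Rdiv_lt_0_compat; lra.
Qed.
End Radiation.

Lemma box_plus f g t x y z : Cinf 4 All (lift f) -> Cinf 4 All (lift g) ->
  box (fun t x y z => f t x y z + g t x y z) t x y z = box f t x y z + box g t x y z.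
Proof.
  intros F G.
  assert (P1 : forall i (f g : env -> R), (i < 4)%nat -> Cinf 4 All f -> Cinf 4 All g ->
     PD i (fun v => f v + g v) = (fun v => PD i f v + PD i g v)).
  { intros i f' g' Hi Hf Hg. apply functional_extensionality; intros v.
    apply is_derive_unique. apply @is_derive_plus; apply (Ck_is_derive 4 0 All); auto; easy. }
  assert (P2 : forall i (f : fun4) t x y z,
    pd i (pd i f) t x y z = PD (idx i) (PD (idx i) (lift f)) (env4 t x y z)).
  { intros i f' a b c d. rewrite <- !lift_pd. reflexivity. }
  unfold box. rewrite !P2. unfold idx.
  change (lift (fun t x y z => f t x y z + g t x y z)) with (fun v => lift f v + lift g v).
  rewrite !(P1 _ (lift f) (lift g)) by (trivial; lia).
  rewrite !P1 by (try (apply Cinf_D; trivial); lia). ring.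
Qed.

Theorem theorem1p2
  (chi chi_neg : R -> R)
  (Hchi_s : Smooth1 chi)
  (Hchi_1 : forall s, s < 1/4 -> chi s = 1)
  (Hchi_0 : forall s, s > 1/2 -> chi s = 0)
  (Hneg_s : Smooth1 chi_neg)
  (Hneg_1 : forall s, s < -1 -> chi_neg s = 1)
  (Hneg_0 : forall s, s > 0 -> chi_neg s = 0)
  (gam : R) (Hgam : 1/2 <= gam < 1)
  (m : fun4)
  (Hm_s : SmoothOn punct (homext m))
  (Hm_b : SymbolBound m (1 + 2 * gam))
  (Q : R -> R -> R -> R)
  (HQ_s : SmoothOn punct (homext (sph Q)))
  (HQ : forall w1 w2 w3, w1 ^ 2 + w2 ^ 2 + w3 ^ 2 = 1 ->
          lapS Q w1 w2 w3 =
          - intR (fun q => m q w1 w2 w3)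
          + / (4 * PI) * sphere_int (fun s1 s2 s3 => intR (fun q => m q s1 s2 s3)))
  (G0t : fun4)
  (HG_s : SmoothOn punct (homext G0t))
  (HG_b : SymbolBound G0t 2)
  (HG_int : forall w1 w2 w3, w1 ^ 2 + w2 ^ 2 + w3 ^ 2 = 1 ->
          intR (fun q => G0t q w1 w2 w3) = Q w1 w2 w3) :
  exists phi : fun4,
    SmoothOn (fun _ _ _ _ => True) phi /\
    (forall t x y z, 0 < nrm x y z ->
       box phi t x y z
       + m (nrm x y z - t) (x / nrm x y z) (y / nrm x y z) (z / nrm x y z)
         / (nrm x y z ^ 3) * chi (jb (t - nrm x y z) / nrm x y z) = 0) /\
    (forall q w1 w2 w3, w1 ^ 2 + w2 ^ 2 + w3 ^ 2 = 1 ->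
       is_lim (fun r => r * phi (r - q) (r * w1) (r * w2) (r * w3)) p_infty
         (/ (4 * PI) * sphere_int (fun s1 s2 s3 => intR (fun q' => m q' s1 s2 s3))
            * / jb q * chi_neg q + G0t q w1 w2 w3)).
Proof.
  set (Mb := / (4 * PI) * sphere_int (fun s1 s2 s3 => intR (fun q => m q s1 s2 s3))).
  set (a := fun p => Mb * / jb p * chi_neg p).
  assert (Ha : forall k, Ck1 k (fun _ => True) a).
  { intros k. unfold Ck1, a. assert (HU := open1_Open _ open1_All).
    assert (HJ : Ck1 k (fun _ => True) jb) by apply Ck1_jb.
    assert (HN : Ck1 k (fun _ => True) chi_neg) by now apply Smooth1_Ck1.
    apply Ck_mult; trivial. apply Ck_mult; trivial; [now apply Ck_const|].
    apply Ck_inv; trivial. intros v _. generalize (jb_ge1 (v 0%nat)); lra. }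
  assert (Hab : forall p, p < -1 -> Rabs (a p) <= Rabs Mb / - p).
  { intros p Hp. unfold a. rewrite Hneg_1, Rmult_1_r, Rabs_mult by trivial.
    apply Rmult_le_compat_l; [apply Rabs_pos|].
    assert (J := jb_ge1 p). assert (J2 := jb_sq p).
    rewrite Rabs_inv, Rabs_pos_eq by lra. apply Rinv_le_contravar; nra. }
  destruct (cutoff_bounded chi Hchi_s Hchi_1 Hchi_0) as [Cc HCc].
  (* The lower bound 1/2 on gam gives decay of order at least 2 for m. *)
  destruct (SymbolBound_homext m (1 + 2 * gam) 2 ltac:(simpl; lra) Hm_b) as [Cm [_ HCm]].
  set (u := free_wave (profile G0t a)).
  set (v := advanced chi m).
  assert (Cu : Cinf 4 All (lift u)) by (apply free_wave_smooth, Cinf_profile; trivial).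
  assert (Cv : Cinf 4 All (lift v)) by now apply advanced_smooth.
  exists (fun t x y z => u t x y z + v t x y z). split; [|split].
  - apply Cinf_SmoothOn. intros k. apply Ck_plus; [apply Open_All | apply Cu | apply Cv].
  - intros t x y z _. rewrite box_plus by trivial.
    unfold u, v. rewrite box_free_wave by (now apply Cinf_profile).
    rewrite box_advanced by trivial. unfold source, psi.
    (* The equation has t - |x| in the cutoff and [psi] has |x| - t; [jb] is even. *)
    rewrite <- (jb_opp (t - nrm x y z)), Ropp_minus_distr, Rmult_1_r. unfold homext. ring.
  - intros q w1 w2 w3 Hw.
    destruct (free_wave_limit G0t HG_s HG_b a Ha (Rabs Mb) Hab q w1 w2 w3 Hw)
      as [K [R0 [HK B]]].
    set (D := Rabs (54 * Cm * Cc * (1 + q ^ 2) * PI / 4)).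
    (* The free wave converges at the rate r^(-1/2); the rate 1 / r of the advanced potential, valid
       once r >= 2 |q|, is weakened to match. *)
    apply (is_lim_rate _ _ (K + D) (Rmax R0 (2 * Rabs q))).
    + generalize (Rabs_pos (54 * Cm * Cc * (1 + q ^ 2) * PI / 4)). fold D; lra.
    + intros r Hr Hr1.
      assert (R1 : R0 <= r) by (eapply Rle_trans; [apply Rmax_l | exact Hr]).
      assert (R2 : 2 * Rabs q <= r) by (eapply Rle_trans; [apply Rmax_r | exact Hr]).
      specialize (B r R1 Hr1). fold u in B.
      assert (A := advanced_decay chi Hchi_s Hchi_0 m Hm_s Cc HCc Cm HCm r q w1 w2 w3 Hw Hr1 R2).
      fold v in A.
      match goal with |- Rabs ?X <= _ =>
        replace X with ((r * u (r - q) (r * w1) (r * w2) (r * w3) - (a q + G0t q w1 w2 w3))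
          + r * v (r - q) (r * w1) (r * w2) (r * w3)) by (unfold a; ring) end.
      eapply Rle_trans; [apply Rabs_triang|].
      unfold Rdiv at 1. rewrite Rmult_plus_distr_r. apply Rplus_le_compat; [exact B|].
      eapply Rle_trans; [exact A|].
      assert (Sr1 : 1 <= sqrt r) by (rewrite <- sqrt_1; now apply sqrt_le_1_alt).
      assert (Sr2 : sqrt r * sqrt r = r) by (apply sqrt_sqrt; lra).
      apply Rle_trans with (D * / r).
      * apply Rmult_le_compat_r; [left; apply Rinv_0_lt_compat; lra | apply Rle_abs].
      * apply Rmult_le_compat_l; [apply Rabs_pos|]. apply Rinv_le_contravar; nra.
Qed.
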